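(* Let $\Omega\subset\mathbb{R}^d$ be an open set, let $P(D)$ be a first-order differential operator of the form $P(D)\mu=\sum_{i=1}^d P_i[\partial_i\mu]+P_0\mu$ with $P_0,P_1,\dots,P_d\in F\otimes E$, where $E,F$ are finite dimensional euclidean spaces, and let $\mu\in\mathcal{M}(\Omega;E)$ be a solution of the equation $$P(D)\mu=0\quad\text{in the sense of distributions on }\Omega.$$ Then $$\dim_{\mathcal H}(|\mu|)\ \ge\ \ell_{\mathbb P}.$$ Moreover, this estimate is sharp since the measure $$\mu=e\,\mathcal{H}^{\ell_{\mathbb P}}\llcorner\{\mathbb P[e]\equiv 0\}^{\perp}$$ is a solution, in the sense of distributions, of the equation $P(D)\mu=\sum_{i=1}^d P_i[\partial_i\mu]+P_0\mu=0$ on $\mathbb{R}^d$, whenever $e\in E$ is any vector at which the minimum defining $\ell_{\mathbb P}$ is attained.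
   Context: The elements $P_0,P_i\in F\otimes E$ are regarded as linear maps $E\to F$ with constant coefficients. $\mathcal{M}(\Omega;E)\cong C_c(\Omega;E)^*$ denotes the space of $E$-valued Radon measures on $\Omega$, and $|\mu|$ is the total variation measure of $\mu$. $\mathcal{H}^\kappa$ is the $\kappa$-dimensional Hausdorff measure on $\mathbb{R}^d$, and $\llcorner$ denotes restriction of a measure to a set. For a positive Radon measure $\sigma$, $\dim_{\mathcal H}(\sigma):=\sup\{0\le\kappa\le d : \sigma\ll\mathcal{H}^\kappa\}$. The principal symbol of $P(D)$ is the linear map $\xi\mapsto\mathbb{P}(\xi):=\sum_{i=1}^d\xi_iP_i$, $\xi\in\mathbb{R}^d$. For $e\in E$, $\{\mathbb P[e]\equiv 0\}:=\{\xi\in\mathbb{R}^d : \mathbb P(\xi)[e]=0\}$, a linear subspace of $\mathbb{R}^d$ whose orthogonal complement is $\{\mathbb P[e]\equiv 0\}^\perp$. Finally, $\ell_{\mathbb P}:=\min_{e\in E\setminus\{0\}}\dim\big(\{\mathbb P[e]\equiv 0\}^\perp\big)$.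
   Formalization: The claim that the displayed measure solves P(D)μ=0 is proved under the added hypothesis P_0[e]=0; without it the claim is false, since P(D)μ=P_0[e]H^ℓ⌞{P[e]≡0}^⊥ (e.g. μ'+μ=0 on the line with Lebesgue measure). *)

(* Defs.v *)
From HB Require Import structures.
From mathcomp Require Import all_boot all_order all_algebra.
From mathcomp Require Import all_classical all_reals all_analysis.

Set Implicit Arguments.
Unset Strict Implicit.
Unset Printing Implicit Defensive.

Import Order.TTheory GRing.Theory Num.Theory.
Import numFieldNormedType.Exports.

Local Open Scope classical_set_scope.
Local Open Scope ring_scope.

(* Euclidean spaces are coordinatised: R^d is 'rV[R]_d, E is 'cV[R]_m, F is
   'cV[R]_k, and an element of F \otimes E is a matrix 'M[R]_(k, m) acting on
   column vectors.  The library norm of a matrix is the sup norm; it is only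
   used through its topology, and the metric notions below use [enorm]. *)

Section Euclidean.
Context {R : realType}.

Definition enorm p q (x : 'M[R]_(p, q)) : R :=
  Num.sqrt (\sum_i \sum_j x i j ^+ 2).

Definition dotp d (x y : 'rV[R]_d) : R := \sum_i x 0 i * y 0 i.

Definition orthv_map d (U : {vspace 'rV[R]_d}) (x : 'rV[R]_d) :
  'rV[R]_(\dim U) := \row_i dotp x (vbasis U)`_i.

Fact orthv_map_is_linear d (U : {vspace 'rV[R]_d}) : linear (orthv_map U).
Proof.
move=> a x y; apply/rowP => i; rewrite !mxE /dotp mulr_sumr -big_split /=.
by apply: eq_bigr => j _; rewrite !mxE mulrDl mulrA.
Qed.

HB.instance Definition _ d (U : {vspace 'rV[R]_d}) :=
  GRing.isLinear.Build R 'rV[R]_d 'rV[R]_(\dim U) *:%R (orthv_map U)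
    (orthv_map_is_linear U).

(* The orthogonal complement; see [memv_orthv]. *)
Definition orthv d (U : {vspace 'rV[R]_d}) : {vspace 'rV[R]_d} :=
  lker (linfun (orthv_map U)).

Lemma memv_orthv d (U : {vspace 'rV[R]_d}) (x : 'rV[R]_d) :
  x \in orthv U <-> (forall y, y \in U -> dotp x y = 0).
Proof.
have dotp_sumr n (c : 'I_n -> R) (v : 'I_n -> 'rV[R]_d) :
    dotp x (\sum_i c i *: v i) = \sum_i c i * dotp x (v i).
  transitivity (\sum_j \sum_i c i * (x 0 j * v i 0 j)).
    apply: eq_bigr => j _; rewrite summxE mulr_sumr.
    by apply: eq_bigr => i _; rewrite mxE mulrCA.
  by rewrite exchange_big /=; apply: eq_bigr => i _; rewrite -mulr_sumr.
rewrite memv_ker lfunE /=; split=> [/eqP x0 y yU|xU].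
  rewrite (coord_vbasis yU) dotp_sumr big1// => i _.
  by have /rowP/(_ i) := x0; rewrite !mxE => ->; rewrite mulr0.
apply/eqP/rowP => i; rewrite !mxE; apply: xU.
by apply: vbasis_mem; rewrite mem_nth// size_tuple.
Qed.

End Euclidean.

Section Symbol.
Context {R : realType} {d m k : nat}.
Implicit Types (P : 'I_d -> 'M[R]_(k, m)) (e : 'cV[R]_m).

Definition symbol P (xi : 'rV[R]_d) : 'M[R]_(k, m) := \sum_i xi 0 i *: P i.

Definition symbol_at P e (xi : 'rV[R]_d) : 'cV[R]_k := symbol P xi *m e.

Fact symbol_at_is_linear P e : linear (symbol_at P e).
Proof.
move=> a x y; rewrite /symbol_at scalemxAl -mulmxDl; congr (_ *m _).
rewrite /symbol scaler_sumr -big_split /=.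
by apply: eq_bigr => i _; rewrite !mxE scalerDl scalerA.
Qed.

HB.instance Definition _ P e :=
  GRing.isLinear.Build R 'rV[R]_d 'cV[R]_k *:%R (symbol_at P e)
    (symbol_at_is_linear P e).

(* The subspace {P[e] = 0} of R^d; see [memv_symbol_ker]. *)
Definition symbol_ker P e : {vspace 'rV[R]_d} := lker (linfun (symbol_at P e)).

Lemma memv_symbol_ker P e xi :
  xi \in symbol_ker P e <-> symbol P xi *m e = 0.
Proof. by rewrite memv_ker lfunE /=; split => /eqP. Qed.

Definition symbol_ker_perp P e : {vspace 'rV[R]_d} := orthv (symbol_ker P e).

(* The minimum over e != 0 of the dimension of {P[e] = 0}^\perp; see
   [ell_le] and [ell_attained].  In the degenerate case E = 0, where there is
   nothing to minimise over, the value is d. *)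
Definition ell P : nat :=
  \big[Order.min/d]_(n < d.+1 |
    `[< exists2 e, e != 0 & \dim (symbol_ker_perp P e) = n >]) (n : nat).

Lemma ell_le P e : e != 0 -> (ell P <= \dim (symbol_ker_perp P e))%N.
Proof.
move=> e0; have dim_lt : (\dim (symbol_ker_perp P e) < d.+1)%N.
  by rewrite ltnS (leq_trans (dimvS (subvf _)))// dimvf /dim /= mul1n.
have : `[< exists2 e, e != 0 & \dim (symbol_ker_perp P e) =
    Ordinal dim_lt >] by apply/asboolP; exists e.
by rewrite -leEnat; exact: (@bigmin_le_cond _ nat _ d).
Qed.

Lemma ell_attained P : (0 < m)%N ->
  exists2 e, e != 0 & \dim (symbol_ker_perp P e) = ell P.
Proof.
move=> m0; have e0 : (const_mx 1 : 'cV[R]_m) != 0.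
  apply/eqP => /colP/(_ (Ordinal m0)); rewrite !mxE => /eqP.
  by rewrite oner_eq0.
pose Q n := n = d \/ exists2 e, e != 0 & \dim (symbol_ker_perp P e) = n.
have [elld|//] : Q (ell P).
  rewrite /ell; apply: (big_ind Q) => [|x y Qx Qy|n /asboolP ?].
  - by left.
  - by rewrite /Order.min; case: ifP.
  - by right.
exists (const_mx 1) => //; apply/eqP; rewrite eqn_leq ell_le// andbT elld.
by rewrite (leq_trans (dimvS (subvf _)))// dimvf /dim /= mul1n.
Qed.

End Symbol.

Section Hausdorff.
Context {R : realType} {d : nat}.
Implicit Types (A : set 'rV[R]_d) (kappa delta : R).
Local Open Scope ereal_scope.

Definition ediam A : \bar R :=
  ereal_sup [set (enorm (x - y))%:E | x in A & y in A].

(* 0^0 = 1, so H^0 is the counting measure; the empty set weighs 0. *)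
Definition ediam_pow kappa A : \bar R :=
  if `[< A = set0 >] then 0 else poweR (ediam A) kappa.

Definition hausdorff_delta kappa delta A : \bar R :=
  ereal_inf [set \sum_(0 <= i <oo) ediam_pow kappa (U i) | U in
    [set U : nat -> set 'rV[R]_d |
      A `<=` \bigcup_i U i /\ forall i, ediam (U i) <= delta%:E]].

(* Without the dimensional factor omega_kappa / 2^kappa, hence a positive
   constant multiple of the other common normalisation. *)
Definition hausdorff kappa A : \bar R :=
  ereal_sup [set hausdorff_delta kappa delta A | delta in
    [set delta | (0 < delta)%R]].

End Hausdorff.

Section Radon.
Context {R : realType} {d m : nat}.
Implicit Types (Omega A B : set 'rV[R]_d) (mu : set 'rV[R]_d -> 'cV[R]_m).

Definition borelRV := g_sigma_algebraType (@open 'rV[R]_d).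

Definition relcompact Omega A : Prop :=
  measurable (A : set borelRV) /\
  exists K, [/\ compact K, K `<=` Omega & A `<=` K].

(* An E-valued Radon measure on Omega, possibly of infinite total mass, is a
   set function on the Borel sets that are contained in a compact subset of
   Omega, countably additive on the Borel subsets of each compact K \subset
   Omega.  Its values on other sets are never used. *)
Definition vector_radon Omega mu : Prop :=
  forall A : nat -> set 'rV[R]_d,
    (forall n, measurable (A n : set borelRV)) -> trivIset setT A ->
    relcompact Omega (\bigcup_n A n) ->
    (fun n => \sum_(i < n) mu (A i)) @ \oo --> mu (\bigcup_n A n).

Definition radon_variation Omega mu (A : set borelRV) : \bar R :=
  ereal_sup [set r | exists n, exists B : 'I_n -> set 'rV[R]_d,
    [/\ forall i, relcompact Omega (B i) /\ B i `<=` A,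
        trivIset setT B &
        r = (\sum_i enorm (mu (B i)))%:E]].

Definition upper_variation Omega (nu : set 'rV[R]_d -> R) (A : set borelRV) :
    \bar R :=
  ereal_sup [set (nu B)%:E | B in [set B | relcompact Omega B /\ B `<=` A]].

Definition signed_integral Omega (nu : set 'rV[R]_d -> R)
    (phi : 'rV[R]_d -> R) : R :=
  fine (\int[upper_variation Omega nu]_(x in [set: borelRV]) (phi x)%:E) -
  fine (\int[upper_variation Omega (fun B => - nu B)]_(x in [set: borelRV])
          (phi x)%:E).

Definition vector_integral Omega mu (phi : 'rV[R]_d -> R) : 'cV[R]_m :=
  \col_i signed_integral Omega (fun B => mu B i 0) phi.

Definition hdim (sigma : set borelRV -> \bar R) : R :=
  sup [set kappa : R | 0 <= kappa <= d%:R /\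
    sigma `<< (hausdorff kappa : set borelRV -> \bar R)].

(* e H^l restricted to V, where H^l is finite on bounded subsets of V *)
Definition hausdorff_on (l : nat) (V : set 'rV[R]_d) (e : 'cV[R]_m)
    (A : set 'rV[R]_d) : 'cV[R]_m :=
  fine (hausdorff l%:R (A `&` V)) *: e.

End Radon.
Arguments borelRV : clear implicits.

Section Distributions.
Context {R : realType} {d m k : nat}.
Implicit Types (Omega : set 'rV[R]_d) (phi : 'rV[R]_d -> R).

Definition partial (i : 'I_d) phi : 'rV[R]_d -> R :=
  fun x => 'D_(delta_mx 0 i) phi x.

Definition smooth phi : Prop := forall s : seq 'I_d,
  let g := foldr partial phi s in
  continuous g /\ forall i x, derivable g x (delta_mx 0 i).

Definition test_function Omega phi : Prop :=
  let supp := closure [set x | phi x != 0] in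
  [/\ smooth phi, compact supp & supp `<=` Omega].

(* The F-valued distribution P(D) mu paired with scalar test functions, with
   <d_i mu, phi> = - \int d_i phi d mu. *)
Definition solves Omega (P0 : 'M[R]_(k, m)) (P : 'I_d -> 'M[R]_(k, m))
    (mu : set 'rV[R]_d -> 'cV[R]_m) : Prop :=
  forall phi, test_function Omega phi ->
    \sum_i P i *m (- vector_integral Omega mu (partial i phi)) +
    P0 *m vector_integral Omega mu phi = 0.

End Distributions.

(* Main.v *)
Require Import Defs.
From HB Require Import structures.
From mathcomp Require Import all_boot all_order all_algebra.
From mathcomp Require Import all_classical all_reals all_analysis.
From mathcomp Require Import measurable_realfun.
From mathcomp Require Import ring lra.
Import Order.TTheory GRing.Theory Num.Theory.
Import numFieldNormedType.Exports.
Set Implicit Arguments.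
Unset Strict Implicit.
Unset Printing Implicit Defensive.
Local Open Scope classical_set_scope.
Local Open Scope ring_scope.

(** Lower bound.  Near a point, [mu] is a density f with values in E times a finite
    measure la, and f vanishes almost nowhere ([local_density]).  At a Lebesgue
    point x of f ([lebesgue_points]), on small balls around x, [mu] is nearly e la
    with e = f(x) different from 0, so the equation nearly says that the
    derivatives of la along the rows of the matrix of xi |-> P(xi)[e] vanish; the
    term with P_0 is of lower order.  These rows span V = {P[e] = 0}^perp, of
    dimension n >= ell.  A measure with vanishing derivatives along V satisfies
    la(B(x, eta r)) <= C eta^ell la(B(x, r)).  This is proved by pairing the equation
    with the field pi_V(y - x) psi((y - x) / r), where psi is a regularisation of
    |y|^-ell with a cut-off: its divergence is nonnegative up to the bounded
    contribution of the cut-off, and is of size eta^-ell on the ball of radius eta r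
    ([test_field_of_rank]).  The true equation gives the same estimate with
    la(B(x, 3 r)) on the right ([decay_at_point]), as only a Vitali covering
    argument with enlarged balls is available for a general measure.  Iteration
    over scales loses an arbitrarily small power: la(B(x, r)) <= C r^kappa for each
    kappa < ell ([geometric_decay]).  By the mass distribution principle
    ([mass_distribution]) la, hence the variation of [mu], vanishes on sets that
    are null for the kappa-dimensional Hausdorff measure.

    Sharpness.  Let V = {P[e] = 0}^perp have dimension n = ell.  The n-dimensional
    Hausdorff measure is a Borel measure ([caratheodory_borel]), translation
    invariant, finite on bounded subsets of V (cover by a grid), and positive on
    large bounded pieces of V (count grid points, [hausdorff_cube_gt0]), whereas the
    kappa-dimensional one vanishes on V for kappa > n.  This gives the Radon
    property and the dimension of [e H^n] on V.  For the equation, put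
    s_i = int_V d_i phi dH^n.  Then P(D) mu paired with phi is - P(s)[e] as
    P_0 e = 0, and each component of P(s)[e] is the integral over V of a derivative
    of phi along a vector of V, which is 0 by translation invariance
    ([integral_directional_eq0]). *)

(** * Directional derivatives and smooth functions *)

Section DirectionalDerivatives.
Context {R : realType} {V : normedModType R}.
Implicit Types (f g : V -> R) (x v : V).

Lemma is_derive1P f x v df :
  is_derive x v f df <-> is_derive (0 : R) 1 (fun h : R => f (h *: v + x)) df.
Proof.
have E : 'D_v f x = 'D_1 (fun h : R => f (h *: v + x)) 0.
  rewrite /derive; set g1 := fun h => h^-1 *: _; set g2 := fun h => h^-1 *: _.
  suff -> : g1 = g2 by [].
  by rewrite funeqE /g1 /g2 => h /=; rewrite addr0 scale0r add0r [_%:A]mulr1.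
split=> -[fx fE]; split.
- exact: (iffLR (derivable1P f x v) fx).
- by rewrite -E.
- exact: (iffRL (derivable1P f x v) fx).
- by rewrite E.
Qed.

Lemma is_derive_comp_real (g : R -> R) f x v dg df :
  is_derive (f x) 1 g dg -> is_derive x v f df ->
  is_derive x v (fun y => g (f y)) (dg * df).
Proof.
move=> gx /is_derive1P fx; apply/is_derive1P.
have gx' : is_derive (f (0 *: v + x)) (1 : R) g dg by rewrite scale0r add0r.
exact: (is_derive_eq (@is_derive1_comp R g _ 0 _ _ gx' fx)).
Qed.

Lemma is_derive_along f v (df : V -> R) :
  (forall x, is_derive x v f (df x)) ->
  forall x (t : R), is_derive t 1 (fun h : R => f (h *: v + x)) (df (t *: v + x)).
Proof.
move=> fv x t; have /is_derive1P h0 := fv (t *: v + x).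
have -> : (fun h : R => f (h *: v + x)) =
    (fun h : R => (fun h : R => f (h *: v + (t *: v + x))) (h - t)).
  by apply/funext => h /=; rewrite addrA -scalerDl subrK.
have ht : is_derive (t - t) (1 : R) (fun h : R => f (h *: v + (t *: v + x)))
   (df (t *: v + x)) by rewrite subrr.
apply: (is_derive_eq (@is_derive1_comp R _ (fun h => h - t) t _ 1 ht _)).
  exact: is_derive_shift.
by rewrite mulr1.
Qed.

Lemma is_derive_mul f g x v (df dg : R) :
  is_derive x v f df -> is_derive x v g dg ->
  is_derive x v (fun y => f y * g y) (df * g x + f x * dg).
Proof.
move=> fx gx; apply: (is_derive_eq (is_deriveM fx gx)).
by rewrite /GRing.scale/= addrC (mulrC df).
Qed.

End DirectionalDerivatives.

Section ContinuousRealFunctions.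
Context {R : realType} {T : topologicalType}.
Implicit Types f g : T -> R.

Lemma continuous_addf f g :
  continuous f -> continuous g -> continuous (fun x => f x + g x).
Proof. by move=> fc gc x; exact: (continuousD (fc x) (gc x)). Qed.

Lemma continuous_mulf f g :
  continuous f -> continuous g -> continuous (fun x => f x * g x).
Proof. by move=> fc gc x; exact: (continuousM (fc x) (gc x)). Qed.

Lemma continuous_realcomp (h : R -> R) f :
  continuous h -> continuous f -> continuous (fun x => h (f x)).
Proof. by move=> hc fc x; exact: (continuous_comp (fc x) (hc _)). Qed.

End ContinuousRealFunctions.

Section SmoothFunctions.
Context {R : realType} {d : nat}.
Implicit Types (f g q : 'rV[R]_d -> R) (x y : 'rV[R]_d) (i : 'I_d).

Let dir i : 'rV[R]_d := delta_mx 0 i.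

(** Closure of smoothness under sums, products and compositions is proved by
    induction on the order of differentiation. *)
Fixpoint Ck n f : Prop :=
  [/\ continuous f, forall i x, derivable f x (dir i) &
      if n is n'.+1 then forall i, Ck n' (partial i f) else True].

Lemma Ck_smooth f : (forall n, Ck n f) -> smooth f.
Proof.
move=> fC s; elim/last_ind: s f fC => [|s i IH] f fC.
  by have [] := fC 0%N.
rewrite foldr_rcons; apply: IH => n.
by have [_ _] := fC n.+1; exact.
Qed.

Lemma CkW n f : Ck n.+1 f -> Ck n f.
Proof.
elim: n f => [|n IH] f [fc fd fp]; split => // i; apply: IH; exact: fp.
Qed.

Lemma CkS n f (df : 'I_d -> 'rV[R]_d -> R) : continuous f ->
  (forall i x, is_derive x (dir i) f (df i x)) -> (forall i, Ck n (df i)) ->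
  Ck n.+1 f.
Proof.
move=> fc fd fC; split => [//|i x|i].
  by have [] := fd i x.
rewrite (_ : partial i f = df i)//; apply/funext => x.
by rewrite /partial; apply: derive_val; exact: fd.
Qed.

Lemma Ck0 f (df : 'I_d -> 'rV[R]_d -> R) : continuous f ->
  (forall i x, is_derive x (dir i) f (df i x)) -> Ck 0 f.
Proof. by move=> fc fd; split => // i x; have [] := fd i x. Qed.

Lemma Ck_continuous n f : Ck n f -> continuous f.
Proof. by case: n => [|n] []. Qed.

Lemma Ck_is_derive n f i x : Ck n f -> is_derive x (dir i) f (partial i f x).
Proof. by case: n => [|n] [_ fd _]; exact/derivableP/fd. Qed.

Lemma Ck_cst n (c : R) : Ck n (fun=> c).
Proof.
elim: n c => [|n IH] c.
  by apply: (@Ck0 _ (fun _ _ => 0)); exact: cst_continuous.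
by apply: (@CkS _ _ (fun _ _ => 0)) => //; exact: cst_continuous.
Qed.

Lemma is_derive_coord j v x : is_derive x v (fun y : 'rV[R]_d => y 0 j) (v 0 j).
Proof.
apply/is_derive1P.
have -> : (fun h : R => (h *: v + x) 0 j) = (v 0 j *: id) + cst (x 0 j).
  by apply/funext => h; rewrite !mxE /= mulrC.
by apply: is_derive_eq; rewrite addr0 /GRing.scale/= mulr1.
Qed.

Lemma Ck_coord n j : Ck n (fun y : 'rV[R]_d => y 0 j).
Proof.
have cj : continuous (fun y : 'rV[R]_d => y 0 j) by exact: coord_continuous.
case: n => [|n].
  by apply: Ck0 => // i x; exact: is_derive_coord.
by apply: CkS => // [i x|i]; [exact: is_derive_coord|exact: Ck_cst].
Qed.

Lemma CkD n f g : Ck n f -> Ck n g -> Ck n (fun x => f x + g x).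
Proof.
elim: n f g => [|n IH] f g fC gC.
  apply: Ck0 => [|i x].
    exact: (continuous_addf (Ck_continuous fC) (Ck_continuous gC)).
  exact: (is_deriveD (Ck_is_derive i x fC) (Ck_is_derive i x gC)).
apply: CkS => [|i x|i].
- exact: (continuous_addf (Ck_continuous fC) (Ck_continuous gC)).
- exact: (is_deriveD (Ck_is_derive i x fC) (Ck_is_derive i x gC)).
- by apply: IH; [have [_ _] := fC|have [_ _] := gC]; exact.
Qed.

Lemma CkM n f g : Ck n f -> Ck n g -> Ck n (fun x => f x * g x).
Proof.
elim: n f g => [|n IH] f g fC gC.
  apply: Ck0 => [|i x].
    exact: (continuous_mulf (Ck_continuous fC) (Ck_continuous gC)).
  exact: (is_derive_mul (Ck_is_derive i x fC) (Ck_is_derive i x gC)).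
apply: CkS => [|i x|i].
- exact: (continuous_mulf (Ck_continuous fC) (Ck_continuous gC)).
- exact: (is_derive_mul (Ck_is_derive i x fC) (Ck_is_derive i x gC)).
- apply: CkD; apply: IH; try exact: CkW.
    by have [_ _] := fC; exact.
  by have [_ _] := gC; exact.
Qed.

Lemma CkX n f m : Ck n f -> Ck n (fun x => f x ^+ m).
Proof.
move=> fC; elim: m => [|m IH]; first exact: Ck_cst.
by under eq_fun do rewrite exprS; exact: CkM.
Qed.

Lemma Ck_sum n (I : Type) (s : seq I) (F : I -> 'rV[R]_d -> R) :
  (forall j, Ck n (F j)) -> Ck n (fun x => \sum_(j <- s) F j x).
Proof.
move=> FC; elim: s => [|j s IH].
  by under eq_fun do rewrite big_nil; exact: Ck_cst.
by under eq_fun do rewrite big_cons; exact: CkD.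
Qed.

(** A whole sequence of functions, each the derivative of the previous one,
    makes the induction on [n] go through: the chain rule leads from [G k] to
    [G k.+1]. *)
Lemma Ck_comp (G : nat -> R -> R) n q k :
  (forall j (t : R), is_derive t (1 : R) (G j) (G j.+1 t)) -> Ck n q ->
  Ck n (fun x => G k (q x)).
Proof.
move=> dG; have Gc j : continuous (G j).
  move=> t; apply: differentiable_continuous; apply/derivable1_diffP.
  by have [] := dG j t.
elim: n q k => [|n IH] q k qC.
  apply: Ck0 => [|i x].
    exact: (continuous_realcomp (Gc k) (Ck_continuous qC)).
  exact: (is_derive_comp_real (dG k _) (Ck_is_derive i x qC)).
apply: CkS => [|i x|i].
- exact: (continuous_realcomp (Gc k) (Ck_continuous qC)).
- exact: (is_derive_comp_real (dG k _) (Ck_is_derive i x qC)).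
- apply: CkM; first exact/IH/CkW.
  by have [_ _] := qC; exact.
Qed.

Lemma is_derive_invsqrt (t : R) : 0 < t ->
  is_derive t (1 : R) (fun s : R => (Num.sqrt s)^-1) (- 2^-1 * (Num.sqrt t)^-1 ^+ 3).
Proof.
move=> t0; have st0 : 0 < Num.sqrt t by rewrite sqrtr_gt0.
have [ds dsE] := is_derive1_sqrt t0.
apply: DeriveDef; first by apply: derivableV; rewrite ?gt_eqF.
rewrite deriveV ?gt_eqF// dsE /GRing.scale/= invfM.
by field; rewrite ?gt_eqF.
Qed.

(** The derivative is a polynomial in the function itself and in [q]. *)
Lemma Ck_invsqrt n q : (forall x, 0 < q x) -> Ck n q ->
  Ck n (fun x => (Num.sqrt (q x))^-1).
Proof.
move=> q0.
have wc f : continuous f -> (forall x, 0 < f x) ->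
    continuous (fun x => (Num.sqrt (f x))^-1).
  move=> fc f0 x; apply: (@continuousV _ _ (fun x => Num.sqrt (f x))).
    by rewrite gt_eqF// sqrtr_gt0.
  exact: (continuous_realcomp (@sqrt_continuous R) fc).
elim: n => [|n IH] qC.
  apply: Ck0 => [|i x]; first by apply: wc => //; exact: (Ck_continuous qC).
  exact: (is_derive_comp_real (is_derive_invsqrt (q0 x)) (Ck_is_derive i x qC)).
apply: CkS => [|i x|i]; first by apply: wc => //; exact: (Ck_continuous qC).
- exact: (is_derive_comp_real (is_derive_invsqrt (q0 x)) (Ck_is_derive i x qC)).
- apply: CkM; last by have [_ _] := qC; exact.
  by apply: CkM; [exact: Ck_cst|apply: CkX; exact/IH/CkW].
Qed.

Section Rescale.
Variables (r : R) (x : 'rV[R]_d).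

Definition rescale (y : 'rV[R]_d) : 'rV[R]_d := r^-1 *: (y - x).

Lemma continuous_rescale : continuous rescale.
Proof.
move=> y; apply: (@continuous_comp _ _ _ (fun y => y - x) ( *:%R r^-1)).
  exact: (continuousB (@cvg_id _ _) (@cst_continuous _ _ x _)).
exact: scaler_continuous.
Qed.

Lemma is_derive_rescale g i y (df : R) : is_derive (rescale y) (dir i) g df ->
  is_derive y (dir i) (fun y => g (rescale y)) (r^-1 * df).
Proof.
move=> /is_derive1P gy; apply/is_derive1P.
have -> : (fun h : R => g (rescale (h *: dir i + y))) =
    (fun h => g (h *: dir i + rescale y)) \o (fun h => r^-1 * h).
  by apply/funext => h /=; rewrite /rescale -addrA scalerDr scalerA.
have gy' : is_derive (r^-1 * 0) (1:R) (fun h => g (h *: dir i + rescale y)) df.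
  by rewrite mulr0.
apply: (is_derive_eq (@is_derive1_comp R _ (fun h => r^-1 * h) 0 _ r^-1 gy' _)).
  have /is_derive_eq := is_deriveZ r^-1 (is_derive_id (0 : R) (1 : R)).
  by apply; rewrite /GRing.scale/= mulr1.
by rewrite mulrC.
Qed.

Lemma partial_rescale f i y : derivable f (rescale y) (dir i) ->
  partial i (fun y => f (rescale y)) y = r^-1 * partial i f (rescale y).
Proof.
move=> /derivableP/is_derive_rescale fy.
exact: (@derive_val _ _ _ _ _ _ _ fy).
Qed.

Lemma smooth_rescale f : smooth f -> smooth (fun y => f (rescale y)).
Proof.
move=> fS s.
suff [c ->] : exists c : R, foldr partial (fun y => f (rescale y)) s =
    (fun y => c * foldr partial f s (rescale y)).
  have [gc gd] := fS s; split=> [|i y].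
    apply: continuous_mulf; first exact: cst_continuous.
    by move=> y; apply: continuous_comp; [exact: continuous_rescale|exact: gc].
  have gy := is_derive_rescale (derivableP (gd i (rescale y))).
  exact: (@ex_derive _ _ _ _ _ _ _ (is_derive_mul (is_derive_cst c _ _) gy)).
elim: s => [|i s [c IH]]; first by exists 1; apply/funext => y; rewrite mul1r.
exists (c * r^-1); apply/funext => y /=; rewrite {1}/partial IH.
have [_ gd] := fS s.
have gy := is_derive_rescale (derivableP (gd i (rescale y))).
have cgy := is_derive_mul (is_derive_cst c _ _) gy.
by rewrite (@derive_val _ _ _ _ _ _ _ cgy) mul0r add0r mulrA.
Qed.

End Rescale.

End SmoothFunctions.

(** * The flat function exp(-1/s) *)

Section FlatFunctions.
Context {R : realType}.
Implicit Types (p : {poly R}) (s : R).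

(** At 0 the flat functions are differentiated by this estimate. *)
Lemma is_derive0_quadratic (f : R -> R) (C : R) :
  (forall h, `|f h| <= C * h ^+ 2) -> is_derive (0 : R) (1 : R) f 0.
Proof.
move=> fC; have f0 : f 0 = 0.
  by apply/eqP; rewrite -normr_le0 (le_trans (fC 0))// expr0n mulr0.
have C0 : 0 <= C.
  by have := le_trans (normr_ge0 _) (fC 1); rewrite expr1n mulr1.
suff fl : (fun h : R => h^-1 *: ((f \o shift 0) (h *: (1 : R)) - f 0)) @ 0^'
    --> (0 : R).
  by split; [apply/cvg_ex; exists 0|exact: cvg_lim fl].
apply/cvgr0Pnorm_lt => e e0; near=> h.
have hn0 : h != 0 by near: h; exact: nbhs_dnbhs_neq.
rewrite /= addr0 f0 subr0 [_%:A]mulr1 normrM normfV.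
rewrite ltr_pdivrMl ?normr_gt0//.
apply: (le_lt_trans (fC h)).
rewrite -(real_normK (num_real h)) expr2 mulrA mulrC ltr_pM2l ?normr_gt0//.
have h1 : `|h| < e / (C + 1).
  by near: h; apply: dnbhs0_lt; rewrite divr_gt0// ltr_wpDl.
rewrite (@le_lt_trans _ _ ((C + 1) * `|h|))//.
  by rewrite ler_wpM2r// lerDl.
by rewrite mulrC -ltr_pdivlMr// ltr_wpDl.
Unshelve. all: by end_near. Qed.

(** Every derivative of exp(-1/s) is a polynomial in 1/s times exp(-1/s), so
    that this family of functions is stable under differentiation. *)
Definition flatp p s : R := if 0 < s then p.[s^-1] * expR (- s^-1) else 0.

Definition flatD p : {poly R} := 'X^2 * (p - p^`()).

Lemma poly_expRN_bounded p :
  exists C, forall u : R, 0 <= u -> `|p.[u]| * expR (- u) <= C.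
Proof.
have mono n (u : R) : 0 <= u -> u ^+ n * expR (- u) <= n`!%:R.
  move=> u0; rewrite expRN ler_pdivrMr ?expR_gt0//.
  case: n => [|n].
    by rewrite expr0 mul1r -(expR0 R) ler_expR.
  rewrite mulrC -ler_pdivrMr ?ltr0n ?fact_gt0//.
  by rewrite (le_trans _ (expR_ge1Dxn n u0))// lerDr.
suff H n : exists C, forall u : R, 0 <= u ->
    u ^+ n * `|p.[u]| * expR (- u) <= C.
  have [C HC] := H 0%N; exists C => u u0.
  by have := HC _ u0; rewrite expr0 mul1r.
elim/poly_ind: p n => [|p c IH] n.
  by exists 0 => u u0; rewrite horner0 normr0 mulr0 mul0r.
have [C HC] := IH n.+1; exists (C + `|c| * n`!%:R) => u u0.
rewrite hornerMXaddC (@le_trans _ _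
    (u ^+ n * (`|p.[u]| * u + `|c|) * expR (- u)))//.
  rewrite ler_wpM2r ?expR_ge0// ler_wpM2l ?exprn_ge0//.
  by rewrite (le_trans (ler_normD _ _))// normrM (ger0_norm u0).
rewrite mulrDr mulrDl lerD//.
  by rewrite [_ * u]mulrC mulrA -exprSr; exact: HC.
by rewrite mulrAC mulrC ler_wpM2l// mono.
Qed.

Lemma is_derive_flatp p s : is_derive s (1 : R) (flatp p) (flatp (flatD p) s).
Proof.
have [s0|s0|->] := ltgtP s 0; last first.
- have [C HC] := poly_expRN_bounded ('X^2 * p).
  have -> : flatp (flatD p) 0 = 0 by rewrite /flatp ltxx.
  apply: (@is_derive0_quadratic _ C) => h; rewrite /flatp.
  have C0 : 0 <= C.
    by apply: (le_trans _ (HC 0 (lexx _))); rewrite mulr_ge0// expR_ge0.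
  case: ifPn => [h0|_]; last by rewrite normr0 mulr_ge0// sqr_ge0.
  have := HC h^-1; rewrite invr_ge0 => /(_ (ltW h0)).
  rewrite hornerM hornerXn normrM (ger0_norm (sqr_ge0 _)).
  rewrite [`|_ * expR _|]normrM (gtr0_norm (expR_gt0 _)) exprVn -mulrA.
  by rewrite ler_pdivrMl ?exprn_gt0// (mulrC (h ^+ 2)).
- apply: (@near_eq_is_derive R R R (fun t : R => p.[t^-1] * expR (- t^-1))).
  - near=> t; rewrite /flatp ifT//; near: t; exact: lt_nbhsr.
  have dV : is_derive s (1 : R) (fun t : R => t^-1) (- s ^- 2).
    split; first by apply: derivableV; rewrite ?gt_eqF.
    by rewrite deriveV ?gt_eqF// derive_id /GRing.scale/= mulr1.
  have dp := is_derive_comp_real (is_derive_poly p s^-1) dV.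
  have dN : is_derive s (1 : R) (fun t : R => - t^-1) (- - s ^- 2).
    exact: is_deriveN.
  have de := @is_derive_comp_real R R _ (fun t : R => - t^-1) s 1 _ _
    (is_derive_expR (- s^-1)) dN.
  apply: (is_derive_eq (is_derive_mul dp de)).
  rewrite /flatp s0 /flatD hornerM hornerXn hornerD hornerN exprVn.
  by ring.
- apply: (@near_eq_is_derive R R R (fun=> 0)).
  - near=> t; rewrite /flatp ifF//; apply/negbTE; rewrite -leNgt ltW//.
    near: t; exact: lt_nbhsl.
  by rewrite /flatp ltNge (ltW s0)/=; exact: is_derive_cst.
Unshelve. all: by end_near. Qed.

Definition flat s := flatp 1 s.
Definition dflat s := flatp 'X^2 s.

Lemma is_derive_flat s : is_derive s (1 : R) flat (dflat s).
Proof.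
apply: (is_derive_eq (is_derive_flatp 1 s)).
by rewrite /dflat /flatD derivC subr0 mulr1.
Qed.

Lemma flat_ge0 s : 0 <= flat s.
Proof. by rewrite /flat /flatp; case: ifP => // _; rewrite hornerC mul1r expR_ge0. Qed.

Lemma flat_le0 s : s <= 0 -> flat s = 0.
Proof. by move=> s0; rewrite /flat /flatp ltNge s0. Qed.

Lemma dflat_le0 s : s <= 0 -> dflat s = 0.
Proof. by move=> s0; rewrite /dflat /flatp ltNge s0. Qed.

Lemma dflat_ge0 s : 0 <= dflat s.
Proof.
rewrite /dflat /flatp; case: ifP => // _.
by rewrite hornerXn mulr_ge0// ?sqr_ge0// expR_ge0.
Qed.

Lemma dflat_le2 s : dflat s <= 2.
Proof.
rewrite /dflat /flatp; case: ifP => // s0.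
rewrite hornerXn expRN ler_pdivrMr ?expR_gt0// mulrC -ler_pdivrMr//.
have := @expR_ge1Dxn _ s^-1 1; rewrite invr_ge0 => /(_ (ltW s0)).
by apply: le_trans; rewrite lerDr.
Qed.

Lemma flat_ge s : 2^-1 <= s -> expR (-2) <= flat s.
Proof.
move=> s1; have s0 : 0 < s by apply: lt_le_trans s1.
rewrite /flat /flatp s0 hornerC mul1r ler_expR lerN2.
by rewrite -[2]invrK lef_pV2// posrE.
Qed.

End FlatFunctions.

(** * A radial test field *)

Section CoordinateNorm.
Context {R : realType} {d : nat}.
Implicit Types (x y : 'rV[R]_d) (c : R).

Lemma rV_norm_le x c : 0 <= c -> (forall i, `|x 0 i| <= c) -> `|x| <= c.
Proof.
move=> c0 xc; rewrite [leLHS]/Num.norm /= mx_normrE.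
by apply/bigmax_leP; split => // -[i j] _ /=; rewrite ord1.
Qed.

Lemma rV_coord_le x i : `|x 0 i| <= `|x|.
Proof.
rewrite [leRHS]/Num.norm /= mx_normrE.
by apply/bigmax_geP; right => /=; exists (0, i).
Qed.

Definition sqn x : R := dotp x x.

Lemma sqnE x : sqn x = \sum_i x 0 i ^+ 2.
Proof. by apply: eq_bigr => i _; rewrite expr2. Qed.

Lemma sqn_ge0 x : 0 <= sqn x.
Proof. by rewrite sqnE sumr_ge0// => i _; exact: sqr_ge0. Qed.

Lemma sqn_coord x i : x 0 i ^+ 2 <= sqn x.
Proof. by rewrite sqnE (bigD1 i)//= lerDl sumr_ge0// => j _; exact: sqr_ge0. Qed.

Lemma norm_sqr_le_sqn x : `|x| ^+ 2 <= sqn x.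
Proof.
rewrite -[leRHS]sqr_sqrtr ?sqn_ge0// ler_sqr ?nnegrE ?sqrtr_ge0//.
apply: rV_norm_le => [|i]; first exact: sqrtr_ge0.
by rewrite -sqrtr_sqr ler_wsqrtr// sqn_coord.
Qed.

Lemma sqn_le x c : `|x| <= c -> sqn x <= (d%:R * c) ^+ 2.
Proof.
move=> xc; have c0 : 0 <= c by apply: le_trans xc.
have [d0|d0] := eqVneq d 0%N.
  by rewrite sqnE big1 ?sqr_ge0// => i; move: (ltn_ord i); rewrite {2}d0.
rewrite sqnE (@le_trans _ _ (\sum_(i < d) c ^+ 2))//.
  apply: ler_sum => i _; rewrite -(real_normK (num_real _)) ler_sqr ?nnegrE//.
  by rewrite (le_trans (rV_coord_le x i)).
rewrite sumr_const card_ord -[c ^+ 2 *+ d]mulr_natl exprMn ler_wpM2r ?sqr_ge0//.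
by rewrite expr2 ler_peMr// ler1n lt0n.
Qed.

Lemma is_derive_sqn i x :
  is_derive x (delta_mx 0 i : 'rV[R]_d) sqn (2 * x 0 i).
Proof.
have H j : is_derive x (delta_mx 0 i : 'rV[R]_d) (fun y : 'rV[R]_d => y 0 j ^+ 2)
    (2 * x 0 j * (i == j)%:R).
  have cj := is_derive_coord j (delta_mx 0 i : 'rV[R]_d) x.
  apply: (is_derive_eq (is_derive_mul cj cj)).
  by rewrite mxE eqxx/= eq_sym; ring.
have := is_derive_sum H.
have -> : \sum_(j < d) (fun y : 'rV[R]_d => y 0 j ^+ 2) = sqn.
  by apply/funext => y; rewrite sqnE fct_sumE.
move=> /is_derive_eq; apply.
rewrite (bigD1 i)//= eqxx mulr1 big1 ?addr0// => j ji.
by rewrite eq_sym (negbTE ji) mulr0.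
Qed.

Lemma Ck_sqn n : Ck n sqn.
Proof.
have -> : sqn = (fun y => \sum_i y 0 i ^+ 2) by apply/funext => y; rewrite sqnE.
by apply: Ck_sum => i; apply: CkX; exact: Ck_coord.
Qed.

End CoordinateNorm.

Section RadialTestFunction.
Context {R : realType} {d k l : nat} (H : 'M[R]_(d, k)) (delta : R).
Hypothesis delta0 : 0 < delta.
Implicit Types (x y : 'rV[R]_d) (i : 'I_d) (a : 'I_k).

(** The function |y|^-1, regularised at scale [delta]. *)
Definition winv y : R := (Num.sqrt (sqn y + delta ^+ 2))^-1.
Definition chi y : R := flat (1 - sqn y ^+ l.+1).
Definition psi y : R := winv y ^+ l.+1 * chi y.
(** With [H *m L] the orthogonal projection on a subspace U, this is the
    field pi_U(y) psi(y) read through [H]; [psi] is |y|^-(l + 1), regularised at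
    the origin and cut off outside the unit ball. *)
Definition radial_test a y : R := (y *m H) 0 a * psi y.

Let arg_gt0 y : 0 < sqn y + delta ^+ 2.
Proof. by rewrite ltr_wpDl ?sqn_ge0// exprn_gt0. Qed.

Let winv_gt0 y : 0 < winv y.
Proof. by rewrite invr_gt0 sqrtr_gt0. Qed.

Let winv_sqr y : winv y ^+ 2 * (sqn y + delta ^+ 2) = 1.
Proof. by rewrite exprVn sqr_sqrtr ?mulVf ?gt_eqF// ltW. Qed.

(** As [psi] is radial, its gradient is [dpsi y] times [y]. *)
Definition dpsi y : R := - (l.+1%:R * winv y ^+ l.+3 * chi y
  + 2 * l.+1%:R * sqn y ^+ l * winv y ^+ l.+1 * dflat (1 - sqn y ^+ l.+1)).

Let dir i : 'rV[R]_d := delta_mx 0 i.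

Let is_derive_winv i x : is_derive x (dir i) winv (- winv x ^+ 3 * x 0 i).
Proof.
have ds := is_derive_sqn i x.
have da : is_derive x (dir i) (fun y => sqn y + delta ^+ 2) (2 * x 0 i).
  apply: (is_derive_eq (is_deriveD ds (is_derive_cst (delta ^+ 2) x (dir i)))).
  by rewrite addr0.
apply: (is_derive_eq (@is_derive_comp_real _ _ _ (fun y => sqn y + delta ^+ 2)
  _ _ _ _ (is_derive_invsqrt (arg_gt0 x)) da)).
by rewrite -/(winv x); field.
Qed.

Lemma is_derive_pow (f : 'rV[R]_d -> R) n x v (df : R) : is_derive x v f df ->
  is_derive x v (fun y => f y ^+ n) (n%:R * f x ^+ n.-1 * df).
Proof.
move=> fx.
apply: (@is_derive_comp_real _ _ (fun t : R => t ^+ n) f) => //.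
have := is_deriveX n (is_derive_id (f x) (1 : R)).
rewrite exprfctE => /is_derive_eq; apply.
by rewrite /GRing.scale/= mulr1.
Qed.

Let is_derive_chi i x : is_derive x (dir i) chi
  (- (2 * l.+1%:R * sqn x ^+ l * dflat (1 - sqn x ^+ l.+1)) * x 0 i).
Proof.
have ds := is_derive_pow l.+1 (is_derive_sqn i x).
have da : is_derive x (dir i) (fun y => 1 - sqn y ^+ l.+1)
    (- (l.+1%:R * sqn x ^+ l * (2 * x 0 i))).
  apply: (is_derive_eq (is_deriveB (is_derive_cst (1 : R) x (dir i)) ds)).
  by rewrite sub0r.
apply: (is_derive_eq (@is_derive_comp_real _ _ _ (fun y => 1 - sqn y ^+ l.+1)
  _ _ _ _ (is_derive_flat _) da)).
by ring.
Qed.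

Lemma is_derive_psi i x : is_derive x (dir i) psi (dpsi x * x 0 i).
Proof.
apply: (is_derive_eq (is_derive_mul (is_derive_pow l.+1 (is_derive_winv i x))
  (is_derive_chi i x))).
rewrite /dpsi (_ : l.+1.-1 = l)// !(exprS (winv x)).
by move: (l.+1%:R : R) => c; ring.
Qed.

Lemma is_derive_radial_test a i x :
  is_derive x (dir i) (radial_test a)
    (H i a * psi x + (x *m H) 0 a * (dpsi x * x 0 i)).
Proof.
have dl : is_derive x (dir i) (fun y => (y *m H) 0 a) (H i a).
  apply/is_derive1P.
  have -> : (fun h : R => ((h *: dir i + x) *m H) 0 a) =
      (fun h => H i a * h + (x *m H) 0 a).
    apply/funext => h; rewrite mulmxDl -scalemxAl mxE; congr (_ + _).
    by rewrite mxE /dir -rowE mxE mulrC.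
  have := is_deriveD (is_deriveZ (H i a) (is_derive_id (0 : R) (1 : R)))
    (is_derive_cst ((x *m H) 0 a) (0 : R) (1 : R)).
  by move=> /is_derive_eq; apply; rewrite addr0 /GRing.scale/= mulr1.
exact: is_derive_mul dl (is_derive_psi i x).
Qed.

Lemma partial_radial_test a i x : partial i (radial_test a) x =
  H i a * psi x + (x *m H) 0 a * (dpsi x * x 0 i).
Proof. exact: (@derive_val _ _ _ _ _ _ _ (is_derive_radial_test a i x)). Qed.

Lemma smooth_radial_test a : smooth (radial_test a).
Proof.
apply: Ck_smooth => n; apply: CkM.
  under eq_fun do rewrite mxE.
  by apply: Ck_sum => i; apply: CkM; [exact: Ck_coord|exact: Ck_cst].
apply: CkM.
  apply/CkX/Ck_invsqrt => //.
  by apply: CkD; [exact: Ck_sqn|exact: Ck_cst].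
have dG j (t : R) : is_derive t (1 : R) (flatp (iter j flatD (1 : {poly R})))
    (flatp (iter j.+1 flatD 1) t) by exact: is_derive_flatp.
apply: (@Ck_comp _ _ _ n (fun y => 1 - sqn y ^+ l.+1) 0 dG); apply: CkD; first exact: Ck_cst.
under eq_fun do rewrite -mulN1r.
by apply: CkM; [exact: Ck_cst|apply: CkX; exact: Ck_sqn].
Qed.

Lemma psi_out y : 1 <= sqn y -> psi y = 0.
Proof. by move=> y1; rewrite /psi /chi flat_le0 ?mulr0// subr_le0 exprn_ege1. Qed.

Lemma dpsi_out y : 1 <= sqn y -> dpsi y = 0.
Proof.
move=> y1; have y1l : 1 - sqn y ^+ l.+1 <= 0 by rewrite subr_le0 exprn_ege1.
by rewrite /dpsi /chi flat_le0// dflat_le0// !mulr0 addr0 oppr0.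
Qed.

Variable (L : 'M[R]_(k, d)).
Hypothesis trHL : l.+1%:R <= \tr (H *m L).
Hypothesis HL : forall y, 0 <= (y *m (H *m L) *m y^T) 0 0 <= sqn y.

Definition radial_div y : R := \sum_a \sum_i L a i * partial i (radial_test a) y.

Lemma radial_divE y : radial_div y =
  \tr (H *m L) * psi y + dpsi y * (y *m (H *m L) *m y^T) 0 0.
Proof.
rewrite /radial_div (eq_bigr (fun a => (\sum_i H i a * L a i) * psi y +
    dpsi y * ((y *m H) 0 a * (\sum_i L a i * y 0 i)))); last first.
  move=> a _; rewrite mulr_suml !mulr_sumr -big_split /=; apply: eq_bigr => i _.
  by rewrite partial_radial_test; ring.
rewrite big_split /= -mulr_suml -mulr_sumr; congr (_ * _ + _ * _).
  rewrite exchange_big /=; apply: eq_bigr => i _; rewrite mxE.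
  by [].
rewrite mulmxA -mulmxA mxE; apply: eq_bigr => a _; congr (_ * _).
by rewrite mxE; apply: eq_bigr => i _; rewrite mxE.
Qed.

(** For psi = |y|^-(l + 1) and trace at least l + 1 the divergence
    tr psi + dpsi <pi y, y> is nonnegative, since <pi y, y> <= |y|^2.  The
    regularisation contributes (l + 1) delta^2 w^(l + 3), a positive bump of
    height delta^-(l + 1) on the ball of radius [delta]; the cut-off contributes
    a bounded error. *)
Lemma radial_div_ge y : l.+1%:R * (winv y ^+ l.+3 * delta ^+ 2 * chi y)
  - 4 * l.+1%:R <= radial_div y.
Proof.
have /andP[q0 qs] := HL y; set q := (_ *m _) 0 0 in q0 qs.
have chi0 : 0 <= chi y by exact: flat_ge0.
have w0 n : 0 <= winv y ^+ n by rewrite exprn_ge0// ltW.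
have sn n : 0 <= sqn y ^+ n by rewrite exprn_ge0// sqn_ge0.
have psi0 : 0 <= psi y by rewrite mulr_ge0.
have dpsi0 : dpsi y <= 0.
  rewrite /dpsi oppr_le0; apply: addr_ge0; apply: mulr_ge0 => //.
  - exact: mulr_ge0.
  - by apply: mulr_ge0 => //; apply: mulr_ge0 => //; exact: mulr_ge0.
  - exact: dflat_ge0.
rewrite radial_divE -/q.
apply: (@le_trans _ _ (l.+1%:R * psi y + dpsi y * sqn y)); last first.
  by rewrite lerD// ?ler_wpM2r// ler_wnM2l.
have -> : l.+1%:R * psi y + dpsi y * sqn y =
    l.+1%:R * (winv y ^+ l.+3 * delta ^+ 2 * chi y) -
    2 * l.+1%:R * ((sqn y * winv y) ^+ l.+1 * dflat (1 - sqn y ^+ l.+1)).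
  rewrite /psi /dpsi exprMn.
  transitivity (l.+1%:R * (winv y ^+ l.+1 * (winv y ^+ 2 * (sqn y + delta ^+ 2))
    * chi y) - (l.+1%:R * winv y ^+ l.+3 * chi y
  + 2 * l.+1%:R * sqn y ^+ l * winv y ^+ l.+1 * dflat (1 - sqn y ^+ l.+1)) * sqn y).
    by rewrite winv_sqr mulr1 mulNr.
  by rewrite !(exprS _ l.+2) !(exprS _ l.+1) !(exprS _ l); ring.
rewrite lerD2l lerN2 (_ : 4 * _ = 2 * l.+1%:R * 2); last by ring.
rewrite ler_wpM2l//.
have [s1|s1] := lerP 1 (sqn y).
  by rewrite dflat_le0 ?mulr0// subr_le0 exprn_ege1.
have sw0 : 0 <= sqn y * winv y by rewrite mulr_ge0 ?sqn_ge0// ltW.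
(* On the support of the cut-off, |y|^2 w is at most |y|, hence at most 1. *)
have sw1 : sqn y * winv y <= 1.
  rewrite -ler_sqr ?nnegrE// expr1n exprMn -[leRHS](winv_sqr y) mulrC.
  rewrite ler_wpM2l// (@le_trans _ _ (sqn y)) ?lerDl ?sqr_ge0//.
  by rewrite expr2 ler_piMr ?sqn_ge0// ltW.
rewrite -[leRHS]mul1r ler_pM ?dflat_ge0 ?dflat_le2//; first exact: exprn_ge0.
exact: exprn_ile1.
Qed.

(** On the ball of radius [delta], w is at least 1 / (2 delta) and the cut-off is
    at least exp(-2). *)
Lemma radial_div_ge_center y : delta <= 2^-1 -> sqn y <= delta ^+ 2 ->
  expR (-2) / 2 ^+ l.+3 * delta ^- l.+1 - 4 * l.+1%:R <= radial_div y.
Proof.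
move=> d2 yd; apply: le_trans (radial_div_ge y); rewrite lerD2r.
have s1 : sqn y <= 2^-1.
  rewrite (le_trans yd)// expr2 (le_trans _ d2)// ler_piMl ?(ltW delta0)//.
  by rewrite (le_trans d2)// invf_le1// ler1n.
have chig : expR (-2) <= chi y.
  apply: flat_ge; rewrite lerBrDr -lerBrDl [leRHS](_ : _ = 2^-1); last by field.
  apply: le_trans (s1); rewrite exprS ler_piMr ?sqn_ge0// exprn_ile1 ?sqn_ge0//.
  by rewrite (le_trans s1)// invf_le1// ler1n.
have wg : (2 * delta)^-1 <= winv y.
  rewrite lef_pV2 ?posrE ?mulr_gt0 ?sqrtr_gt0//.
  have d20 : 0 <= 2 * delta by rewrite mulr_ge0// ltW.
  rewrite -[leRHS]ger0_norm// -sqrtr_sqr ler_wsqrtr// exprMn.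
  by have := sqr_ge0 delta; move: (delta ^+ 2) yd => D; lra.
have wg3 : (2 * delta)^-1 ^+ l.+3 <= winv y ^+ l.+3.
  have v0 : 0 <= (2 * delta)^-1 by rewrite invr_ge0 mulr_ge0// ltW.
  by rewrite lerXn2r// nnegrE// (le_trans v0).
apply: (@le_trans _ _ (1 * ((2 * delta)^-1 ^+ l.+3 * delta ^+ 2 * expR (-2)))).
  have D0 : delta != 0 by rewrite gt_eqF.
  rewrite mul1r exprVn exprMn (_ : delta ^+ l.+3 = delta ^+ 2 * delta ^+ l.+1);
    last by rewrite -exprD.
  have := expf_neq0 l.+3 (lt0r_neq0 (ltr0Sn R 1)).
  move: (expf_neq0 2 D0) (expf_neq0 l.+1 D0) (2 ^+ l.+3) => C0 B0 A A0.
  rewrite le_eqVlt; apply/orP; left; apply/eqP.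
  move: (delta ^+ 2) (delta ^+ l.+1) C0 B0 (expR (-2)) => C B C0 B0 E.
  by field; rewrite A0 B0 C0.
have v0 n : 0 <= (2 * delta)^-1 ^+ n.
  by rewrite exprn_ge0// invr_ge0 mulr_ge0// ltW.
have e0 : 0 <= expR (-2 : R) by exact: expR_ge0.
have d0 := sqr_ge0 delta.
apply: ler_pM => //; [by apply: mulr_ge0 => //; exact: mulr_ge0|by rewrite ler1n|].
by apply: ler_pM => //; [exact: mulr_ge0|exact: ler_wpM2r].
Qed.

End RadialTestFunction.

(** * Orthogonal projections and the symbol *)

Section OrthogonalProjection.
Context {R : realType}.

Lemma sqn_mulmx n (x : 'rV[R]_n) : (x *m x^T) 0 0 = sqn x.
Proof. by rewrite mxE; apply: eq_bigr => i _; rewrite mxE. Qed.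

Lemma sqn_eq0 n (x : 'rV[R]_n) : sqn x = 0 -> x = 0.
Proof.
move=> x0; apply/rowP => i; rewrite mxE; apply/eqP.
by rewrite -sqrf_eq0 eq_le sqr_ge0 andbT -x0 sqn_coord.
Qed.

Definition basis_mx n (U : {vspace 'rV[R]_n}) : 'M[R]_(\dim U, n) :=
  \matrix_i (vbasis U)`_i.

Lemma mul_basis_mx n (U : {vspace 'rV[R]_n}) (x : 'rV[R]_(\dim U)) :
  x *m basis_mx U = \sum_i x 0 i *: (vbasis U)`_i.
Proof. by rewrite mulmx_sum_row; apply: eq_bigr => i _; rewrite rowK. Qed.

Lemma mem_mul_basis_mx n (U : {vspace 'rV[R]_n}) (x : 'rV[R]_(\dim U)) :
  x *m basis_mx U \in U.
Proof.
rewrite mul_basis_mx memv_suml// => i _; apply: memvZ; apply: vbasis_mem.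
by rewrite mem_nth// size_tuple.
Qed.

Lemma row_free_basis_mx n (U : {vspace 'rV[R]_n}) : row_free (basis_mx U).
Proof.
rewrite -kermx_eq0; apply/eqP/row_matrixP => i; rewrite row0.
have : row i (kermx (basis_mx U)) *m basis_mx U = 0.
  by apply: sub_kermxP; exact: row_sub.
rewrite mul_basis_mx => x0.
have /freeP := basis_free (vbasisP U); move/(_ (fun j => row i (kermx (basis_mx U)) 0 j) x0) => H.
by apply/rowP => j; rewrite H mxE.
Qed.

(** The orthogonal projection on [U] is B^T (B B^T)^-1 B for a matrix [B] of
    basis vectors; it factors through [L] because the rows of [B] are combinations
    of those of [L]. *)
Lemma orthogonal_projection_factor n k (L : 'M[R]_(k, n)) (U : {vspace 'rV[R]_n}) :
  (forall u, u \in U -> (u <= L)%MS) ->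
  exists H : 'M[R]_(n, k), \tr (H *m L) = (\dim U)%:R /\
    forall y : 'rV[R]_n, 0 <= (y *m (H *m L) *m y^T) 0 0 <= sqn y.
Proof.
move=> UL; set B := basis_mx U.
have /submxP[C BCL] : (B <= L)%MS.
  apply/row_subP => i; apply: UL; rewrite rowK; apply: vbasis_mem.
  by rewrite mem_nth// size_tuple.
pose G := B *m B^T.
have Gu : G \in unitmx.
  rewrite -row_free_unit -kermx_eq0; apply/eqP/row_matrixP => i; rewrite row0.
  set x := row i _; have xG : x *m G = 0.
    by apply: sub_kermxP; exact: row_sub.
  have /sqn_eq0 xB : sqn (x *m B) = 0.
    by rewrite -sqn_mulmx trmx_mul mulmxA -(mulmxA x) -/G xG mul0mx mxE.
  have := row_free_inj (row_free_basis_mx U); move/(_ 1%N x 0); apply.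
  by rewrite mul0mx.
have GT : G^T = G by rewrite trmx_mul trmxK.
pose Q := B^T *m invmx G *m B.
exists (B^T *m invmx G *m C).
have -> : B^T *m invmx G *m C *m L = Q by rewrite -mulmxA -BCL.
have QT : Q^T = Q by rewrite !trmx_mul trmxK trmx_inv GT mulmxA.
have QQ : Q *m Q = Q.
  rewrite /Q !mulmxA -[_ *m B *m B^T]mulmxA -/G -[_ *m invmx G *m G]mulmxA.
  by rewrite mulVmx// mulmx1.
split=> [|y].
  by rewrite /Q mxtrace_mulC mulmxA -/G mulmxV// mxtrace1.
clearbody Q; have yQy : (y *m Q) *m (y *m Q)^T = y *m Q *m y^T.
  by rewrite trmx_mul QT !mulmxA -[y *m Q *m Q]mulmxA QQ.
have yQ : (y *m Q *m y^T) 0 0 = sqn (y *m Q) by rewrite -sqn_mulmx yQy.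
rewrite yQ sqn_ge0 -subr_ge0/=.
suff -> : sqn y - sqn (y *m Q) = sqn (y - y *m Q) by exact: sqn_ge0.
have -> : sqn (y - y *m Q) = ((y - y *m Q) *m (y - y *m Q)^T) 0 0.
  by rewrite sqn_mulmx.
rewrite linearB/= mulmxBr !mulmxBl yQy (trmx_mul y Q) QT mulmxA subrr subr0.
by rewrite -yQ -sqn_mulmx !mxE.
Qed.

Context {d m k : nat} (P : 'I_d -> 'M[R]_(k, m)) (e : 'cV[R]_m).

(** The linear map xi |-> P(xi)[e]: its row [a] is the direction in which the
    equation number [a] differentiates, once the measure is e times a scalar one. *)
Definition symbol_mx : 'M[R]_(k, d) := \matrix_(a, i) (P i *m e) a 0.

Lemma symbol_mxE xi a : (symbol P xi *m e) a 0 = \sum_i xi 0 i * symbol_mx a i.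
Proof.
rewrite /symbol mulmx_suml summxE; apply: eq_bigr => i _.
by rewrite -scalemxAl !mxE.
Qed.

(** The orthogonal complement of the kernel of a matrix is its row space. *)
Lemma symbol_ker_perp_sub u : u \in symbol_ker_perp P e -> (u <= symbol_mx)%MS.
Proof.
move=> /memv_orthv uo; rewrite submxE; apply/eqP/rowP => j; rewrite [RHS]mxE.
have Lc : symbol_mx *m cokermx symbol_mx = 0 by exact: mulmx_coker.
rewrite -(uo (col j (cokermx symbol_mx))^T).
  by rewrite mxE; apply: eq_bigr => i _; rewrite !mxE.
apply/memv_symbol_ker/colP => a; rewrite symbol_mxE [RHS]mxE.
have /matrixP/(_ a j) := Lc; rewrite [LHS]mxE [RHS]mxE => Lc0; rewrite -[RHS]Lc0.
by apply: eq_bigr => i _; rewrite mulrC; congr (_ * _); rewrite mxE mxE.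
Qed.

End OrthogonalProjection.

(** * Test fields adapted to a subspace *)

Section CompactBalls.
Context {R : realType} {d : nat}.
Implicit Types (x y : 'rV[R]_d) (r : R) (f : 'rV[R]_d -> R).

Definition cball x r : set 'rV[R]_d := closed_ball_ Num.norm x r.

Lemma in_cball x r y : cball x r y = (`|x - y| <= r).
Proof. by []. Qed.

Lemma in_ball x r y : ball x r y = (`|x - y| < r) :> Prop.
Proof. by rewrite -ball_normE. Qed.

Lemma closed_cball x r : closed (cball x r).
Proof. exact: closed_closed_ball_. Qed.

Lemma compact_cball x r : compact (cball x r).
Proof.
apply: bounded_closed_compact; last exact: closed_cball.
exists (`|x| + r); split; first exact: num_real.
move=> M xrM y xyr; apply: le_trans (ltW xrM).
by rewrite -(subrKC x y) (le_trans (ler_normD _ _))// lerD// distrC.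
Qed.

Lemma bounded_of_support f : continuous f ->
  (exists r, forall y, r <= `|y| -> f y = 0) -> exists M, forall y, `|f y| <= M.
Proof.
move=> fc [r f0].
have nfc : {within cball 0 `|r|, continuous (fun y => `|f y|)}.
  apply: continuous_subspaceT; apply: continuous_realcomp => //.
  exact: norm_continuous.
have cb0 : cball 0 `|r| !=set0 by exists 0; rewrite in_cball subrr normr0.
have [c _ cM] := compact_EVT_max cb0 (@compact_cball 0 `|r|) nfc.
exists `|f c| => y; have [ry|yr] := lerP r `|y|.
  by rewrite f0// normr0.
apply: cM; rewrite inE in_cball sub0r normrN (le_trans (ltW yr))//.
exact: ler_norm.
Qed.

End CompactBalls.

(** The radial field of the projection on [U], of rank at least l + 1, at the
    scale [d%:R * eta]: the factor d compares the Euclidean and the sup norms. *)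
Lemma test_field_of_rank {R : realType} {d k l : nat} (L : 'M[R]_(k, d))
    (U : {vspace 'rV[R]_d}) (eta : R) :
  (forall u, u \in U -> (u <= L)%MS) -> (l < \dim U)%N ->
  0 < eta -> d%:R * eta <= 2^-1 ->
  exists (Phi : 'I_k -> 'rV[R]_d -> R) (M : R),
  [/\ forall a, smooth (Phi a),
      forall a y, 1 <= `|y| ->
        Phi a y = 0 /\ forall i, partial i (Phi a) y = 0,
      forall a y, `|Phi a y| <= M /\ forall i, `|partial i (Phi a) y| <= M,
      forall y, - (4 * l.+1%:R) <= \sum_a \sum_i L a i * partial i (Phi a) y &
      forall y, `|y| <= eta ->
        expR (-2) / 2 ^+ l.+3 * (d%:R * eta) ^- l.+1 - 4 * l.+1%:R <=
        \sum_a \sum_i L a i * partial i (Phi a) y].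
Proof.
move=> UL lU eta0 deta; have [H [trH HL]] := orthogonal_projection_factor UL.
have d0 : (0 < d)%N.
  rewrite (leq_trans _ (leq_trans (dimvS (subvf U)) _))//; last first.
    by rewrite dimvf /dim /= mul1n.
  exact: leq_ltn_trans lU.
have delta0 : 0 < d%:R * eta by rewrite mulr_gt0// ltr0n.
pose Phi := @radial_test R d k l H (d%:R * eta).
have out a y : 1 <= `|y| -> Phi a y = 0 /\ forall i, partial i (Phi a) y = 0.
  move=> y1; have s1 : 1 <= sqn y.
    by rewrite (le_trans _ (norm_sqr_le_sqn y))// exprn_ege1.
  split=> [|i]; first by rewrite /Phi /radial_test psi_out// mulr0.
  by rewrite partial_radial_test// psi_out// dpsi_out// mul0r !mulr0 addr0.
have sPhi a : smooth (Phi a) by exact: smooth_radial_test.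
have trl : l.+1%:R <= \tr (H *m L) by rewrite trH ler_nat.
have Phib a : exists M, forall y, `|Phi a y| <= M.
  apply: bounded_of_support; first by have [] := sPhi a [::].
  by exists 1 => y y1; have [] := out a y y1.
have dPhib (ai : 'I_k * 'I_d) :
    exists M, forall y, `|partial ai.2 (Phi ai.1) y| <= M.
  case: ai => a i /=.
  apply: bounded_of_support; first by have [] := sPhi a [:: i].
  by exists 1 => y y1; have [] := out a y y1.
have [M1 HM1] := choice Phib.
have [M2 HM2] := choice dPhib.
have M10 a : 0 <= M1 a by exact: le_trans (HM1 a 0).
have M20 ai : 0 <= M2 ai by exact: le_trans (HM2 ai 0).
exists Phi, (\sum_a M1 a + \sum_ai M2 ai); split => //.
- move=> a y; split=> [|i].
    rewrite (le_trans (HM1 a y))// (bigD1 a)//= -!addrA lerDl.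
    by rewrite addr_ge0// sumr_ge0.
  rewrite (le_trans (HM2 (a, i) y))// (bigD1 (a, i))//= addrCA lerDl.
  by rewrite addr_ge0// sumr_ge0.
- move=> y; rewrite (le_trans _ (radial_div_ge delta0 trl HL y))// lerDr.
  rewrite mulr_ge0// mulr_ge0 ?flat_ge0// mulr_ge0 ?sqr_ge0//.
  by rewrite exprn_ge0// invr_ge0 sqrtr_ge0.
- by move=> y yeta; apply: radial_div_ge_center => //; exact: sqn_le.
Qed.

(** * Regularity of finite Borel measures *)

Section BorelSets.
Context {R : realType} {d : nat}.
Local Notation T := (borelRV R d).

Lemma open_borel (U : set 'rV[R]_d) : open U -> measurable (U : set T).
Proof. by move=> oU; apply: sub_sigma_algebra. Qed.

Lemma closed_borel (C : set 'rV[R]_d) : closed C -> measurable (C : set T).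
Proof.
move=> cC; rewrite -(setCK C); apply: measurableC.
by apply: open_borel; rewrite openC.
Qed.

Lemma ball_borel (x : 'rV[R]_d) r : measurable (ball x r : set T).
Proof. by apply: open_borel; exact: ball_open. Qed.

Lemma cball_borel (x : 'rV[R]_d) r : measurable (cball x r : set T).
Proof. by apply: closed_borel; exact: closed_cball. Qed.

Lemma continuous_borel (f : 'rV[R]_d -> R) (D : set T) :
  continuous f -> measurable D -> measurable_fun D (f : T -> R).
Proof.
move=> /continuousP fc mD.
apply: (measurability _ (RGenOpens.measurableE R)) => _ [_ [a [b ->] <-]].
by apply: measurableI => //; apply: open_borel; apply: fc; exact: interval_open.
Qed.

(** Exhaustion of an open set by the compact sets
    {|x| <= n, dist(x, ~U) >= 1/(n+1)}. *)
Lemma open_compact_exhaustion (U : set 'rV[R]_d) : open U ->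
  exists F : nat -> set 'rV[R]_d, [/\ forall n, compact (F n),
    {homo F : n m / (n <= m)%N >-> (n <= m)%O} & \bigcup_n F n = U].
Proof.
move=> oU; pose F n := [set x : 'rV[R]_d | `|x| <= n%:R /\
  forall y, ~ U y -> n.+1%:R^-1 <= `|x - y|].
have FU n : F n `<=` U.
  move=> x [_ Fx]; apply: contrapT => /Fx; rewrite subrr normr0.
  by apply/negP; rewrite -ltNge invr_gt0.
exists F; split.
- move=> n; apply: bounded_closed_compact.
    exists n%:R; split; first exact: num_real.
    by move=> M nM x [xn _]; exact: le_trans (ltW nM).
  have -> : F n = cball 0 n%:R `&`
      \bigcap_(y in ~` U) [set x | n.+1%:R^-1 <= `|x - y|].
    apply/seteqP; split=> x; rewrite /F /cball /closed_ball_/= sub0r normrN.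
      by move=> [].
    by move=> [].
  apply: closedI; first exact: closed_cball.
  apply: closed_bigI => y _.
  have nc : continuous (fun x : 'rV[R]_d => `|x - y|).
    move=> x; apply: (@continuous_comp _ _ _ (fun x : 'rV[R]_d => x - y)
      (fun z => `|z|)).
      exact: (continuousB (@cvg_id _ _) (@cst_continuous _ _ y _)).
    exact: norm_continuous.
  by move/continuous_closedP : nc => /(_ _ (@closed_ge R (n.+1%:R^-1))).
- move=> n m nm; apply/subsetPset => x [xn xy]; split.
    by rewrite (le_trans xn)// ler_nat.
  move=> y /xy; apply: le_trans.
  by rewrite lef_pV2 ?posrE ?ltr0n// ler_nat.
- apply/seteqP; split=> [x [n _]|x Ux]; first exact: FU.
  have /nbhs_ballP [e /= e0 xe] := open_nbhs_nbhs (conj oU Ux).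
  pose n := maxn (Num.truncn `|x|).+1 (Num.truncn e^-1).+1.
  exists n => //; split.
    rewrite ltW// (lt_le_trans (truncnS_gt _))// ler_nat.
    exact: leq_maxl.
  move=> y Uy; rewrite leNgt; apply/negP => yx; apply: Uy; apply: xe.
  rewrite in_ball (lt_le_trans yx)// invf_ple ?posrE ?ltr0n//.
  rewrite ltW// (lt_le_trans (truncnS_gt _))// ler_nat.
  by rewrite (leq_trans (leq_maxr _ _) (leqnSn _)).
Qed.

Local Open Scope ereal_scope.

(** Approximation from both sides at once, which is stable under complement. *)
Definition regular_set (mu : set T -> \bar R) (A : set T) := forall e : R,
  (0 < e)%R -> exists C U : set 'rV[R]_d,
    [/\ closed C, open U, C `<=` A, A `<=` U & mu (U `\` C : set T) < e%:E].

Section Regularity.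
Variable mu : {finite_measure set T -> \bar R}.

Lemma finite_measure_lty (B : set T) : measurable B -> mu B < +oo.
Proof. by move=> mB; rewrite ltey_eq fin_num_measure. Qed.

Lemma finite_measure_vanish (F : nat -> set T) (e : R) :
  (forall n, measurable (F n)) -> {homo F : n m / (n <= m)%N >-> (m <= n)%O} ->
  \bigcap_n F n = set0 -> (0 < e)%R -> exists n, mu (F n) < e%:E.
Proof.
move=> mF Fnd F0 e0.
have : mu (F n) @[n --> \oo] --> mu (\bigcap_n F n).
  apply: nonincreasing_cvg_mu => //; first exact: finite_measure_lty.
  exact: bigcapT_measurable.
rewrite F0 measure0 => /fine_cvg /cvgr_lt /(_ _ e0) [n _ /(_ n (leqnn n))] /= h.
by exists n; rewrite -[mu _]fineK ?fin_num_measure// lte_fin.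
Qed.

(** The approximable sets form a sigma-algebra that contains the open sets. *)
Lemma regular_borel (A : set T) : measurable A -> regular_set mu A.
Proof.
pose G : set (set T) := [set A | regular_set mu A].
suff sG : sigma_algebra [set: T] G.
  move=> mA; move: A mA; apply: smallest_sub => // U oU e e0.
  have [F [Fc Fnd FU]] := open_compact_exhaustion oU.
  have Fcl n : closed (F n) by apply: compact_closed => //; exact: norm_hausdorff.
  have mF n : measurable (F n : set T) by exact: closed_borel.
  have mU : measurable (U : set T) by exact: open_borel.
  have [||||n UFn] := @finite_measure_vanish (fun n => U `\` F n) e.
  - by move=> n; exact: measurableD.
  - move=> n m nm; apply/subsetPset; apply: setDS.
    by apply/subsetPset; exact: Fnd.
  - apply/seteqP; split=> // x Hx; have [Ux _] := Hx 0%N I.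
    by move: Ux; rewrite -FU => -[n _ Fx]; have [_] := Hx n I.
  - by [].
  by exists (F n), U; split => //; rewrite -FU => x; exists n.
clear A; split.
- move=> e e0; exists set0, set0; split => //; try exact: open0.
    exact: closed0.
  by rewrite setDv measure0.
- move=> A GA e /GA[C [U [cC oU CA AU UC]]].
  exists (~` U), (~` C); rewrite openC closedC setTD; split => //.
  - exact: subsetC.
  - exact: subsetC.
  - by rewrite setDE setCK setIC -setDE.
move=> A GA e e0.
have e2 n : (0 < e / 2 / (2 ^ n.+1)%:R)%R.
  by rewrite divr_gt0// ?divr_gt0// ltr0n expn_gt0.
have /choice[CU HCU] : forall n, exists CU : set 'rV[R]_d * set 'rV[R]_d,
    [/\ closed CU.1, open CU.2, CU.1 `<=` A n, A n `<=` CU.2 &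
    mu (CU.2 `\` CU.1 : set T) < (e / 2 / (2 ^ n.+1)%:R)%:E].
  by move=> n; have [C [U H]] := GA n _ (e2 n); exists (C, U).
pose C n := (CU n).1; pose U n := (CU n).2.
have cC n : closed (C n) by have [] := HCU n.
have oU n : open (U n) by have [] := HCU n.
have CA n : C n `<=` A n by have [] := HCU n.
have AU n : A n `<=` U n by have [] := HCU n.
have UC n : mu (U n `\` C n : set T) < (e / 2 / (2 ^ n.+1)%:R)%:E by have [] := HCU n.
have mC n : measurable (C n : set T) by exact: closed_borel.
have mU n : measurable (U n : set T) by exact: open_borel.
pose D N := \big[setU/set0]_(n < N) C n.
have cD N : closed (D N) by apply: closed_bigsetU => n _; exact: cC.
have mD N : measurable (D N : set T) by exact: closed_borel.
have mCC : measurable (\bigcup_n C n : set T) by exact: bigcupT_measurable.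
have mUU : measurable (\bigcup_n U n : set T) by exact: bigcupT_measurable.
have [||||N CDN] := @finite_measure_vanish (fun n => \bigcup_n C n `\` D n) (e / 2).
- by move=> n; exact: measurableD.
- move=> n m nm; apply/subsetPset; apply: setDS.
  move=> x; rewrite /D -!bigcup_mkord => -[i /= im Cx]; exists i => //=.
  exact: leq_trans im nm.
- apply/seteqP; split=> // x Hx; have [[n _ Cx] _] := Hx 0%N I.
  by have [_] := Hx n.+1 I; apply; rewrite /D big_ord_recr/=; right.
- by rewrite divr_gt0.
exists (D N), (\bigcup_n U n); split => //.
- exact: bigcup_open.
- move=> x; rewrite /D -bigcup_mkord => -[n _ Cx]; exists n => //; exact: CA.
- move=> x [n _ Ax]; exists n => //; exact: AU.
have sub : \bigcup_n U n `\` D N `<=`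
    (\bigcup_n (U n `\` C n)) `|` (\bigcup_n C n `\` D N).
  move=> x [[n _ Ux] Dx]; have [Cx|Cx] := pselect ((\bigcup_n C n) x).
    by right.
  by left; exists n => //; split => // Cnx; apply: Cx; exists n.
have mUC : measurable (\bigcup_n (U n `\` C n) : set T).
  by apply: bigcupT_measurable => n; exact: measurableD.
apply: (@le_lt_trans _ _ (mu (\bigcup_n (U n `\` C n) : set T) +
    mu (\bigcup_n C n `\` D N : set T))).
  apply: (le_trans _ (measureU2 _ _ _)) => //; last exact: measurableD.
  apply: le_measure => //; rewrite inE; last by apply: measurableU => //; exact: measurableD.
  exact: measurableD.
rewrite [e in e%:E](_ : _ = e / 2 + e / 2)%R; last by field.
rewrite EFinD; apply: lee_ltD => //; first by rewrite fin_num_measure.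
apply: (@le_trans _ _ (\sum_(n <oo) mu (U n `\` C n : set T))).
  apply: measure_sigma_subadditive => //.
  by move=> n; exact: measurableD.
apply: (@le_trans _ _ (\sum_(n <oo) (e / 2 / (2 ^ n.+1)%:R)%:E)).
  by apply: lee_nneseries => n _ //; exact/ltW.
by apply: epsilon_trick0; rewrite ltW// divr_gt0.
Qed.

End Regularity.

End BorelSets.

(** * Vitali coverings and Lebesgue points *)

Section VitaliDensity.
Context {R : realType} {d : nat}.
Local Notation T := (borelRV R d).
Local Open Scope ereal_scope.
Variable la : {finite_measure set T -> \bar R}.

Lemma max_radius (s : seq ('rV[R]_d * R)) : s != [::] ->
  exists2 p, p \in s & forall q, q \in s -> (q.2 <= p.2)%R.
Proof.
elim: s => // p [|q s] IH _.
  by exists p; rewrite ?inE// => r; rewrite inE => /eqP->.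
have [//|p' p's p'max] := IH.
have [pp'|pp'] := lerP p.2 p'.2.
  exists p'; first by rewrite inE p's orbT.
  by move=> r; rewrite inE => /predU1P[->//|/p'max].
exists p; first by rewrite inE eqxx.
move=> r; rewrite inE => /predU1P[->//|/p'max/le_trans]; apply.
exact: ltW.
Qed.

Definition union_balls (s : seq ('rV[R]_d * R)) : set T :=
  \big[setU/set0]_(p <- s) ball p.1 p.2.

Lemma in_union_balls s x :
  union_balls s x <-> exists2 p, p \in s & ball p.1 p.2 x.
Proof.
rewrite /union_balls -bigcup_seq; split=> [[p/= ps px]|[p ps px]]; by exists p.
Qed.

Lemma measurable_union_balls s : measurable (union_balls s).
Proof. by apply: bigsetU_measurable => p _; exact: ball_borel. Qed.

Variables (nu : set T -> \bar R) (c : R).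
Hypothesis c0 : (0 < c)%R.
Hypothesis nu0 : forall A, measurable A -> 0 <= nu A.
Hypothesis nuD : forall A B, measurable A -> measurable B -> B `<=` A ->
  nu A = nu B + nu (A `\` B).

(** Vitali's covering argument by induction on the number of balls: the ball of
    largest radius, enlarged three times, absorbs every ball that it meets, and
    the others live in the part of W outside of it. *)
Lemma vitali_finite_balls s (W : set T) : measurable W ->
  (forall p, p \in s -> [/\ (0 < p.2)%R, ball p.1 p.2 `<=` W &
     c%:E * la (ball p.1 (3 * p.2)) <= nu (ball p.1 p.2)]) ->
  c%:E * la (union_balls s) <= nu W.
Proof.
have [n] := ubnP (size s); elim: n => // n IH in s W * => sn mW sW.
have [->|s0] := eqVneq s [::].
  by rewrite /union_balls big_nil measure0 mule0; exact: nu0.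
have [p ps pmax] := max_radius s0.
have [p0 pW pnu] := sW p ps.
pose s2 := [seq q <- s | `[< ball q.1 q.2 `&` ball p.1 p.2 = set0 >]].
have mp r : measurable (ball p.1 r : set T) by exact: ball_borel.
have s2W : c%:E * la (union_balls s2) <= nu (W `\` ball p.1 p.2).
  apply: IH; [|exact: measurableD|].
    rewrite -ltnS (leq_trans _ sn)// ltnS size_filter.
    set pr := (X in count X s).
    rewrite -[X in (_ < X)%N](count_predC pr s) -addn1 leq_add2l -has_count.
    apply/hasP; exists p => //=; apply/asboolP; rewrite setIid => p00.
    by have := ballxx p.1 p0; rewrite p00.
  move=> q; rewrite mem_filter => /andP[/asboolP qp qs].
  have [q0 qW qnu] := sW q qs; split => // x qx; split; first exact: qW.
  by move=> px; have : set0 x by rewrite -qp.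
have sub : union_balls s `<=` ball p.1 (3 * p.2) `|` union_balls s2.
  move=> x /in_union_balls[q qs qx].
  have [qp|] := pselect (ball q.1 q.2 `&` ball p.1 p.2 = set0).
    right; apply/in_union_balls; exists q => //.
    by rewrite mem_filter qs andbT; exact/asboolP.
  move=> /eqP/set0P[y [qy py]]; left.
  move: qx qy py; rewrite !in_ball => qx qy py.
  have qr := pmax q qs.
  rewrite (_ : p.1 - x = (p.1 - y) - (q.1 - y) + (q.1 - x))%R; last first.
    by rewrite opprB !addrA !subrK.
  rewrite (le_lt_trans (ler_normD _ _))// (le_lt_trans (lerD (ler_normB _ _) (lexx _)))//.
  move: (Num.norm _) (Num.norm _) (Num.norm _) qx qy py => a b e; lra.
apply: (@le_trans _ _ (c%:E * (la (ball p.1 (3 * p.2)) + la (union_balls s2)))).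
  rewrite lee_pmul2l ?fin_numE// ?lte_fin//.
  apply: (le_trans _ (measureU2 _ _ _)); rewrite ?inE//; last exact: measurable_union_balls.
  apply: le_measure; rewrite ?inE//; first exact: measurable_union_balls.
  by apply: measurableU => //; exact: measurable_union_balls.
rewrite ge0_muleDr// (nuD mW (mp _) pW).
exact: leeD.
Qed.

(** The finite case, applied to compact subsets of the union of the balls.  The
    estimate on enlarged balls is what makes the covering argument work for a
    measure without any doubling property. *)
Lemma vitali_open_cover (S : set T) (U : set 'rV[R]_d) : open U ->
  (forall x, S x -> exists2 r : R, (0 < r)%R & ball x r `<=` U /\
    c%:E * la (ball x (3 * r)) <= nu (ball x r)) ->
  exists W : set 'rV[R]_d,
    [/\ open W, S `<=` W & la W <= (c^-1)%:E * nu (U : set T)].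
Proof.
move=> oU SU.
have /choice[r Hr] : forall x : 'rV[R]_d, exists r : R, S x ->
    [/\ (0 < r)%R, ball x r `<=` U & c%:E * la (ball x (3 * r)) <= nu (ball x r)].
  move=> x; have [/SU[r r0 [rU rnu]]|Sx] := pselect (S x); first by exists r.
  by exists 0%R.
pose W : set 'rV[R]_d := \bigcup_(x in S) ball x (r x).
have oW : open W by apply: bigcup_open => x _; exact: ball_open.
have mU : measurable (U : set T) by exact: open_borel.
exists W; split=> //.
  by move=> x Sx; exists x => //; apply: ballxx; have [] := Hr x Sx.
have [F [Fc Fnd FW]] := open_compact_exhaustion oW.
have mF n : measurable (F n : set T).
  by apply: closed_borel; apply: compact_closed => //; exact: norm_hausdorff.
have FU n : la (F n : set T) <= (c^-1)%:E * nu (U : set T).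
  have FnW : F n `<=` W by move=> x Fx; rewrite -FW; exists n.
  have := Fc n; rewrite compact_cover.
  move=> /(_ _ S (fun x => ball x (r x)))[||D DS FD].
  - by move=> x _; exact: ball_open.
  - exact: FnW.
  pose s := [seq (x, r x) | x <- finmap.enum_fset D].
  have sU : c%:E * la (union_balls s) <= nu (U : set T).
    apply: vitali_finite_balls => // p /mapP[x xD ->] /=.
    by apply: Hr; have := DS x; rewrite inE; apply.
  rewrite lee_pdivlMl//; apply: (le_trans _ sU).
  rewrite lee_pmul2l ?fin_numE ?lte_fin//.
  apply: le_measure; rewrite ?inE//; first exact: measurable_union_balls.
  move=> x /FD[y /= yD yx]; apply/in_union_balls; exists (y, r y) => //.
  by apply/mapP; exists y.
have : la (F n : set T) @[n --> \oo] --> la (\bigcup_n F n : set T).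
  by apply: nondecreasing_cvg_mu => //; rewrite FW; exact: open_borel.
rewrite FW => laF; rewrite -(cvg_lim _ laF)//.
by apply: lime_le; [apply/cvg_ex; eexists; exact: laF|exact: nearW].
Qed.

End VitaliDensity.

Section LebesguePoints.
Context {R : realType} {d : nat}.
Local Notation T := (borelRV R d).
Local Open Scope ereal_scope.
Variable la : {finite_measure set T -> \bar R}.

Lemma negligible_of_small (S : set T) :
  (forall e : R, (0 < e)%R ->
    exists W, [/\ measurable W, S `<=` W & la W <= e%:E]) ->
  la.-negligible S.
Proof.
move=> small.
have /choice[W HW] : forall n : nat, exists W,
    [/\ measurable W, S `<=` W & la W <= (n.+1%:R^-1)%:E].
  by move=> n; apply: small; rewrite invr_gt0.
have mW n : measurable (W n) by have [] := HW n.
have mI : measurable (\bigcap_n W n) by exact: bigcapT_measurable.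
exists (\bigcap_n W n); split=> // [|x Sx n _]; last by have [_ + _] := HW n; apply.
apply/eqP; rewrite eq_le measure_ge0 andbT; apply/lee_addgt0Pr => e e0.
have [_ _ We] := HW (Num.truncn e^-1); rewrite add0e.
apply: (@le_trans _ _ (la (W (Num.truncn e^-1)))).
  by apply: le_measure; rewrite ?inE// => x; exact.
rewrite (le_trans We)// lee_fin invf_ple ?posrE// ltW//.
exact: truncnS_gt.
Qed.

Variable f : T -> R.
Hypothesis intf : la.-integrable setT (EFin \o f).

Let dist_int (A : set T) (q : R) : \bar R := \int[la]_(y in A) (`|f y - q|)%:E.

Let mf : measurable_fun setT f.
Proof. by apply/measurable_EFinP; exact: measurable_int intf. Qed.

Let mdistR q : measurable_fun (setT : set T) (fun y => `|f y - q|%R).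
Proof.
apply: (@measurableT_comp _ _ _ _ _ _ (@Num.norm R R)) => //.
exact: measurable_funB.
Qed.

Let mdist q (A : set T) : measurable_fun A (fun y => (`|f y - q|)%:E).
Proof. by apply: measurable_funTS; apply/measurable_EFinP; exact: mdistR. Qed.

Let dist_int_ge0 A q : 0 <= dist_int A q.
Proof. by apply: integral_ge0 => y _; rewrite lee_fin. Qed.

Let intfq q : la.-integrable setT (EFin \o (fun y => f y - q)%R).
Proof.
have -> : (EFin \o (fun y => f y - q)%R) = (EFin \o f) \- (fun=> q%:E) by [].
by apply: integrableB => //; exact: finite_measure_integrable_cst.
Qed.

Let close q n : set T := [set x | (`|f x - q| <= n.+1%:R^-1)%R].

Let mclose q n : measurable (close q n).
Proof.
rewrite -[close q n]setTI.
have := mdistR q measurableT (measurable_itv `]-oo, (n.+1%:R^-1 : R)]%R).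
by congr (measurable (_ `&` _)); apply/seteqP; split=> x; rewrite /= in_itv.
Qed.

Let bad q n : set T := [set x | close q n x /\ forall r0 : R, (0 < r0)%R ->
  exists r : R, [/\ (0 < r)%R, (r < r0)%R &
    (n.+1%:R^-1)%:E * la (ball x (3 * r)) <= dist_int (ball x r `\` close q n) q]].

Let bad_negligible q n : la.-negligible (bad q n).
Proof.
apply: negligible_of_small => e e0.
pose c : R := (n.+1%:R^-1)%R.
have c0 : (0 < c)%R by rewrite invr_gt0.
(* Outer regularity gives an open U around the level set whose excess is so
   small that the integral over it is at most c e. *)
have [del [del0 Hdel]] := integral_normr_continuous (intfq q) (mulr_gt0 c0 e0).
have [C [U [cC oU CE EU UC]]] := regular_borel la (mclose q n) del0.
have mU : measurable (U : set T) by exact: open_borel.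
pose nu (A : set T) := dist_int (A `\` close q n) q.
have nuD A B : measurable A -> measurable B -> B `<=` A ->
    nu A = nu B + nu (A `\` B).
  move=> mA mB BA; rewrite /nu /dist_int -ge0_integral_setU//=.
  - congr (integral _ _ _); rewrite -setDUl; congr (_ `\` _).
    by rewrite setDUK.
  - exact: measurableD.
  - by do 2 apply: measurableD => //.
  - by rewrite disj_set2E; apply/eqP; apply/seteqP; split=> // x [[Bx _] [[_ /(_ Bx)]]].
have badU x : bad q n x -> exists2 r : R, (0 < r)%R & ball x r `<=` U /\
    c%:E * la (ball x (3 * r)) <= nu (ball x r).
  move=> [Ex badx].
  have /nbhs_ballP [r0 /= r00 r0U] := open_nbhs_nbhs (conj oU (EU _ Ex)).
  have [r [rr0 rr bx]] := badx _ r00; exists r => //; split=> //.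
  by apply: subset_trans r0U; apply: le_ball; exact: ltW.
have [W [oW SW laW]] :=
  vitali_open_cover c0 (fun A _ => dist_int_ge0 _ _) nuD oU badU.
exists (W : set T); split=> //; first exact: open_borel.
rewrite (le_trans laW)// /nu lee_pdivrMl// -EFinM.
have mUE : measurable (U `\` close q n : set T) by exact: measurableD.
have := Hdel _ mUE; have -> : la (U `\` close q n) < del%:E.
  apply: le_lt_trans UC; apply: le_measure; rewrite ?inE//; last exact: setDS.
  by apply: measurableD => //; exact: closed_borel.
move=> /(_ isT) /ltW; rewrite /Rintegral -lee_fin fineK//.
apply: integrable_fin_num => //.
have := integrable_abse (intfq q).
by apply: integrableS.
Qed.

(** Lebesgue points for an arbitrary finite measure, at the price of the larger
    ball [ball x (3 * r)] on the right.  At an exceptional point, f is close to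
    some rational [q] while the mean of |f - q| over the far set {|f - q| > 1/n}
    is not small; these points are covered by Vitali balls inside an open set on
    which that far part has small integral. *)
Lemma lebesgue_points : la.-negligible (~` [set x | forall e : R, (0 < e)%R ->
  exists2 r0 : R, (0 < r0)%R & forall r : R, (0 < r)%R -> (r < r0)%R ->
    \int[la]_(y in ball x r) (`|f y - f x|)%:E <= e%:E * la (ball x (3 * r))]).
Proof.
pose F (k : nat) : set T := if unpickle k is Some (q, n) then bad (ratr q) n else set0.
apply: (@negligibleS _ _ _ _ (\bigcup_k F k)); last first.
  apply: negligible_bigcup => k; rewrite /F; case: (unpickle k) => [[q n]|].
    exact: bad_negligible.
  exact: negligible_set0.
move=> x /= /existsNP[e /not_implyP[e0 nx]].
pose n := Num.truncn (3 / e)%R.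
have n3 : (3 * n.+1%:R^-1 <= e)%R.
  rewrite ler_pdivrMr// -ler_pdivrMl// mulrC ltW//; exact: truncnS_gt.
pose c : R := (n.+1%:R^-1)%R.
have c0 : (0 < c)%R by rewrite invr_gt0.
have [q] : exists q : rat, ratr q \in `](f x - c)%R, (f x + c)%R[.
  by apply: rat_in_itvoo; rewrite ltrBlDr -addrA ltrDl addr_gt0.
rewrite in_itv/= => /andP[q1 q2].
have fq : (`|f x - ratr q| <= c)%R by rewrite ler_norml; lra.
exists (pickle (q, n)); first exact: I.
rewrite /F pickleK; split; first exact: fq.
move=> r0 r00; apply: contrapT => nr; apply: nx; exists r0 => // r rr rr0.
have mb : measurable (ball x r : set T) by exact: ball_borel.
have mcl : measurable (close (ratr q) n) by exact: mclose.
have mb1 : measurable (ball x r `&` close (ratr q) n : set T) by exact: measurableI.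
have mb2 : measurable (ball x r `\` close (ratr q) n : set T) by exact: measurableD.
have far : dist_int (ball x r `\` close (ratr q) n) (ratr q) <=
    c%:E * la (ball x (3 * r)).
  by rewrite leNgt; apply/negP => far; apply: nr; exists r; split=> //; exact: ltW.
have bb : la (ball x r) <= la (ball x (3 * r)).
  apply: le_measure; rewrite ?inE//; try exact: ball_borel.
  by apply: le_ball; lra.
have near_ : dist_int (ball x r `&` close (ratr q) n) (ratr q) <=
    c%:E * la (ball x (3 * r)).
  apply: (@le_trans _ _ (c%:E * la (ball x r `&` close (ratr q) n))); last first.
    rewrite lee_pmul2l ?fin_numE ?lte_fin//; apply: le_trans bb.
    by apply: le_measure; rewrite ?inE// => y [].
  rewrite -integral_cst//; apply: ge0_le_integral => //=.
  by move=> y [_ yc]; rewrite lee_fin.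
apply: (@le_trans _ _ (\int[la]_(y in ball x r) ((`|f y - ratr q|)%:E + c%:E))).
  apply: ge0_le_integral => //=.
  - by apply: emeasurable_funD => //; exact: mdist.
  - move=> y _; rewrite -EFinD lee_fin.
    rewrite (_ : f y - f x = (f y - ratr q) - (f x - ratr q))%R; last first.
      by ring.
    by rewrite (le_trans (ler_normB _ _))// lerD2l.
rewrite ge0_integralD//=; last by move=> y _; rewrite lee_fin ltW.
rewrite integral_cst//.
rewrite -[X in \int[la]_(_ in X) _](setUIDK (ball x r) (close (ratr q) n)).
rewrite ge0_integral_setU//=; last first.
  by rewrite disj_set2E; apply/eqP; apply/seteqP; split=> // y [[_ yc] [_ /(_ yc)]].
apply: (@le_trans _ _ ((3 * c)%:E * la (ball x (3 * r)))); last first.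
  by rewrite lee_wpmul2r.
rewrite (_ : 3 * c = c + c + c)%R; last by ring.
rewrite !EFinD !ge0_muleDl ?lee_fin ?addr_ge0 ?(ltW c0)//.
apply: leeD; first exact: leeD.
by rewrite lee_pmul2l ?fin_numE ?lte_fin.
Qed.

End LebesguePoints.

(** * Power decay and the mass distribution principle *)

Section PowerDecay.
Context {R : realType}.
Implicit Types (f : R -> R) (C r : R).

Lemma powRV (a kappa : R) : 0 < a -> a^-1 `^ kappa = (a `^ kappa)^-1.
Proof.
move=> a0; have pa : a `^ kappa != 0 by rewrite gt_eqF// powR_gt0.
apply: (mulIf pa); rewrite mulVf// -powRM ?invr_ge0 ?(ltW a0)//.
by rewrite mulVf ?gt_eqF// powR1.
Qed.

(** The gain [eta ^ (n - kappa)] absorbs the constant [C * 3 `^ kappa] for a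
    small [eta], so that [f (theta * rho) <= theta `^ kappa * f rho] with
    [theta = eta / 3], which is iterated along a geometric sequence. *)
Lemma geometric_decay f (kappa C eta0 : R) (n : nat) :
  (forall r, 0 <= f r) -> {homo f : r s / r <= s} ->
  0 < kappa -> kappa < n%:R -> 0 < C -> 0 < eta0 ->
  (forall eta, 0 < eta -> eta <= eta0 -> exists2 r0, 0 < r0 &
     forall r, 0 < r -> r < r0 -> f (eta * r) <= C * eta ^+ n * f (3 * r)) ->
  exists C' r1, 0 < r1 /\ forall r, 0 < r -> r < r1 -> f r <= C' * r `^ kappa.
Proof.
move=> f0 fnd k0 kn C0 eta00 decay.
have nk : 0 < n%:R - kappa by rewrite subr_gt0.
pose D := C * 3 `^ kappa.
have D0 : 0 < D by rewrite mulr_gt0// powR_gt0.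
pose eta := Num.min (Num.min eta0 1) (D^-1 `^ (n%:R - kappa)^-1).
have eta_gt0 : 0 < eta by rewrite !lt_min eta00 ltr01 powR_gt0// invr_gt0.
have eta_le0 : eta <= eta0 by rewrite !ge_min lexx.
have [r0 r00 Hr0] := decay eta eta_gt0 eta_le0.
have eta1 : eta <= 1 by rewrite !ge_min lexx orbT.
have etaD : D * eta `^ (n%:R - kappa) <= 1.
  rewrite mulrC -ler_pdivlMr// div1r.
  rewrite (@le_trans _ _ ((D^-1 `^ (n%:R - kappa)^-1) `^ (n%:R - kappa)))//.
    apply: ge0_ler_powR; rewrite ?nnegrE ?powR_ge0 ?(ltW nk) ?(ltW eta_gt0)//.
    by rewrite /eta ge_min lexx orbT.
  by rewrite -powRrM mulVf ?gt_eqF// powRr1// invr_ge0 ltW.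
clearbody eta; pose theta := eta / 3.
have theta0 : 0 < theta by rewrite divr_gt0.
have theta1 : theta < 1 by rewrite ltr_pdivrMr// mul1r (le_lt_trans eta1)// ltr1n.
have step rho : 0 < rho -> rho < 3 * r0 -> f (theta * rho) <= theta `^ kappa * f rho.
  move=> rho0 rhor.
  have r3 : rho / 3 < r0 by rewrite ltr_pdivrMr// mulrC.
  have := Hr0 _ (divr_gt0 rho0 (ltr0Sn R 2)) r3.
  rewrite (_ : eta * (rho / 3) = theta * rho); last by rewrite /theta; ring.
  rewrite (_ : 3 * (rho / 3) = rho); last by field.
  move=> /le_trans; apply.
  rewrite ler_wpM2r//.
  have -> : eta ^+ n = eta `^ (n%:R - kappa) * eta `^ kappa.
    rewrite -powRD; last by apply/implyP => _; rewrite gt_eqF.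
    by rewrite subrK powR_mulrn// ltW.
  have -> : theta `^ kappa = (3 `^ kappa)^-1 * eta `^ kappa.
    by rewrite /theta powRM ?invr_ge0 ?(ltW eta_gt0)// mulrC powRV.
  rewrite mulrA ler_wpM2r ?powR_ge0// -[leRHS]mul1r ler_pdivlMr ?powR_gt0//.
  by rewrite mulrAC.
clearbody theta; pose rho1 := r0.
have rho1r : rho1 < 3 * r0 by rewrite ltr_pMl// ltr1n.
have iter_step j : f (theta ^+ j * rho1) <= (theta ^+ j) `^ kappa * f rho1.
  elim: j => [|j IH]; first by rewrite expr0 !mul1r powR1 mul1r.
  have tj0 : 0 < theta ^+ j by rewrite exprn_gt0.
  rewrite !exprS -mulrA (le_trans (step _ _ _))// ?mulr_gt0//.
    rewrite (le_lt_trans _ rho1r)// ler_piMl ?(ltW r00)//.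
    by rewrite exprn_ile1 ?(ltW theta0)// ltW.
  rewrite powRM ?(ltW theta0) ?(ltW tj0)// -mulrA ler_wpM2l ?powR_ge0//.
exists ((theta * rho1)^-1 `^ kappa * f rho1), rho1; split=> // r rr rr1.
have [j Hj] : exists j, theta ^+ j * rho1 < r.
  have : (theta ^+ j * rho1) @[j --> \oo] --> (0 * rho1 : R).
    apply: cvgMr_tmp.
    by apply: cvg_expr; rewrite ger0_norm// ltW.
  rewrite mul0r => /cvgr_lt /(_ _ rr) [j _ /(_ j (leqnn j)) h].
  by exists j.
have := ex_minnP (ex_intro (fun j => theta ^+ j * rho1 < r) j Hj).
case: ex_minnP => -[|i] ti imin _.
  by move: ti; rewrite expr0 mul1r ltNge (ltW rr1).
have rti : r <= theta ^+ i * rho1.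
  by rewrite leNgt; apply/negP => /imin; rewrite ltnn.
rewrite (le_trans (fnd _ _ rti))// (le_trans (iter_step i))//.
have tr0 : 0 < theta * rho1 by rewrite mulr_gt0.
rewrite mulrAC ler_wpM2r// -powRM ?invr_ge0 ?(ltW tr0) ?(ltW rr)//.
apply: ge0_ler_powR; rewrite ?nnegrE ?exprn_ge0 ?(ltW k0) ?(ltW theta0)//.
  by rewrite mulr_ge0 ?invr_ge0 ?(ltW tr0) ?(ltW rr).
rewrite mulrC ler_pdivlMr// mulrA -exprSr; exact: ltW.
Qed.

End PowerDecay.

Section MassDistribution.
Context {R : realType} {d : nat}.
Local Notation T := (borelRV R d).
Implicit Types (U A : set 'rV[R]_d) (x y : 'rV[R]_d).

Lemma enorm_rVE x : enorm x = Num.sqrt (sqn x).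
Proof. by rewrite /enorm big_ord1 sqnE. Qed.

Lemma norm_le_enorm x : `|x| <= enorm x.
Proof.
rewrite enorm_rVE -[leLHS]ger0_norm// -sqrtr_sqr ler_wsqrtr//.
exact: norm_sqr_le_sqn.
Qed.

Lemma enorm_le_norm x : enorm x <= d%:R * `|x|.
Proof.
rewrite enorm_rVE -[leRHS]ger0_norm ?mulr_ge0// -sqrtr_sqr ler_wsqrtr//.
exact: sqn_le.
Qed.

Local Open Scope ereal_scope.

Lemma ediam_ge U x y : U x -> U y -> (enorm (x - y))%:E <= ediam U.
Proof. by move=> Ux Uy; apply: ereal_sup_ubound; exists x => //; exists y. Qed.

Lemma ediam_ge0 U : U !=set0 -> 0 <= ediam U.
Proof.
move=> [x Ux]; apply: le_trans (ediam_ge Ux Ux).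
by rewrite lee_fin sqrtr_ge0.
Qed.

Lemma ediam_pow_ge0 kappa U : 0 <= ediam_pow kappa U.
Proof. by rewrite /ediam_pow; case: asboolP => // _; exact: poweR_ge0. Qed.

Lemma ediam_powE kappa U (delta : R) : U !=set0 -> ediam U <= delta%:E ->
  [/\ ediam U = (fine (ediam U))%:E, (0 <= fine (ediam U))%R,
      (fine (ediam U) <= delta)%R &
      ediam_pow kappa U = (fine (ediam U) `^ kappa)%:E].
Proof.
move=> U0 Ud; have d0 := ediam_ge0 U0.
have dE : ediam U = (fine (ediam U))%:E.
  by rewrite fineK// ge0_fin_numE// (le_lt_trans Ud)// ltry.
split=> //; first by rewrite -lee_fin -dE.
  by rewrite -lee_fin -dE.
rewrite /ediam_pow; case: asboolP => [U00|_]; last by rewrite dE poweR_EFin.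
by move: U0; rewrite U00 => -[].
Qed.

Variable la : {finite_measure set T -> \bar R}.

(** The mass distribution principle: a cover by sets of diameters D_i yields a
    cover by balls of radii 2 D_i, of total mass at most a multiple of the sum of
    the D_i^kappa.  The constants [C] and [r1] are made uniform by splitting [A]
    into countably many pieces. *)
Lemma mass_distribution (kappa : R) A : (0 < kappa)%R -> hausdorff kappa A = 0 ->
  (forall x, A x -> exists C r1 : R, (0 < r1)%R /\ forall r : R,
     (0 < r)%R -> (r < r1)%R -> la (ball x r) <= (C * r `^ kappa)%:E) ->
  la.-negligible (A : set T).
Proof.
move=> k0 HA Agrowth.
pose G (n : nat) : set T := [set x | A x /\ forall r : R, (0 < r)%R ->
  (r < n.+1%:R^-1)%R -> la (ball x r) <= (n.+1%:R * r `^ kappa)%:E].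
apply: (@negligibleS _ _ _ _ (\bigcup_n G n)).
  move=> x Ax; have [C [r1 [r10 Hr1]]] := Agrowth x Ax.
  pose n := maxn (Num.truncn C) (Num.truncn r1^-1).
  have nC : (C <= n.+1%:R)%R.
    by rewrite ltW// (lt_le_trans (truncnS_gt C))// ler_nat ltnS leq_maxl.
  have nr : (n.+1%:R^-1 <= r1)%R.
    rewrite invf_ple ?posrE// ltW// (lt_le_trans (truncnS_gt _))//.
    by rewrite ler_nat ltnS leq_maxr.
  exists n => //; split=> // r rr rn; rewrite (le_trans (Hr1 _ rr _))//.
    exact: lt_le_trans rn nr.
  by rewrite lee_fin ler_wpM2r ?powR_ge0.
apply: negligible_bigcup => n; apply: negligible_of_small => e e0.
pose delta : R := ((4 * n.+1%:R)^-1)%R.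
have delta0 : (0 < delta)%R by rewrite invr_gt0 mulr_gt0.
pose K : R := (n.+1%:R * 2 `^ kappa)%R.
have K0 : (0 < K)%R by rewrite mulr_gt0// powR_gt0.
pose e1 : R := (e / (2 * K))%R.
have e10 : (0 < e1)%R by rewrite divr_gt0// mulr_gt0.
have : hausdorff_delta kappa delta A < e1%:E.
  apply: (@le_lt_trans _ _ (hausdorff kappa A)); last by rewrite HA lte_fin.
  by apply: ereal_sup_ubound; exists delta.
move=> /ereal_inf_lt[_ [U [AU Udelta] <-]] sumU.
(* A positive radius for the sets of diameter 0. *)
pose s (i : nat) : R := (Num.min delta ((e1 / (2 ^ i.+1)%:R) `^ kappa^-1))%R.
have es0 (i : nat) : (0 < e1 / (2 ^ i.+1)%:R)%R by rewrite divr_gt0// ltr0n expn_gt0.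
have s0 i : (0 < s i)%R by rewrite lt_min delta0 powR_gt0.
have sk i : (s i `^ kappa <= e1 / (2 ^ i.+1)%:R)%R.
  rewrite (@le_trans _ _ (((e1 / (2 ^ i.+1)%:R) `^ kappa^-1) `^ kappa)%R)//.
    apply: ge0_ler_powR; rewrite ?nnegrE ?powR_ge0 ?(ltW k0) ?(ltW (s0 _))//.
    by rewrite ge_min lexx orbT.
  by rewrite -powRrM mulVf ?gt_eqF// powRr1// ltW.
have /choice[W HW] : forall i, exists Wi : set T, [/\ measurable Wi,
    G n `&` U i `<=` Wi &
    la Wi <= K%:E * (ediam_pow kappa (U i) + (e1 / (2 ^ i.+1)%:R)%:E)].
  move=> i; have [GU|/set0P[x [Gx Ux]]] := eqVneq (G n `&` U i) set0.
    exists set0; rewrite GU measure0; split=> //.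
    by rewrite mule_ge0 ?adde_ge0 ?ediam_pow_ge0// lee_fin ltW.
  have [|dE d0 dd ->] := ediam_powE kappa _ (Udelta i); first by exists x.
  set D := fine (ediam (U i)) in dE d0 dd *.
  pose r : R := (2 * Num.max D (s i))%R.
  have r0 : (0 < r)%R by rewrite mulr_gt0// lt_max s0 orbT.
  exists (ball x r : set T); split; first exact: ball_borel.
    move=> y [_ Uy]; rewrite in_ball (le_lt_trans (norm_le_enorm _))//.
    have := ediam_ge Ux Uy; rewrite dE lee_fin => /le_lt_trans; apply.
    have : (D <= Num.max D (s i))%R by rewrite le_max lexx.
    by move: r0; rewrite /r; move: (Num.max _ _) => D'; lra.
  have rn : (r < n.+1%:R^-1)%R.
    have dn : (delta * 4 = n.+1%:R^-1)%R by rewrite /delta invfM mulrAC mulVf// mul1r.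
    have : (Num.max D (s i) <= delta)%R by rewrite ge_max dd ge_min lexx.
    rewrite /r -dn; move: (Num.max _ _) delta0 => D'; lra.
  have [_ /(_ r r0 rn)] := Gx; move=> /le_trans; apply; rewrite -EFinD -EFinM lee_fin.
  rewrite /K /r powRM// ?le_max ?d0// mulrA ler_wpM2l ?(ltW K0)//.
  have [Ds|Ds] := leP D (s i).
    by rewrite (le_trans (sk i))// lerDr powR_ge0.
  by rewrite lerDl ltW.
have mW i : measurable (W i) by have [] := HW i.
exists (\bigcup_i W i); split.
- exact: bigcupT_measurable.
- move=> x Gx; have [i _ Ux] := AU x Gx.1.
  by exists i => //; have [_ + _] := HW i; apply.
have UP i : 0 <= ediam_pow kappa (U i) by exact: ediam_pow_ge0.
apply: (le_trans (measure_sigma_subadditive la _ _ (@subset_refl _ _))) => //.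
  exact: bigcupT_measurable.
apply: (@le_trans _ _ (\sum_(i <oo) (K%:E *
    (ediam_pow kappa (U i) + (e1 / (2 ^ i.+1)%:R)%:E)))).
  by apply: lee_nneseries => i _ //; have [] := HW i.
rewrite nneseriesZl//; last by move=> i _; rewrite adde_ge0// lee_fin ltW.
rewrite (_ : e = K * (2 * e1))%R; last first.
  by rewrite /e1; field; rewrite gt_eqF.
rewrite [(K * _)%:E]EFinM lee_pmul2l ?fin_numE ?lte_fin//.
apply: (le_trans (epsilon_trick _ _ _)) => //; first exact: ltW.
by rewrite mulr_natl mulr2n EFinD leeD2r// ltW.
Qed.

End MassDistribution.

(** * Local densities of a vector measure *)

Section FiniteMeasures.
Context {d0 : measure_display} {X : measurableType d0} {R : realType}.
Local Open Scope ereal_scope.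
Import HBNNSimple.

(** The integral is defined through simple functions, hence evaluates the set
    functions on level sets only; these lie in [K] for a function that vanishes
    off [K].  Neither set function has to be a measure, which applies to the
    upper variations of a vector measure that is only defined locally. *)
Lemma eq_integral_carrier (m1 m2 : set X -> \bar R) (K : set X) (f : X -> \bar R) :
  (forall A, measurable A -> A `<=` K -> m1 A = m2 A) ->
  (forall x, ~ K x -> f x = 0) ->
  \int[m1]_x f x = \int[m2]_x f x.
Proof.
move=> m12 fK; rewrite /integral patch_setT /=.
have nn (g : X -> \bar R) : (forall x, ~ K x -> g x = 0) ->
    ereal_sup [set sintegral m1 h | h in
      [set h : {nnsfun X >-> R} | forall x, (h x)%:E <= g x]] =
    ereal_sup [set sintegral m2 h | h in
      [set h : {nnsfun X >-> R} | forall x, (h x)%:E <= g x]].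
  move=> gK; congr ereal_sup.
  have E (h : {nnsfun X >-> R}) : (forall x, (h x)%:E <= g x) ->
      sintegral m1 h = sintegral m2 h.
    move=> hg; apply: eq_fsbigr => r _.
    have [->|r0] := eqVneq r 0%R; first by rewrite !mul0e.
    congr (_ * _); apply: m12 => // x /= hx; apply: contrapT => Kx.
    have hx0 : (0 <= h x)%R by exact: fun_ge0.
    have := hg x; rewrite gK// lee_fin hx => r0'; move/eqP: r0; apply.
    by apply/eqP; rewrite eq_le r0' -hx.
  by apply/seteqP; split=> _ [h hg <-]; exists h => //; rewrite E.
congr (_ - _); apply: nn => x Kx.
  by rewrite funeposE fK// maxxx.
by rewrite funenegE fK// oppe0 maxxx.
Qed.

Section add.
Variables p q : {finite_measure set X -> \bar R}.

Let fin_add : fin_num_fun (measure_add p q).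
Proof. by move=> A mA; rewrite measure_addE fin_numD !fin_num_measure. Qed.

HB.instance Definition _ := Measure.on (measure_add p q).
HB.instance Definition _ := @Measure_isFinite.Build _ _ _ (measure_add p q) fin_add.

Lemma finite_measure_add : exists r : {finite_measure set X -> \bar R},
  forall A, r A = p A + q A.
Proof.
exists (measure_add p q : {finite_measure set X -> \bar R}) => A.
exact: measure_addE.
Qed.

End add.

Lemma finite_measure_sum n (p : 'I_n -> {finite_measure set X -> \bar R}) :
  exists r : {finite_measure set X -> \bar R}, forall A, r A = \sum_i p i A.
Proof.
elim: n p => [|n IH] p.
  exists (mzero : {finite_measure set X -> \bar R}) => A.
  by rewrite big_ord0.
have [r rE] := IH (fun i => p (lift ord0 i)).
have [s sE] := finite_measure_add (p ord0) r.
by exists s => A; rewrite sE rE big_ord_recl.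
Qed.

(** The Radon-Nikodym derivative is finite everywhere here, which allows a
    real-valued density. *)
Lemma real_density (p la : {finite_measure set X -> \bar R}) :
  (forall A, measurable A -> p A <= la A) ->
  exists g : X -> R, [/\ la.-integrable setT (EFin \o g),
    forall A, measurable A -> p A = \int[la]_(x in A) (g x)%:E &
    forall phi : X -> R, measurable_fun setT phi ->
      (exists M, forall x, (`|phi x| <= M)%R) ->
      p.-integrable setT (EFin \o phi) /\
      \int[p]_x (phi x)%:E = \int[la]_x (phi x * g x)%:E].
Proof.
move=> pla; have dom : p `<< la.
  apply/null_content_dominatesP => A mA laA; apply/eqP.
  by rewrite eq_le measure_ge0 andbT -laA pla.
pose G := Radon_Nikodym (charge_of_finite_measure p) la.
have Gfin x : G x \is a fin_num by exact: Radon_Nikodym_fin_num.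
have GE : EFin \o (fine \o G) = G by apply/funext => x /=; rewrite fineK.
exists (fine \o G); split.
- by rewrite GE; exact: Radon_Nikodym_integrable.
- move=> A mA; rewrite (_ : p A = charge_of_finite_measure p A)//.
  rewrite (@Radon_Nikodym_integral _ _ _ _ la)//.
  by apply: eq_integral => x _; rewrite /= fineK.
move=> phi mphi [M phiM].
have iphi : p.-integrable setT (EFin \o phi).
  apply: measurable_bounded_integrable => //.
    by rewrite ltey_eq fin_num_measure.
  exists M; split; first exact: num_real.
  by move=> t Mt x _; exact: le_trans (ltW Mt).
split=> //; rewrite -(Radon_Nikodym_change_of_variables dom measurableT iphi).
by apply: eq_integral => x _; rewrite EFinM /= fineK.
Qed.

End FiniteMeasures.

Section LocalDensity.
Context {R : realType} {d m : nat}.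
Local Notation T := (borelRV R d).
Variables (Omega : set 'rV[R]_d) (mu : set 'rV[R]_d -> 'cV[R]_m).
Hypothesis mu_radon : vector_radon Omega mu.

Lemma relcompactS (A B : set 'rV[R]_d) : measurable (A : set T) -> A `<=` B ->
  relcompact Omega B -> relcompact Omega A.
Proof.
move=> mA AB [_ [K [cK KO BK]]]; split=> //; exists K; split=> //.
exact: subset_trans AB BK.
Qed.

(** The constant sequence of empty sets has convergent partial sums. *)
Lemma vector_radon0 : mu set0 = 0.
Proof.
have rel0 : relcompact Omega (\bigcup_(n : nat) (set0 : set 'rV[R]_d)).
  rewrite bigcup0//; split; first exact: measurable0.
  by exists set0; split=> //; exact: compact0.
have := @mu_radon (fun=> set0) (fun=> measurable0) (@trivIset_set0 _ _ _) rel0.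
rewrite bigcup0// => cv.
have cv1 : (fun n => \sum_(i < n.+1) mu set0) @ \oo --> mu set0.
  by have := cv; rewrite -[X in X -> _]cvg_shiftS.
have cvD : (fun n => \sum_(i < n.+1) mu set0 - \sum_(i < n) mu set0) @ \oo
    --> mu set0 - mu set0 by exact: cvgB.
have E : (fun n => \sum_(i < n.+1) mu set0 - \sum_(i < n) mu set0) =
    (fun n : nat => mu set0).
  by apply/funext => n; rewrite big_ord_recr/= addrAC subrr add0r.
move: cvD; rewrite E subrr => /cvg_lim <-//.
by rewrite lim_cst.
Qed.

Lemma vector_radon_additive (A B : set 'rV[R]_d) :
  measurable (A : set T) -> measurable (B : set T) -> A `&` B = set0 ->
  relcompact Omega (A `|` B) -> mu (A `|` B) = mu A + mu B.
Proof.
move=> mA mB AB rAB.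
have mF n : measurable (bigcup2 A B n : set T).
  by case: n => [|[|n]]//=; exact: measurable0.
have tF : trivIset setT (bigcup2 A B).
  move=> [|[|i]] [|[|j]] _ _ //=; rewrite ?AB ?(setIC B) ?AB ?set0I ?setI0 => -[x []]//.
have := @mu_radon (bigcup2 A B) mF tF; rewrite bigcup2E => /(_ rAB) cv.
have cv2 : (fun n => \sum_(i < n.+2) mu (bigcup2 A B i)) @ \oo --> mu (A `|` B).
  rewrite (_ : (fun n => _) = (fun n => \sum_(i < n + 2) mu (bigcup2 A B i)));
    last by apply/funext => n; rewrite addn2.
  by rewrite (cvg_shiftn 2 (fun N => \sum_(i < N) mu (bigcup2 A B i))).
have E : (fun n => \sum_(i < n.+2) mu (bigcup2 A B i)) = (fun n : nat => mu A + mu B).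
  apply/funext => n; rewrite big_ord_recl big_ord_recl big1 ?addr0// => i _.
  by rewrite /= vector_radon0.
move: cv2; rewrite E => /cvg_lim <-//.
by rewrite lim_cst.
Qed.

Variable K : set 'rV[R]_d.
Hypotheses (cK : compact K) (KO : K `<=` Omega).

Let mK : measurable (K : set T).
Proof. by apply: closed_borel; apply: compact_closed => //; exact: norm_hausdorff. Qed.

Lemma relcompactK (A : set T) : measurable A -> relcompact Omega (A `&` K).
Proof.
move=> mA; split; first exact: measurableI.
by exists K; split=> // x [].
Qed.

Definition local_charge (b : 'I_m) (A : set T) : \bar R := (mu (A `&` K) b 0)%:E.

Section local_charge.
Variable b : 'I_m.

Let charge0 : local_charge b set0 = 0%E.
Proof. by rewrite /local_charge set0I vector_radon0 mxE. Qed.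

Let charge_fin A : measurable A -> local_charge b A \is a fin_num.
Proof. by []. Qed.

Let charge_sigma : semi_sigma_additive (local_charge b).
Proof.
move=> F mF tF mUF.
have FK : (\bigcup_n (F n `&` K)) = (\bigcup_n F n) `&` K by rewrite setI_bigcupl.
have cv : (fun n => \sum_(i < n) mu (F i `&` K)) @ \oo --> mu (\bigcup_n (F n `&` K)).
  apply: mu_radon.
  - by move=> n; exact: measurableI.
  - exact: trivIset_setIr.
  - by rewrite FK; exact: relcompactK.
rewrite /local_charge -FK.
have -> : (fun n => (\sum_(0 <= i < n) (mu (F i `&` K) b 0)%:E)%E) =
    EFin \o (fun v : 'cV[R]_m => v b 0) \o (fun n => \sum_(i < n) mu (F i `&` K)).
  by apply/funext => n; rewrite /= summxE -sumEFin big_mkord.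
apply: cvg_EFin; first exact: nearW.
have : (fun v : 'cV[R]_m => v b 0) @ nbhs (mu (\bigcup_n (F n `&` K))) -->
    mu (\bigcup_n (F n `&` K)) b 0 by exact: coord_continuous.
exact: cvg_comp.
Qed.

HB.instance Definition _ :=
  isCharge.Build _ _ _ (local_charge b) charge0 charge_fin charge_sigma.

End local_charge.

Local Open Scope ereal_scope.

(** On Borel subsets of K the two upper variations are the parts of the Jordan
    decomposition of the charge A |-> mu_b (A & K): the supremum is attained at
    the intersection with a positive, resp. negative, set. *)
Lemma local_jordan b : exists (p n : {finite_measure set T -> \bar R}) (P N : set T),
  [/\ measurable P /\ measurable N,
      forall A : set T, measurable A -> p A = local_charge b (A `&` P) /\
        n A = - local_charge b (A `&` N),
      forall A : set T, measurable A -> local_charge b A = p A - n A,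
      forall A : set T, measurable A -> A `<=` K ->
        upper_variation Omega (fun B => (mu B b 0)%R) A = p A &
      forall A : set T, measurable A -> A `<=` K ->
        upper_variation Omega (fun B => - mu B b 0)%R A = n A].
Proof.
pose nu : {charge set T -> \bar R} := local_charge b.
have [P [N PN]] := Hahn_decomposition nu.
have [[mP _] [mN _] _ _] := PN.
pose p : {finite_measure set T -> \bar R} := jordan_pos PN.
pose n : {finite_measure set T -> \bar R} := jordan_neg PN.
have pE A : measurable A -> p A = local_charge b (A `&` P).
  move=> mA; transitivity (if A \in measurable then nu (A `&` P) else 0) => //.
  by rewrite mem_set.
have nE A : measurable A -> n A = - local_charge b (A `&` N).
  move=> mA.
  transitivity ((-1)%:E * (if A \in measurable then nu (A `&` N) else 0)) => //.
  by rewrite mem_set// mulN1e.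
have pnE A : measurable A -> local_charge b A = p A - n A.
  by move=> mA; rewrite (_ : local_charge b A = nu A)// (jordan_decomp PN mA) /cadd/= cscaleN1.
have KE (B : set T) : B `<=` K -> B `&` K = B by move=> /setIidPl.
exists p, n, P, N; split=> // [A mA|A mA AK|A mA AK]; first by rewrite pE// nE.
- apply/eqP; rewrite eq_le; apply/andP; split.
    apply: ge_ereal_sup => _ [B [rB BA] <-].
    have mB : measurable (B : set T) by have [] := rB.
    have -> : (mu B b 0)%R%:E = local_charge b B.
      by rewrite /local_charge KE//; exact: subset_trans BA AK.
    rewrite pnE// (@le_trans _ _ (p B))//.
      by rewrite leeBlDr ?fin_num_measure// leeDl.
    by apply: le_measure; rewrite ?inE.
  apply: ereal_sup_ubound; exists (A `&` P `&` K); last by rewrite pE.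
  split; last by move=> x [[]].
  by apply: relcompactK; exact: measurableI.
- apply/eqP; rewrite eq_le; apply/andP; split.
    apply: ge_ereal_sup => _ [B [rB BA] <-].
    have mB : measurable (B : set T) by have [] := rB.
    have -> : ((- mu B b 0)%R)%:E = - local_charge b B.
      by rewrite /local_charge KE//; exact: subset_trans BA AK.
    rewrite pnE// fin_num_oppeB ?fin_num_measure// (@le_trans _ _ (n B))//.
      by rewrite addeC leeBlDr ?fin_num_measure// leeDl.
    by apply: le_measure; rewrite ?inE.
  apply: ereal_sup_ubound; exists (A `&` N `&` K); last by rewrite nE.
  split; last by move=> x [[]].
  by apply: relcompactK; exact: measurableI.
Qed.

(** The measure [la] is the sum of the positive and negative parts of all
    components.  Where all densities vanish, so do all parts, hence [la] itself. *)
Lemma local_density : exists (la : {finite_measure set T -> \bar R})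
    (f : 'I_m -> T -> R),
  [/\ forall b, la.-integrable setT (EFin \o f b),
      forall phi : 'rV[R]_d -> R, continuous phi -> (forall y, ~ K y -> phi y = 0%R) ->
        forall b, la.-integrable setT (fun y => (phi y * f b y)%:E) /\
          (vector_integral Omega mu phi b 0)%R%:E = \int[la]_y (phi y * f b y)%:E,
      la.-negligible [set x | forall b, f b x = 0%R] &
      forall B, relcompact Omega B -> B `<=` K -> la B = 0 -> mu B = 0%R].
Proof.
have /choice[p Hp] := local_jordan.
have /choice[n Hn] := Hp; have {Hn} /choice[P HP] := Hn; have {HP} /choice[N H] := HP.
have /choice[q qE] := fun b => finite_measure_add (p b) (n b).
have [la laE] := finite_measure_sum q.
have mP b : measurable (P b) by have [[]] := H b.
have mN b : measurable (N b) by have [[]] := H b.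
have qla b A : q b A <= la A by rewrite laE (bigD1 b)//= leeDl// sume_ge0.
have pla b A : measurable A -> p b A <= la A.
  by move=> _; apply: le_trans (qla b A); rewrite qE leeDl.
have nla b A : measurable A -> n b A <= la A.
  by move=> _; apply: le_trans (qla b A); rewrite qE leeDr.
have /choice[gp Hgp] := fun b => real_density (pla b).
have /choice[gn Hgn] := fun b => real_density (nla b).
pose f b y : R := (gp b y - gn b y)%R.
have gpi b : la.-integrable setT (EFin \o gp b) by have [] := Hgp b.
have gni b : la.-integrable setT (EFin \o gn b) by have [] := Hgn b.
have fi b : la.-integrable setT (EFin \o f b).
  rewrite (_ : EFin \o f b = (EFin \o gp b) \- (EFin \o gn b))//.
  exact: integrableB.
have chargeE b A : measurable A -> local_charge b A = \int[la]_(x in A) (f b x)%:E.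
  move=> mA; have [_ _ + _ _] := H b; move=> ->//.
  have [_ -> // _] := Hgp b; have [_ -> // _] := Hgn b.
  rewrite -integralB//=; last 2 first.
    exact: (integrableS measurableT mA (@subsetT _ _) (gpi b)).
    exact: (integrableS measurableT mA (@subsetT _ _) (gni b)).
exists la, f; split=> //.
- move=> phi phic phiK b.
  have phim : measurable_fun (setT : set T) (phi : T -> R) by exact: continuous_borel.
  have phib : exists M, forall x, (`|phi x| <= M)%R.
    apply: bounded_of_support => //.
    have [M [_ KM]] := compact_bounded cK.
    exists (M + 2)%R => y yM; apply: phiK => Ky.
    have M1 : (M < M + 1)%R by rewrite ltrDl.
    have /(le_trans yM) : (`|y| <= M + 1)%R by exact: (KM _ M1 y Ky).
    by rewrite leNgt ltrD2l ltr1n.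
  have phibd : [bounded phi x : R^o | x in [set: T]].
    have [M HM] := phib; exists M; split; first exact: num_real.
    by move=> t Mt x _; exact: le_trans (HM x) (ltW Mt).
  have [_ _ /(_ phi phim phib)[pphi pE]] := Hgp b.
  have [_ _ /(_ phi phim phib)[nphi nE]] := Hgn b.
  have gpphi : la.-integrable setT (fun y => (phi y * gp b y)%:E).
    exact: (@integrableMr _ _ _ la setT measurableT phi (EFin \o gp b)).
  have gnphi : la.-integrable setT (fun y => (phi y * gn b y)%:E).
    exact: (@integrableMr _ _ _ la setT measurableT phi (EFin \o gn b)).
  have fE : (fun y => (phi y * f b y)%:E) =
      (fun y => (phi y * gp b y)%:E - (phi y * gn b y)%:E).
    by apply/funext => y; rewrite /f mulrBr EFinB.
  split; first by rewrite fE; exact: integrableB.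
  rewrite fE integralB//= -pE -nE mxE /signed_integral.
  have [_ _ _ uvp uvn] := H b.
  have up : \int[upper_variation Omega (fun B => (mu B b 0)%R)]_(x in [set: T]) (phi x)%:E
      = \int[p b]_x (phi x)%:E.
    by apply: (@eq_integral_carrier _ T R _ _ (K : set T)) => // x /phiK ->.
  have un : \int[upper_variation Omega (fun B => - mu B b 0)%R]_(x in [set: T]) (phi x)%:E
      = \int[n b]_x (phi x)%:E.
    by apply: (@eq_integral_carrier _ T R _ _ (K : set T)) => // x /phiK ->.
  rewrite up un EFinB !fineK//; exact: integrable_fin_num.
- pose Z : set T := [set x | forall b, f b x = 0%R].
  have mf b : measurable_fun setT (f b) by apply/measurable_EFinP; exact: measurable_int (fi b).
  have mZ : measurable Z.
    rewrite (_ : Z = \bigcap_(b in [set: 'I_m]) (f b @^-1` [set 0%R])); last first.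
      by apply/seteqP; split=> x; [move=> Zx b _; exact: Zx|move=> Zx b; exact: Zx].
    apply: fin_bigcap_measurable => // b _.
    by rewrite -[X in measurable X]setTI; apply: mf.
  exists Z; split=> //; rewrite laE big1// => b _; rewrite qE.
  have Z0 A : measurable A -> A `<=` Z -> local_charge b A = 0.
    move=> mA AZ; rewrite chargeE// integral0_eq// => x /AZ /(_ b) ->//.
  have [_ /(_ Z mZ)[-> ->] _ _ _] := H b.
  by rewrite !Z0 ?oppe0 ?adde0//; try exact: measurableI; move=> x [].
- move=> B rB BK laB; have mB : measurable (B : set T) by have [] := rB.
  apply/colP => b; rewrite mxE; apply/eqP; rewrite -eqe.
  have -> : (mu B b 0)%R%:E = local_charge b B.
    by rewrite /local_charge; congr ((mu _ b 0)%R%:E); apply/esym/setIidPl.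
  have [_ _ -> // _ _] := H b.
  have p0 : p b B = 0 by apply/eqP; rewrite eq_le measure_ge0 andbT -laB pla.
  have n0 : n b B = 0 by apply/eqP; rewrite eq_le measure_ge0 andbT -laB nla.
  by rewrite p0 n0 sube0.
Qed.

End LocalDensity.

(** * Decay of the measure around a Lebesgue point *)

Section IntegralValues.
Context {d0 : measure_display} {X : measurableType d0} {R : realType}.
Variables (mu : {measure set X -> \bar R}) (D : set X).
Hypothesis mD : measurable D.
Implicit Types (h g : X -> R) (u v : R).

Definition intval h v : Prop :=
  mu.-integrable D (EFin \o h) /\ (\int[mu]_(x in D) (h x)%:E)%E = v%:E.

Lemma intvalD h g u v : intval h u -> intval g v ->
  intval (fun x => h x + g x) (u + v).
Proof.
move=> [ih hu] [ig gv]; split; first exact: (integrableD mD ih ig).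
by under eq_integral do rewrite EFinD; rewrite integralD// hu gv.
Qed.

Lemma intvalZ c h v : intval h v -> intval (fun x => c * h x) (c * v).
Proof.
move=> [ih hv]; split; first exact: (integrableZl mD c ih).
by under eq_integral do rewrite EFinM; rewrite integralZl// hv.
Qed.

Lemma intval_eq h g v : (forall x, h x = g x) -> intval h v -> intval g v.
Proof. by move=> /funext ->. Qed.

Lemma intval0 : intval (fun=> 0) 0.
Proof. by split; [exact: integrable0|rewrite integral0]. Qed.

Lemma intval_sum (I : Type) (s : seq I) (h : I -> X -> R) (v : I -> R) :
  (forall i, intval (h i) (v i)) ->
  intval (fun x => \sum_(i <- s) h i x) (\sum_(i <- s) v i).
Proof.
move=> hv; elim: s => [|i s IH].
  by rewrite big_nil; apply: intval_eq intval0 => x; rewrite big_nil.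
rewrite big_cons; apply: (@intval_eq (fun x => h i x + \sum_(j <- s) h j x)).
  by move=> x; rewrite big_cons.
exact: intvalD.
Qed.

Lemma le_intval h g u v : (forall x, D x -> h x <= g x) ->
  intval h u -> intval g v -> u <= v.
Proof.
move=> hg [ih hu] [ig gv]; rewrite -lee_fin -hu -gv.
by apply: le_integral => // x; rewrite inE => Dx; rewrite lee_fin hg.
Qed.

End IntegralValues.

Lemma intval_restrict {d0 : measure_display} {X : measurableType d0} {R : realType}
    (mu : {measure set X -> \bar R}) (D : set X) (h : X -> R) (v : R) :
  measurable D -> (forall x, ~ D x -> h x = 0) ->
  intval mu setT h v -> intval mu D h v.
Proof.
move=> mD h0 [ih hv]; split; first exact: (integrableS measurableT).
rewrite integral_mkcond -hv; apply: eq_integral => x _.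
by rewrite patchE; case: ifPn => // /negP; rewrite inE => /h0 ->.
Qed.

Lemma common_radius {R : realFieldType} (I : finType) (Q : I -> R -> Prop) :
  (forall i, exists2 r0, 0 < r0 & forall r, 0 < r -> r < r0 -> Q i r) ->
  exists2 r0, 0 < r0 & forall r, 0 < r -> r < r0 -> forall i, Q i r.
Proof.
move=> HQ; suff [r0 r00 Hr0] : exists2 r0, 0 < r0 & forall r, 0 < r -> r < r0 ->
    forall i, i \in enum I -> Q i r.
  by exists r0 => // r rr rr0 i; apply: Hr0 => //; rewrite mem_enum.
elim: (enum I) => [|i s [r0 r00 IH]]; first by exists 1.
have [r1 r10 Hr1] := HQ i; exists (Num.min r0 r1); first by rewrite lt_min r00.
move=> r rr; rewrite lt_min => /andP[rr0 rr1] j.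
by rewrite inE => /predU1P[->|js]; [exact: Hr1|exact: IH].
Qed.

Section DecayAtPoint.
Context {R : realType} {d m k l : nat}.
Local Notation T := (borelRV R d).
Variables (Omega : set 'rV[R]_d) (P0 : 'M[R]_(k, m)) (P : 'I_d -> 'M[R]_(k, m)).
Variables (mu : set 'rV[R]_d -> 'cV[R]_m) (K : set 'rV[R]_d).
Hypotheses (KO : K `<=` Omega) (mu_solves : solves Omega P0 P mu).
Variables (la : {finite_measure set T -> \bar R}) (f : 'I_m -> T -> R).
Hypothesis f_density : forall phi : 'rV[R]_d -> R, continuous phi ->
  (forall y, ~ K y -> phi y = 0) -> forall b,
  intval la setT (fun y => phi y * f b y) (vector_integral Omega mu phi b 0).
Hypothesis f_integrable : forall b, la.-integrable setT (EFin \o f b).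
Variable x : 'rV[R]_d.
Hypothesis x_lebesgue : forall b (e : R), 0 < e -> exists2 r0 : R, 0 < r0 &
  forall r : R, 0 < r -> r < r0 ->
    (\int[la]_(y in ball x r) (`|f b y - f b x|)%:E <= e%:E * la (ball x (3 * r)))%E.
Hypothesis x_ell : (l < \dim (symbol_ker_perp P (\col_b f b x)))%N.
Variable rK : R.
Hypotheses (rK0 : 0 < rK) (xK : cball x rK `<=` K).

Let e : 'cV[R]_m := \col_b f b x.
Let L : 'M[R]_(k, d) := symbol_mx P e.
Let Lam (r : R) : R := fine (la (ball x r)).

Let LamE r : la (ball x r) = (Lam r)%:E.
Proof. by rewrite fineK// fin_num_measure//; exact: ball_borel. Qed.

Let LE a i : L a i = \sum_b P i a b * f b x.
Proof. by rewrite mxE mxE; apply: eq_bigr => b _; rewrite mxE. Qed.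

Section Field.
Variables (Phi : 'I_k -> 'rV[R]_d -> R) (M r : R).
Hypotheses (r0 : 0 < r) (rrK : r <= rK).
Hypothesis Phi_smooth : forall a, smooth (Phi a).
Hypothesis Phi_out : forall a y, 1 <= `|y| ->
  Phi a y = 0 /\ forall i, partial i (Phi a) y = 0.
Hypothesis Phi_bound : forall a y,
  `|Phi a y| <= M /\ forall i, `|partial i (Phi a) y| <= M.

Let z y := rescale r x y.

(** The contribution of the test functions [y |-> Phi a ((y - x) / r)] to the
    equation, as a function to be integrated against the scalar measure. *)
Let total (y : T) : R :=
  \sum_a \sum_i \sum_b P i a b * (partial i (Phi a) (z y) * f b y) -
  r * \sum_a \sum_b P0 a b * (Phi a (z y) * f b y).

Let out y : ~ ball x r y -> 1 <= `|z y|.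
Proof.
rewrite in_ball => /negP; rewrite -leNgt => ry.
rewrite /z /rescale normrZ ger0_norm ?invr_ge0 ?(ltW r0)// distrC.
by rewrite ler_pdivlMl// mulr1.
Qed.

Let total_out y : ~ ball x r y -> total y = 0.
Proof.
move=> /out zy; rewrite /total.
rewrite big1 ?sub0r => [|a _]; last first.
  have [_ dP] := Phi_out a zy; apply: big1 => i _; apply: big1 => b _.
  by rewrite dP mul0r mulr0.
rewrite big1 ?mulr0 ?oppr0// => a _; have [P0' _] := Phi_out a zy.
by apply: big1 => b _; rewrite P0' mul0r mulr0.
Qed.

Let ball_sub_K y : ball x r y -> K y.
Proof.
by rewrite in_ball => xy; apply: xK; rewrite in_cball (le_trans (ltW xy)).
Qed.

Let supp_a a : closure [set y | Phi a (z y) != 0] `<=` cball x r.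
Proof.
rewrite closureE; apply: smallest_sub; first exact: closed_cball.
move=> y /= /eqP Py; apply: contrapT => xy; apply: Py.
apply: (Phi_out a _).1; apply: out; apply: contra_not xy.
by rewrite in_ball in_cball => /ltW.
Qed.

Let test_a a : test_function Omega (fun y => Phi a (z y)).
Proof.
split; first exact: smooth_rescale.
- apply: (subclosed_compact _ (@compact_cball _ _ x r)) => //.
  exact: closed_closure.
- move=> y /supp_a; rewrite in_cball => xy; apply: KO; apply: xK.
  by rewrite in_cball (le_trans xy).
Qed.

Let partial_test a i y :
  partial i (fun y => Phi a (z y)) y = r^-1 * partial i (Phi a) (z y).
Proof. by apply: partial_rescale; have [_] := Phi_smooth a [::]; exact. Qed.

(** The equation paired with the rescaled test functions; multiplying by [r]
    clears the factor r^-1 of the derivatives. *)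
Lemma total_intval : intval la (ball x r : set T) total 0.
Proof.
have mT := @measurableT _ T.
apply: intval_restrict => //; first exact: ball_borel.
pose I b phi := vector_integral Omega mu phi b 0.
have Ia a b : intval la setT (fun y => Phi a (z y) * f b y) (I b (fun y => Phi a (z y))).
  apply: f_density; first by have [/(_ [::])[]] := test_a a.
  by move=> y Ky; apply: (Phi_out a _).1; apply: out; apply: contra_not Ky; exact: ball_sub_K.
have Ida a i b : intval la setT (fun y => partial i (Phi a) (z y) * f b y)
    (r * I b (partial i (fun y => Phi a (z y)))).
  have dE : (fun y : T => r * (partial i (fun y => Phi a (z y)) y * f b y)) =
      (fun y => partial i (Phi a) (z y) * f b y).
    by apply/funext => y; rewrite partial_test; field; rewrite gt_eqF.
  rewrite -dE; apply: intvalZ => //; apply: f_density.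
    by have [/(_ [:: i])[]] := test_a a.
  move=> y Ky; rewrite partial_test (_ : partial _ _ _ = 0) ?mulr0//.
  by apply: (Phi_out a _).2; apply: out; apply: contra_not Ky; exact: ball_sub_K.
have -> : 0 = \sum_a \sum_i \sum_b P i a b *
      (r * I b (partial i (fun y => Phi a (z y)))) +
    (- r) * \sum_a \sum_b P0 a b * I b (fun y => Phi a (z y)).
  rewrite [X in _ + X]mulr_sumr -big_split big1//= => a _.
  have E : \sum_i \sum_b P i a b * - I b (partial i (fun y => Phi a (z y))) +
      \sum_b P0 a b * I b (fun y => Phi a (z y)) = 0.
    have /colP/(_ a) := mu_solves (test_a a).
    rewrite [LHS]mxE [RHS]mxE summxE => E; rewrite -[RHS]E; congr (_ + _).
      apply: eq_bigr => i _; rewrite mxE; apply: eq_bigr => b _.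
      by congr (_ * _); rewrite [RHS]mxE.
    by rewrite mxE.
  transitivity (- r * (\sum_i \sum_b P i a b *
      - I b (partial i (fun y => Phi a (z y))) +
      \sum_b P0 a b * I b (fun y => Phi a (z y)))); last by rewrite E mulr0.
  rewrite mulrDr [in RHS]mulr_sumr; congr (_ + _).
  apply: eq_bigr => i _; rewrite mulr_sumr; apply: eq_bigr => b _.
  by rewrite mulrN mulrNN mulrCA.
apply: (@intval_eq _ T _ _ _ (fun y : T =>
    \sum_a \sum_i \sum_b P i a b * (partial i (Phi a) (z y) * f b y) +
    (- r) * \sum_a \sum_b P0 a b * (Phi a (z y) * f b y))).
  by move=> y; rewrite /total mulNr.
apply: intvalD => //; last apply: intvalZ => //.
  apply: intval_sum => // a; apply: intval_sum => // i; apply: intval_sum => // b.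
  by apply: intvalZ.
by apply: intval_sum => // a; apply: intval_sum => // b; apply: intvalZ.
Qed.

Let C1 : R := \sum_a \sum_i \sum_b `|P i a b|.
Let C0 : R := \sum_a \sum_b `|P0 a b|.
Let S y : R := \sum_b `|f b y - f b x|.
Let F : R := \sum_b `|f b x|.

(** Replacing f(y) by its value at the Lebesgue point costs S(y), and the
    zero-order term carries the factor [r]. *)
Lemma total_ge y : \sum_a \sum_i L a i * partial i (Phi a) (z y) <=
  total y + (M * C1 + r * M * C0) * S y + r * M * C0 * F.
Proof.
have Sb b : `|f b y - f b x| <= S y by rewrite /S (bigD1 b)//= lerDl sumr_ge0.
have Fb b : `|f b x| <= F by rewrite /F (bigD1 b)//= lerDl sumr_ge0.
pose X := \sum_a \sum_i \sum_b
  P i a b * (partial i (Phi a) (z y) * (f b y - f b x)).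
pose Y := \sum_a \sum_b P0 a b * (Phi a (z y) * f b y).
have -> : \sum_a \sum_i L a i * partial i (Phi a) (z y) = total y - X + r * Y.
  rewrite /total -/Y addrAC addrNK /X -sumrB; apply: eq_bigr => a _.
  rewrite -sumrB; apply: eq_bigr => i _; rewrite -sumrB LE mulr_suml.
  by apply: eq_bigr => b _; ring.
have Xb : `|X| <= C1 * (M * S y).
  rewrite mulr_suml (le_trans (ler_norm_sum _ _ _))// ler_sum// => a _.
  rewrite mulr_suml (le_trans (ler_norm_sum _ _ _))// ler_sum// => i _.
  rewrite mulr_suml (le_trans (ler_norm_sum _ _ _))// ler_sum// => b _.
  by rewrite !normrM ler_wpM2l// ler_pM// (Phi_bound a (z y)).2.
have Yb : `|Y| <= C0 * (M * (S y + F)).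
  rewrite mulr_suml (le_trans (ler_norm_sum _ _ _))// ler_sum// => a _.
  rewrite mulr_suml (le_trans (ler_norm_sum _ _ _))// ler_sum// => b _.
  rewrite !normrM ler_wpM2l// ler_pM// ?(Phi_bound a (z y)).1//.
  by rewrite -[f b y](subrK (f b x)) (le_trans (ler_normD _ _))// lerD.
have rY : r * Y <= r * (C0 * (M * (S y + F))).
  by rewrite ler_pM2l// (le_trans (ler_norm _)).
have NX : - X <= C1 * (M * S y).
  by rewrite (le_trans _ Xb)// -normrN ler_norm.
rewrite -addrA -[leRHS]addrA lerD2l (_ : _ * S y + _ =
  C1 * (M * S y) + r * (C0 * (M * (S y + F)))); last by ring.
exact: lerD.
Qed.

End Field.

(** The divergence of the test field is at least c (d eta)^-(l + 1) on the small
    ball and at least - 4 (l + 1) elsewhere, while its integral is nearly 0.  So the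
    mass of the small ball, times eta^-(l + 1), is at most a constant times the
    mass of [ball x (3 * r)]. *)
Lemma decay_at_point : exists C eta0 : R, [/\ 0 < C, 0 < eta0 &
  forall eta, 0 < eta -> eta <= eta0 -> exists2 r0, 0 < r0 &
    forall r, 0 < r -> r < r0 -> Lam (eta * r) <= C * eta ^+ l.+1 * Lam (3 * r)].
Proof.
have d0 : (0 < d)%N.
  rewrite (leq_trans _ (leq_trans (dimvS (subvf (symbol_ker_perp P e))) _))//.
    exact: leq_ltn_trans x_ell.
  by rewrite dimvf /dim /= mul1n.
have dR0 : 0 < d%:R :> R by rewrite ltr0n.
pose A := 4 * l.+1%:R + 2 : R.
pose c := expR (-2) / 2 ^+ l.+3 : R.
have c0 : 0 < c by rewrite divr_gt0// ?expR_gt0// exprn_gt0.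
have A0 : 0 < A by rewrite addr_gt0// mulr_gt0.
exists (A / c * d%:R ^+ l.+1), ((2 * d%:R)^-1); split.
- by rewrite mulr_gt0 ?divr_gt0// exprn_gt0.
- by rewrite invr_gt0 mulr_gt0.
move=> eta eta0 etad.
have deta : d%:R * eta <= 2^-1.
  by rewrite mulrC -ler_pdivlMr// -invfM.
have eta1 : eta <= 1.
  have e1 : eta <= d%:R * eta by apply: ler_peMl; [exact: ltW|rewrite ler1n].
  by apply: (le_trans e1); apply: (le_trans deta); rewrite invf_le1// ler1n.
have [Phi [M1 [sPhi outPhi bPhi1 lowPhi ctrPhi]]] :=
  test_field_of_rank (@symbol_ker_perp_sub _ _ _ _ P e) x_ell eta0 deta.
pose M : R := `|M1|.
have bPhi a y : `|Phi a y| <= M /\ forall i, `|partial i (Phi a) y| <= M.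
  have [b1 b2] := bPhi1 a y; split=> [|i].
    exact: le_trans b1 (ler_norm _).
  exact: le_trans (b2 i) (ler_norm _).
have M0 : 0 <= M by exact: normr_ge0.
pose C1 : R := \sum_a \sum_i \sum_b `|P i a b|.
pose C0 : R := \sum_a \sum_b `|P0 a b|.
pose F : R := \sum_b `|f b x|.
have C10 : 0 <= C1 by apply: sumr_ge0 => a _; apply: sumr_ge0 => i _; exact: sumr_ge0.
have C00 : 0 <= C0 by apply: sumr_ge0 => a _; exact: sumr_ge0.
have F0 : 0 <= F by exact: sumr_ge0.
(* B0 and D0 are chosen so that the error terms of the previous estimate are at
   most la (ball x (3 r)) each. *)
pose B0 : R := (M * C1 + M * C0) * m%:R + 1.
have B00 : 0 < B0 by rewrite ltr_wpDl// mulr_ge0// addr_ge0// mulr_ge0.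
pose eps : R := B0^-1.
have eps0 : 0 < eps by rewrite invr_gt0.
have [r1 r10 Hr1] := common_radius (fun b => x_lebesgue b eps0).
pose D0 : R := M * C0 * F + 1.
have D00 : 0 < D0 by rewrite ltr_wpDl// mulr_ge0// mulr_ge0.
pose r0 := Num.min (Num.min r1 rK) (Num.min 1 D0^-1).
exists r0; first by rewrite !lt_min r10 rK0 ltr01 invr_gt0.
move=> r rr; rewrite !lt_min => /andP[/andP[rr1 rrK] /andP[rr2 rrD]].
have mB : measurable (ball x r : set T) by exact: ball_borel.
have tot := total_intval rr (ltW rrK) sPhi outPhi.
have totge := total_ge rr bPhi.
pose S y : R := \sum_b `|f b y - f b x|.
pose dist b (y : T) : R := `|f b y - f b x|.
have dist_int b : la.-integrable (ball x r : set T) (EFin \o dist b).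
  apply: (integrableS measurableT) => //.
  have -> : EFin \o dist b = abse \o ((EFin \o f b) \- (EFin \o cst (f b x)))%E.
    by apply/funext => y.
  apply: integrable_abse; apply: integrableB => //.
  exact: finite_measure_integrable_cst.
pose v b : R := fine (\int[la]_(y in (ball x r : set T)) (dist b y)%:E).
have vE b : (\int[la]_(y in (ball x r : set T)) (dist b y)%:E)%E = (v b)%:E.
  by rewrite /v fineK//; exact: (integrable_fin_num mB (dist_int b)).
have vle b : v b <= eps * Lam (3 * r).
  by rewrite -lee_fin EFinM -LamE -vE; exact: (Hr1 r rr rr1 b).
have Sint : intval la (ball x r : set T) S (\sum_b v b).
  by apply: intval_sum => // b; split; [exact: dist_int|exact: vE].
have LamS : Lam r <= Lam (3 * r).
  rewrite -lee_fin -!LamE; apply: le_measure; rewrite ?inE//; try exact: ball_borel.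
  by apply: le_ball; rewrite ler_peMl ?(ltW rr)// ler1n.
have L30 : 0 <= Lam (3 * r) by rewrite -lee_fin -LamE measure_ge0.
pose A1 : R := c * (d%:R * eta) ^- l.+1.
have A10 : 0 < A1 by rewrite mulr_gt0// invr_gt0 exprn_gt0// mulr_gt0.
pose small : set T := ball x (eta * r).
have msmall : measurable small by exact: ball_borel.
have smallB : small `<=` ball x r.
  by apply: le_ball; rewrite ler_piMl// ltW.
have lower : intval la (ball x r : set T) (fun y => A1 * \1_small y) (A1 * Lam (eta * r)).
  apply: intvalZ => //; split.
    apply: (integrableS measurableT) => //; exact: integrable_indic.
  rewrite integral_indic// (_ : small `&` _ = small); first exact: LamE.
  exact/setIidPl.
have cstint (q : R) : intval la (ball x r : set T) (fun=> q) (q * Lam r).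
  split; first exact: finite_measure_integrable_cst.
  by rewrite integral_cst// EFinM -LamE.
have upper := intvalD mB (intvalD mB tot (intvalZ mB (M * C1 + r * M * C0) Sint))
  (cstint (r * M * C0 * F + 4 * l.+1%:R)).
have key : A1 * Lam (eta * r) <= 0 + (M * C1 + r * M * C0) * (\sum_b v b) +
    (r * M * C0 * F + 4 * l.+1%:R) * Lam r.
  apply: (le_intval mB _ lower upper) => y xy.
  have := totge y; rewrite -/C1 -/C0 -/F -/(S y).
  set t := (X in _ <= X + _ + _ -> _); rewrite -/t.
  have := lowPhi (rescale r x y); have := ctrPhi (rescale r x y).
  set div := \sum_a _; move=> ctr low ge.
  have [ys|ys] := pselect (small y); last first.
    by rewrite indicE memNset// mulr0; lra.
  rewrite indicE mem_set// mulr1.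
  have : A1 - 4 * l.+1%:R <= div.
    apply: ctr; move: ys; rewrite /small in_ball /rescale normrZ distrC => ys.
    by rewrite ger0_norm ?invr_ge0 ?(ltW rr)// ler_pdivrMl// mulrC ltW.
  lra.
have sumv : \sum_b v b <= m%:R * (eps * Lam (3 * r)).
  rewrite (le_trans (ler_sum _ (fun b _ => vle b)))// sumr_const card_ord.
  by rewrite -[leLHS]mulr_natl.
have t1 : (M * C1 + r * M * C0) * (\sum_b v b) <= Lam (3 * r).
  have MC : 0 <= M * C1 + r * M * C0 by rewrite addr_ge0 ?mulr_ge0 ?(ltW rr).
  rewrite (le_trans (ler_wpM2l MC sumv))//.
  have MC' : M * C1 + r * M * C0 <= M * C1 + M * C0.
    by rewrite lerD2l -mulrA ler_piMl ?mulr_ge0// ltW.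
  rewrite (@le_trans _ _ ((M * C1 + M * C0) * (m%:R * (eps * Lam (3 * r)))))//.
    by rewrite ler_wpM2r// !mulr_ge0// ltW.
  rewrite mulrA mulrA -[leRHS]mul1r ler_wpM2r//.
  by rewrite /eps ler_pdivrMr// mul1r lerDl.
have t2 : (r * M * C0 * F + 4 * l.+1%:R) * Lam r <= (1 + 4 * l.+1%:R) * Lam (3 * r).
  have L0 : 0 <= Lam r by rewrite -lee_fin -LamE measure_ge0.
  rewrite ler_pM// ?addr_ge0 ?mulr_ge0 ?(ltW rr)// lerD2r.
  have rD : r * D0 <= 1 by rewrite -ler_pdivlMr// div1r ltW.
  by rewrite (le_trans _ rD)// /D0 mulrDr mulr1 !mulrA ler_wpDr// ltW.
rewrite add0r in key.
have : A1 * Lam (eta * r) <= A * Lam (3 * r).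
  rewrite (le_trans key)// (le_trans (lerD t1 t2))// /A; lra.
rewrite mulrC -ler_pdivlMr// => /le_trans; apply.
rewrite /A1 invfM invrK exprMn mulrAC ler_wpM2r//.
by rewrite !mulrA.
Qed.

End DecayAtPoint.

(** * The lower bound for the dimension *)

Section HausdorffMonotone.
Context {R : realType} {d : nat}.
Implicit Types (A B : set 'rV[R]_d) (kappa delta : R).
Local Open Scope ereal_scope.

Lemma hausdorff_delta_ge0 kappa delta A : 0 <= hausdorff_delta kappa delta A.
Proof.
apply: le_ereal_inf_tmp => _ [U _ <-]; apply: nneseries_ge0 => i _ _.
exact: ediam_pow_ge0.
Qed.

Lemma hausdorff_delta_le kappa delta A : (0 < delta)%R ->
  hausdorff_delta kappa delta A <= hausdorff kappa A.
Proof. by move=> d0; apply: ereal_sup_ubound; exists delta. Qed.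

Lemma hausdorff_ge0 kappa A : 0 <= hausdorff kappa A.
Proof.
by apply: le_trans (hausdorff_delta_le kappa A (@ltr01 R)); exact: hausdorff_delta_ge0.
Qed.

Lemma hausdorff_deltaS kappa delta A B : A `<=` B ->
  hausdorff_delta kappa delta A <= hausdorff_delta kappa delta B.
Proof.
move=> AB; apply: ereal_inf_le_tmp => _ [U [BU Ud] <-]; exists U => //.
by split=> //; exact: subset_trans AB BU.
Qed.

Lemma hausdorffS kappa A B : A `<=` B -> hausdorff kappa A <= hausdorff kappa B.
Proof.
move=> AB; apply: ge_ereal_sup => _ [delta d0 <-].
exact: le_trans (hausdorff_deltaS _ _ AB) (hausdorff_delta_le _ _ d0).
Qed.

End HausdorffMonotone.

Section Variation.
Context {R : realType} {d m : nat}.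

Lemma enorm_eq0 p q (x : 'M[R]_(p, q)) : enorm x = 0 -> x = 0.
Proof.
move=> /eqP; rewrite sqrtr_eq0 => x0.
have s0 i : 0 <= \sum_j x i j ^+ 2 by apply: sumr_ge0 => j _; exact: sqr_ge0.
have x0' : \sum_i \sum_j x i j ^+ 2 = 0.
  by apply/eqP; rewrite eq_le x0/= sumr_ge0.
have xi i : \sum_j x i j ^+ 2 = 0 by exact: psumr_eq0P x0' i isT.
apply/matrixP => i j; rewrite mxE; apply/eqP; rewrite -sqrf_eq0; apply/eqP.
by apply: psumr_eq0P (xi i) j isT => k _; exact: sqr_ge0.
Qed.

Lemma radon_variation_eq0 (Omega : set 'rV[R]_d) (mu : set 'rV[R]_d -> 'cV[R]_m) B :
  (forall C, relcompact Omega C -> C `<=` B -> mu C = 0) ->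
  radon_variation Omega mu B = 0%E.
Proof.
move=> mu0; apply/eqP; rewrite eq_le; apply/andP; split.
  apply: ge_ereal_sup => _ [n [C [rC tC ->]]].
  rewrite big1// => i _; have [ri CB] := rC i; rewrite (mu0 _ ri CB).
  rewrite /enorm big1 ?sqrtr0// => a _; apply: big1 => b _.
  by rewrite mxE expr0n.
apply: ereal_sup_ubound; exists 0%N, (fun=> set0); split=> [[]//|[]//|].
by rewrite big_ord0.
Qed.

Lemma radon_variation_ge (Omega : set 'rV[R]_d) (mu : set 'rV[R]_d -> 'cV[R]_m) B :
  relcompact Omega B -> ((enorm (mu B))%:E <= radon_variation Omega mu B)%E.
Proof.
move=> rB; apply: ereal_sup_ubound; exists 1%N, (fun=> B); split.
- by move=> _; split=> //; exact: subset_refl.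
- by move=> i j _ _ _; rewrite (ord1 i) (ord1 j).
- by rewrite big_ord1.
Qed.

End Variation.

Section LowerBound.
Context {R : realType} {d m k : nat}.
Local Notation T := (borelRV R d).
Variables (Omega : set 'rV[R]_d) (P0 : 'M[R]_(k, m)) (P : 'I_d -> 'M[R]_(k, m)).
Variable mu : set 'rV[R]_d -> 'cV[R]_m.

Lemma ell_le_dim : (ell P <= d)%N.
Proof.
rewrite /ell; apply: (big_ind (fun n => (n <= d)%N)) => // [x y xd yd|n _].
  by rewrite /Order.min; case: ifP.
by rewrite -ltnS ltn_ord.
Qed.

Hypotheses (oO : open Omega) (mu_radon : vector_radon Omega mu).
Hypothesis mu_solves : solves Omega P0 P mu.
Variables (kappa : R) (A : set 'rV[R]_d).
Hypotheses (k0 : 0 < kappa) (kell : kappa < (ell P)%:R) (HA : hausdorff kappa A = 0%E).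

(** At almost every point of the null set the density is nonzero and the point is
    a Lebesgue point of all components, so that the mass of balls decays with any
    exponent below ell. *)
Lemma local_null x0 : Omega x0 -> exists2 rho, 0 < rho &
  forall B, relcompact Omega B -> B `<=` A -> B `<=` ball x0 rho -> mu B = 0.
Proof.
move=> Ox0; have /nbhs_ballP [r0 /= r00 r0O] := open_nbhs_nbhs (conj oO Ox0).
pose rho := r0 / 2; have rho0 : 0 < rho by rewrite divr_gt0.
have KO : cball x0 rho `<=` Omega.
  move=> y; rewrite in_cball => xy; apply: r0O; rewrite in_ball (le_lt_trans xy)//.
  by rewrite ltr_pdivrMr// ltr_pMr// ltr1n.
have [la [f [fint fdens fnull lanull]]] :=
  local_density mu_radon (@compact_cball _ _ x0 rho) KO.
have fint_val (phi : 'rV[R]_d -> R) : continuous phi ->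
    (forall y, ~ cball x0 rho y -> phi y = 0) -> forall b,
    intval la setT (fun y : T => phi y * f b y) (vector_integral Omega mu phi b 0).
  by move=> phic phi0 b; have [i v] := fdens phi phic phi0 b; split.
have [l lE] : exists l, ell P = l.+1.
  case E : (ell P) => [|l]; last by exists l.
  by move: kell; rewrite E ltNge (ltW k0).
pose N : set T := [set x | forall b, f b x = 0] `|` \bigcup_(b in [set: 'I_m])
  ~` [set x | forall e : R, 0 < e -> exists2 r0 : R, 0 < r0 &
    forall r : R, 0 < r -> r < r0 ->
      (\int[la]_(y in ball x r) (`|f b y - f b x|)%:E <= e%:E * la (ball x (3 * r)))%E].
have Nnull : la.-negligible N.
  apply: negligibleU => //.
  apply: (@negligibleS _ _ _ la (\bigcup_n (if insub n is Some b then
    ~` [set x | forall e : R, 0 < e -> exists2 r0 : R, 0 < r0 &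
    forall r : R, 0 < r -> r < r0 ->
      (\int[la]_(y in ball x r) (`|f (b : 'I_m) y - f b x|)%:E <=
       e%:E * la (ball x (3 * r)))%E] else set0))).
    by move=> x [b _ Hb]; exists (val b) => //; rewrite valK.
  apply: negligible_bigcup => n; case: insub => [b|]; last exact: negligible_set0.
  exact: lebesgue_points.
pose G : set T := A `&` ball x0 rho `\` N.
have HG : hausdorff kappa G = 0%E.
  apply/eqP; rewrite eq_le hausdorff_ge0 andbT -HA; apply: hausdorffS.
  by move=> x [[]].
have Gnull : la.-negligible G.
  apply: (mass_distribution k0 HG) => x [[Ax x0x] /not_orP[xf xleb]].
  have xl b (e : R) : 0 < e -> exists2 r0 : R, 0 < r0 &
      forall r : R, 0 < r -> r < r0 ->
      (\int[la]_(y in ball x r) (`|f b y - f b x|)%:E <= e%:E * la (ball x (3 * r)))%E.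
    by apply: contrapT => nb; apply: xleb; exists b => // H; exact/nb/H.
  have e0 : \col_b f b x != 0.
    apply/eqP => /colP fx; apply: xf => b.
    by have := fx b; rewrite !mxE.
  have xell : (l < \dim (symbol_ker_perp P (\col_b f b x)))%N.
    by rewrite -lE; exact: ell_le.
  have rK0 : 0 < rho - `|x0 - x| by rewrite subr_gt0 -in_ball.
  have xK : cball x (rho - `|x0 - x|) `<=` cball x0 rho.
    move=> y; rewrite !in_cball lerBrDl; apply: le_trans.
    by rewrite (_ : x0 - y = (x0 - x) + (x - y)) ?ler_normD// addrA subrK.
  have [C [eta0 [C0 eta00 dec]]] :=
    decay_at_point KO mu_solves fint_val fint xl xell rK0 xK.
  have LamE r : la (ball x r) = (fine (la (ball x r)))%:E.
    by rewrite fineK// fin_num_measure//; exact: ball_borel.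
  have := @geometric_decay R (fun r => fine (la (ball x r))) kappa C eta0 l.+1.
  case=> //.
  - by move=> r; rewrite fine_ge0.
  - move=> r s rs; rewrite -lee_fin -!LamE; apply: le_measure.
    + by rewrite inE; exact: ball_borel.
    + by rewrite inE; exact: ball_borel.
    + exact: le_ball.
  - by rewrite -lE.
  move=> C' [r1 [r10 Hr1]]; exists C', r1; split=> // r rr rr1.
  by rewrite LamE lee_fin Hr1.
exists rho => // B rB BA Bx0; apply: lanull => //.
  by move=> y /Bx0; rewrite in_ball in_cball => /ltW.
have mB : measurable (B : set T) by have [] := rB.
apply: measure_negligible => //; apply: (@negligibleS _ _ _ la (G `|` N)).
  move=> y By; have [Ny|Ny] := pselect (N y); first by right.
  by left; split=> //; split; [exact: BA|exact: Bx0].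
exact: negligibleU.
Qed.

(** Compactness leaves finitely many balls on which the local statement holds. *)
Lemma vector_radon_null B : relcompact Omega B -> B `<=` A -> mu B = 0.
Proof.
move=> rB BA; have [mB [K [cK KO BK]]] := rB.
have /choice[rho Hrho] : forall x, exists rho : R, Omega x -> 0 < rho /\
    forall B, relcompact Omega B -> B `<=` A -> B `<=` ball x rho -> mu B = 0.
  move=> x; have [/local_null[rho r0 Hr]|Ox] := pselect (Omega x).
    by exists rho.
  by exists 0.
move: cK; rewrite compact_cover => /(_ _ K (fun x => ball x (rho x)))[||D DK KD].
- by move=> x _; exact: ball_open.
- by move=> x Kx; exists x => //; apply: ballxx; have [] := Hrho x (KO _ Kx).
have DO x : x \in finmap.enum_fset D -> Omega x.
  by move=> xD; apply: KO; have := DK x; rewrite inE; exact.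
have BD : forall y, B y -> exists2 x, x \in finmap.enum_fset D & ball x (rho x) y.
  by move=> y /BK /KD[x /= xD xy]; exists x.
elim: (finmap.enum_fset D) DO B rB mB BA BD {BK DK KD} => [|x s IH] sO B rB mB BA BD.
  rewrite (_ : B = set0) ?(vector_radon0 mu_radon)//.
  by apply/seteqP; split=> // y /BD[x]; rewrite in_nil.
have mb : measurable (ball x (rho x) : set T) by exact: ball_borel.
have mB1 : measurable (B `&` ball x (rho x) : set T) by exact: measurableI.
have mB2 : measurable (B `\` ball x (rho x) : set T) by exact: measurableD.
have BE : (B `&` ball x (rho x)) `|` (B `\` ball x (rho x)) = B by rewrite setUIDK.
rewrite -BE (vector_radon_additive mu_radon)//; last 2 first.
- by apply/seteqP; split=> // y [[_ yx] [_ /(_ yx)]].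
- by rewrite BE.
have Ox : Omega x by apply: sO; rewrite inE eqxx.
have [_ Hx] := Hrho x Ox.
rewrite (Hx (B `&` ball x (rho x))); last 3 first.
- by apply: (relcompactS mB1 _ rB) => y [].
- by move=> y [/BA].
- by move=> y [].
rewrite add0r; apply: IH => //.
- by move=> y ys; apply: sO; rewrite inE ys orbT.
- by apply: (relcompactS mB2 _ rB) => y [].
- by move=> y [/BA].
- move=> y [By nyx]; have [z + zy] := BD y By.
  rewrite inE => /predU1P[zx|zs]; last by exists z.
  by move: nyx; rewrite -zx.
Qed.

End LowerBound.

Lemma dimension_lower_bound {R : realType} {d m k : nat} (Omega : set 'rV[R]_d)
    (P0 : 'M[R]_(k, m)) (P : 'I_d -> 'M[R]_(k, m)) mu :
  open Omega -> vector_radon Omega mu -> solves Omega P0 P mu ->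
  (ell P)%:R <= hdim (radon_variation Omega mu).
Proof.
move=> oO mu_radon mu_solves.
pose S : set R := [set kappa : R | 0 <= kappa <= d%:R /\
    radon_variation Omega mu `<< (hausdorff kappa : set (borelRV R d) -> \bar R)].
have Sub : has_ubound S by exists d%:R => kappa [/andP[]].
have Sin kappa : 0 < kappa -> kappa < (ell P)%:R -> S kappa.
  move=> k0 kell; split.
    by rewrite (ltW k0)/= (le_trans (ltW kell))// ler_nat ell_le_dim.
  move=> A HA B mB BA.
  have HB : hausdorff kappa B = 0%E by exact: HA.
  apply: radon_variation_eq0 => C rC CB.
  exact: (vector_radon_null oO mu_radon mu_solves k0 kell HB rC CB).
have sup0 : 0 <= sup S.
  have [[kappa Sk]|S0] := pselect (S !=set0).
    by have [/andP[k0 _] _] := Sk; apply: (le_trans k0); exact: ub_le_sup.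
  by rewrite sup_out// => -[].
change ((ell P)%:R <= sup S); rewrite leNgt; apply/negP => supS.
pose t := (sup S + (ell P)%:R) / 2.
have St : S t by apply: Sin; rewrite /t; lra.
have : t <= sup S by exact: ub_le_sup.
rewrite /t; lra.
Qed.

(** * Hausdorff measures are Borel measures *)

Section HausdorffOuterMeasure.
Context {R : realType} {d : nat}.
Implicit Types (A B U : set 'rV[R]_d) (kappa delta : R).
Local Open Scope ereal_scope.

(** Every set is measurable here, as the covers in the definition of Hausdorff
    measures consist of arbitrary sets. *)
Let allsets := g_sigma_algebraType [set: set 'rV[R]_d].

(** Sets of diameter larger than [delta] are too expensive to be used, which
    turns the constrained infimum into the outer measure induced by a set
    function. *)
Let weight kappa delta (U : set allsets) : \bar R :=
  if `[< ediam (U : set 'rV[R]_d) <= delta%:E >] then ediam_pow kappa U else +oo.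

Let weight_ge0 kappa delta U : 0 <= weight kappa delta U.
Proof. by rewrite /weight; case: asboolP => // _; exact: ediam_pow_ge0. Qed.

Lemma ediam0 : ediam (set0 : set 'rV[R]_d) = -oo.
Proof.
rewrite /ediam (_ : [set _ | _ in _ & _ in _] = set0) ?ereal_sup0//.
by apply/seteqP; split=> // r [x []].
Qed.

Lemma ediam_pow0 kappa : ediam_pow kappa (set0 : set 'rV[R]_d) = 0.
Proof. by rewrite /ediam_pow asboolT. Qed.

Let weight0 kappa delta : weight kappa delta set0 = 0.
Proof. by rewrite /weight asboolT ?ediam_pow0// ediam0 leNye. Qed.

Let hausdorff_deltaE kappa delta A :
  hausdorff_delta kappa delta A = mu_ext (weight kappa delta) (A : set allsets).
Proof.
apply/eqP; rewrite eq_le; apply/andP; split.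
  apply: le_ereal_inf_tmp => _ [U [_ AU] <-].
  have [Ud|/existsNP[i Ui]] := pselect (forall i, ediam (U i : set 'rV[R]_d) <= delta%:E).
    apply: ereal_inf_lbound; exists U => //.
    by apply: eq_eseriesr => i _; rewrite /weight asboolT.
  have wi : weight kappa delta (U i) = +oo by rewrite /weight asboolF.
  by rewrite (@nneseries_pinfty R (fun n => weight kappa delta (U n)) xpredT i
    (fun n _ => weight_ge0 _ _ _) isT wi) leey.
apply: le_ereal_inf_tmp => _ [U [AU Ud] <-]; apply: ereal_inf_lbound.
exists U; last by apply: eq_eseriesr => i _; rewrite /weight asboolT.
by split=> // i; exact: sub_sigma_algebra.
Qed.

Lemma hausdorff_delta_subadditive kappa delta :
  sigma_subadditive (hausdorff_delta kappa delta : set 'rV[R]_d -> \bar R).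
Proof.
move=> F; rewrite hausdorff_deltaE.
have := @mu_ext_sigma_subadditive _ allsets R _ (@weight_ge0 kappa delta) F.
move=> /le_trans; apply; apply: lee_nneseries => n *; rewrite -?hausdorff_deltaE//.
exact: hausdorff_delta_ge0.
Qed.

Lemma hausdorff0 kappa : hausdorff kappa (set0 : set 'rV[R]_d) = 0.
Proof.
apply/eqP; rewrite eq_le hausdorff_ge0 andbT.
apply: ge_ereal_sup => _ [delta _ <-]; rewrite hausdorff_deltaE.
by rewrite (@mu_ext0 _ allsets R _ (weight0 kappa delta) (@weight_ge0 kappa delta)).
Qed.

Lemma hausdorff_subadditive kappa :
  sigma_subadditive (hausdorff kappa : set 'rV[R]_d -> \bar R).
Proof.
move=> F; apply: ge_ereal_sup => _ [delta d0 <-].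
apply: (le_trans (hausdorff_delta_subadditive kappa delta F)).
by apply: lee_nneseries => n *; rewrite ?hausdorff_delta_ge0 ?hausdorff_delta_le.
Qed.

HB.instance Definition _ kappa := isOuterMeasure.Build R 'rV[R]_d (hausdorff kappa)
  (hausdorff0 kappa) (hausdorff_ge0 kappa) (@hausdorffS R d kappa)
  (@hausdorff_subadditive kappa).

Lemma hausdorff_delta_anti kappa delta1 delta2 A : (delta1 <= delta2)%R ->
  hausdorff_delta kappa delta2 A <= hausdorff_delta kappa delta1 A.
Proof.
move=> d12; apply: ereal_inf_le_tmp => _ [U [AU Ud] <-]; exists U => //.
by split=> // i; rewrite (le_trans (Ud i))// lee_fin.
Qed.

Lemma hausdorff_delta_separated kappa delta (s : R) A B : (delta < s)%R ->
  (forall a b, A a -> B b -> (s <= enorm (a - b))%R) ->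
  hausdorff_delta kappa delta A + hausdorff_delta kappa delta B <=
  hausdorff_delta kappa delta (A `|` B).
Proof.
move=> ds sAB; apply: le_ereal_inf_tmp => _ [U [ABU Ud] <-].
pose pick C i := if `[< C `&` U i = set0 >] then set0 else U i.
have cover C : C `<=` A `|` B ->
    hausdorff_delta kappa delta C <= \sum_(i <oo) ediam_pow kappa (pick C i).
  move=> CAB; apply: ereal_inf_lbound; exists (pick C) => //; split.
    move=> x Cx; have [i _ Ux] := ABU x (CAB x Cx); exists i => //.
    by rewrite /pick asboolF// => CU; have : set0 x by rewrite -CU.
  by move=> i; rewrite /pick; case: asboolP => // _; rewrite ediam0 leNye.
apply: (le_trans (leeD (cover A (@subsetUl _ A B)) (cover B (@subsetUr _ A B)))).
rewrite -nneseriesD; [|by move=> *; exact: ediam_pow_ge0..].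
apply: lee_nneseries => i *; first by rewrite adde_ge0// ediam_pow_ge0.
rewrite /pick; case: asboolP => [_|AU]; rewrite ?ediam_pow0 ?add0e.
  by case: asboolP => // _; rewrite ediam_pow0 ediam_pow_ge0.
case: asboolP => [_|BU]; first by rewrite ediam_pow0 adde0.
move: AU BU => /eqP/set0P[a [Aa Ua]] /eqP/set0P[b [Bb Ub]].
have := le_trans (ediam_ge Ua Ub) (Ud i); rewrite lee_fin => abd.
by have := lt_le_trans ds (le_trans (sAB a b Aa Bb) abd); rewrite ltxx.
Qed.

(** A set of diameter less than [s] meets at most one of [A] and [B], so that a
    fine cover of the union splits into covers of each. *)
Lemma hausdorff_separated kappa (s : R) A B : (0 < s)%R ->
  (forall a b, A a -> B b -> (s <= enorm (a - b))%R) ->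
  hausdorff kappa A + hausdorff kappa B <= hausdorff kappa (A `|` B).
Proof.
move=> s0 sAB; set c := hausdorff kappa (A `|` B).
have [->|coo] := eqVneq c +oo; first exact: leey.
have cfin : c \is a fin_num.
  by rewrite ge0_fin_numE ?hausdorff_ge0// lt_neqAle coo leey.
have key d1 d2 : (0 < d1)%R -> (0 < d2)%R ->
    hausdorff_delta kappa d1 A + hausdorff_delta kappa d2 B <= c.
  move=> d10 d20; pose del : R := Num.min (Num.min d1 d2) (s / 2)%R.
  have del0 : (0 < del)%R by rewrite !lt_min d10 d20 divr_gt0.
  have dels : (del < s)%R.
    rewrite (@le_lt_trans _ _ (s / 2)%R)//; first by rewrite ge_min lexx orbT.
    by rewrite ltr_pdivrMr// ltr_pMr// ltr1n.
  apply: le_trans (hausdorff_delta_le kappa (A `|` B) del0).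
  apply: le_trans (hausdorff_delta_separated kappa dels sAB).
  by apply: leeD; apply: hausdorff_delta_anti; rewrite !ge_min lexx ?orbT.
have finB d2 : (0 < d2)%R -> hausdorff_delta kappa d2 B \is a fin_num.
  move=> d20; rewrite ge0_fin_numE ?hausdorff_delta_ge0//.
  apply: (@le_lt_trans _ _ c); last by rewrite ltey_eq cfin.
  by apply: le_trans (key 1%R d2 _ d20) => //; rewrite leeDr// hausdorff_delta_ge0.
have HA d2 : (0 < d2)%R -> hausdorff kappa A + hausdorff_delta kappa d2 B <= c.
  move=> d20; rewrite -leeBrDr ?finB//.
  by apply: ge_ereal_sup => _ [d1 d10 <-]; rewrite leeBrDr ?finB// key.
have finA : hausdorff kappa A \is a fin_num.
  rewrite ge0_fin_numE ?hausdorff_ge0//.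
  apply: (@le_lt_trans _ _ c); last by rewrite ltey_eq cfin.
  by apply: le_trans (HA 1%R _) => //; rewrite leeDl// hausdorff_delta_ge0.
rewrite -leeBrDl//; apply: ge_ereal_sup => _ [d2 d20 <-].
by rewrite leeBrDl// HA.
Qed.

End HausdorffOuterMeasure.

Section HausdorffBorel.
Context {R : realType} {d : nat}.
Local Notation T := (borelRV R d).
Local Open Scope ereal_scope.
Variable kappa : R.
Local Notation H := (hausdorff kappa : set 'rV[R]_d -> \bar R).

Section sublevel.
Variable f : 'rV[R]_d -> R.
Hypothesis f_lip : forall x y, (f x - f y <= enorm (x - y))%R.

Let h (n : nat) : R := (n.+1%:R^-1)%R.

Let h_anti m n : (m <= n)%N -> (h n <= h m)%R.
Proof. by move=> mn; rewrite lef_pV2 ?posrE// ler_nat. Qed.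

Let h_lt n : (h n.+1 < h n)%R.
Proof. by rewrite ltf_pV2 ?posrE// ltr_nat. Qed.

Let shell (X : set 'rV[R]_d) (k : nat) : set 'rV[R]_d :=
  X `&` [set x | (h k.+2 < f x)%R /\ (f x <= h k.+1)%R].

Let enorm_sym (x y : 'rV[R]_d) : enorm (x - y) = enorm (y - x).
Proof.
rewrite !enorm_rVE !sqnE; congr Num.sqrt; apply: eq_bigr => i _.
by rewrite !mxE -sqrrN opprB.
Qed.

(** Every second shell: they are at positive distance from each other. *)
Let sum_shells X (e N : nat) : \sum_(j < N) H (shell X (j.*2 + e)) <= H X.
Proof.
apply: (@le_trans _ _ (H (\big[setU/set0]_(j < N) shell X (j.*2 + e)))); last first.
  apply: le_outer_measure; rewrite -(bigcup_mkord _ (fun j => shell X (j.*2 + e))) => x [j _ []]//.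
elim: N => [|N IH]; first by rewrite !big_ord0 hausdorff0.
rewrite !big_ord_recr /=; apply: (le_trans (leeD IH (lexx _))).
apply: (@hausdorff_separated _ _ _ (h (N.*2 + e) - h (N.*2 + e).+1)%R).
  by rewrite subr_gt0.
move=> a b; rewrite -(bigcup_mkord _ (fun j => shell X (j.*2 + e))) => -[j /= jN [_ [fa _]]] [_ [_ fb]].
apply: le_trans (f_lip a b); rewrite lerB// (le_trans _ (ltW fa))// h_anti//.
by rewrite -!addSn leq_add2r -doubleS leq_double.
Qed.

Let sum_even_odd (u : nat -> \bar R) N : (forall i, 0 <= u i) ->
  \sum_(i < N.*2) u i = \sum_(j < N) u j.*2 + \sum_(j < N) u (j.*2.+1).
Proof.
move=> u0; elim: N => [|N IH]; first by rewrite !big_ord0 adde0.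
by rewrite doubleS !big_ord_recr /= IH addeACA addeA.
Qed.

(** The part of [X] outside of {f <= 0} is exhausted by the sets [A n] at positive
    distance from {f <= 0}.  What [A n] misses is a union of shells, which is the
    tail of a convergent series because alternate shells are separated from each
    other. *)
Lemma caratheodory_sublevel : H.-caratheodory [set x | (f x <= 0)%R].
Proof.
apply: le_caratheodory_measurable => X; set F := [set x | _].
suff : H (X `&` F) + H (X `&` ~` F) <= H X by [].
have [->|Xoo] := eqVneq (H X) +oo; first exact: leey.
have Xfin : H X \is a fin_num by rewrite ge0_fin_numE ?hausdorff_ge0// lt_neqAle Xoo leey.
pose A n := X `&` [set x | (h n.+1 < f x)%R].
have XA n : H (X `&` F) + H (A n) <= H X.
  apply: (@le_trans _ _ (H ((X `&` F) `|` A n))).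
    apply: (@hausdorff_separated _ _ _ (h n.+1)); first by rewrite invr_gt0.
    move=> a b [_ fa] [_ fb]; rewrite enorm_sym (le_trans _ (f_lip b a))//.
    by rewrite (le_trans (ltW fb))// lerDl oppr_ge0.
  by apply: le_outer_measure => x [[]|[]].
have cover n : X `&` ~` F `<=` A n `|` \bigcup_i shell X (i + n).
  move=> x [Xx /negP]; rewrite -ltNge => fx.
  have [k hk] : exists k, (h k < f x)%R.
    exists (Num.truncn (f x)^-1).
    by rewrite /h invf_plt ?posrE//; exact: truncnS_gt.
  have := ex_minnP (ex_intro (fun k => (h k < f x)%R) k hk).
  case: ex_minnP => j hj jmin _.
  have [jn|nj] := leqP j n.+1.
    by left; split=> //; apply: le_lt_trans hj; exact: h_anti.
  right; case: j hj jmin nj => [|[|j]]// hj jmin nj.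
  exists (j - n)%N => //; rewrite subnK; last by rewrite -2!ltnS.
  split=> //; split=> //; rewrite leNgt; apply/negP => /jmin.
  by rewrite ltnn.
pose u i := H (shell X i).
have u0 i : 0 <= u i by exact: hausdorff_ge0.
have ufin : \sum_(i <oo) u i < +oo.
  apply: (@le_lt_trans _ _ (H X + H X)); last by rewrite ltey_eq fin_numD Xfin.
  apply: lime_le; first exact: is_cvg_nneseries.
  apply: nearW => n; rewrite big_mkord.
  apply: (@le_trans _ _ (\sum_(i < n.*2) u i)).
    rewrite -!(big_mkord xpredT u).
    apply: lee_sum_nneg_natr => //; rewrite -addnn; exact: leq_addr.
  rewrite sum_even_odd//; apply: leeD.
    have := sum_shells X 0 n; under eq_bigr do rewrite addn0.
    exact.
  have := sum_shells X 1 n; under eq_bigr do rewrite addn1.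
  exact.
apply/lee_addgt0Pr => e e0.
have [n tail] : exists n, \sum_(n <= i <oo) u i < e%:E.
  have := nneseries_tail_cvg ufin (fun k _ => u0 k).
  move=> /fine_cvg /cvgr_lt /(_ _ e0) [n _ /(_ n (leqnn n))] /= tn.
  exists n; rewrite -[X in X < _]fineK ?lte_fin//.
  rewrite ge0_fin_numE; last exact: nneseries_ge0.
  apply: le_lt_trans ufin; rewrite (nneseries_split 0 n)// add0n leeDr//.
  by rewrite sume_ge0.
have tailE : H (\bigcup_i shell X (i + n)) <= \sum_(n <= i <oo) u i.
  apply: (le_trans (hausdorff_subadditive kappa _)).
  by rewrite (nneseries_addn (f := u)).
apply: (@le_trans _ _ (H (X `&` F) + (H (A n) + e%:E))); last first.
  by rewrite addeA leeD2r.
apply: leeD2l; apply: (le_trans (le_outer_measure _ _ _ (cover n))).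
apply: (le_trans (outer_measureU2 _ _ _)); apply: leeD2l.
exact: le_trans tailE (ltW tail).
Qed.

End sublevel.

(** The distance to a closed set is 1-Lipschitz and vanishes on it only. *)
Lemma caratheodory_closed (C : set 'rV[R]_d) : closed C -> H.-caratheodory C.
Proof.
move=> cC; have [->|[c0 Cc0]] : C = set0 \/ C !=set0.
- by have [|/set0P] := eqVneq C set0; [left|right].
- exact: caratheodory_measurable_set0.
pose D (x : 'rV[R]_d) : set R := [set `|x - c|%R | c in C].
have D0 x : D x !=set0 by exists `|x - c0|%R; exists c0.
have Dlb x : lbound (D x) 0%R by move=> _ [c _ <-].
pose f x : R := inf (D x).
have flip x y : (f x - f y <= enorm (x - y))%R.
  rewrite lerBlDr -lerBlDl; apply: lb_le_inf => // _ [c Cc <-].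
  rewrite lerBlDl (@le_trans _ _ (`|x - c|)%R)//.
    by apply: ge_inf; [exists 0%R|exists c].
  rewrite (_ : x - c = (x - y) + (y - c))%R; last by rewrite addrA subrK.
  by rewrite (le_trans (ler_normD _ _))// lerD2r norm_le_enorm.
rewrite (_ : C = [set x | (f x <= 0)%R]); first exact: caratheodory_sublevel.
apply/seteqP; split=> x /=.
  move=> Cx; apply: ge_inf; first by exists 0%R.
  by exists x => //; rewrite subrr normr0.
move=> fx; apply: contrapT => nCx.
have oC : open (~` C) by rewrite openC.
have /nbhs_ballP [r /= r0 rC] := open_nbhs_nbhs (conj oC (nCx : (~` C) x)).
have : (r <= f x)%R.
  apply: lb_le_inf => // _ [c Cc <-]; rewrite leNgt; apply/negP => xc.
  by apply: (rC c) => //; rewrite in_ball.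
by apply/negP; rewrite -ltNge (le_lt_trans fx).
Qed.

Lemma caratheodory_borel (A : set T) : measurable A -> H.-caratheodory A.
Proof.
move: A; apply: smallest_sub => [|U oU]; last first.
  rewrite -[U]setCK; apply: caratheodory_measurable_setC.
  by apply: caratheodory_closed; rewrite closedC.
split.
- exact: caratheodory_measurable_set0.
- by move=> A cA; rewrite setTD; exact: caratheodory_measurable_setC.
- by move=> F cF; exact: caratheodory_measurable_bigcup.
Qed.

Lemma hausdorff_sigma_additive :
  semi_sigma_additive (hausdorff kappa : set T -> \bar R).
Proof.
move=> F mF tF mUF.
apply: (@caratheodory_measure_sigma_additive R 'rV[R]_d H F) => //.
- by move=> n; exact: caratheodory_borel.
- exact: caratheodory_borel.
Qed.

Definition hausdorff_measure (A : set T) : \bar R := hausdorff kappa A.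

HB.instance Definition _ := isMeasure.Build _ T R hausdorff_measure
  (hausdorff0 kappa) (hausdorff_ge0 kappa) hausdorff_sigma_additive.

Lemma ediam_translate (U : set 'rV[R]_d) v : ediam [set x + v | x in U]%R = ediam U.
Proof.
congr ereal_sup; apply/seteqP; split=> r [].
  move=> _ [x Ux <-] [_ [y Uy <-]] <-; exists x => //; exists y => //.
  by rewrite opprD addrACA subrr addr0.
move=> x Ux [y Uy <-]; exists (x + v)%R; first by exists x.
by exists (y + v)%R; [exists y|rewrite opprD addrACA subrr addr0].
Qed.

Lemma hausdorff_translate_le (A : set 'rV[R]_d) v :
  H [set x + v | x in A]%R <= H A.
Proof.
apply: ge_ereal_sup => _ [delta d0 <-].
apply: le_trans (hausdorff_delta_le kappa A d0).
apply: le_ereal_inf_tmp => _ [U [AU Ud] <-]; apply: ereal_inf_lbound.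
exists (fun i => [set x + v | x in U i]%R).
  split=> [_ [x Ax <-]|i]; last by rewrite ediam_translate.
  by have [i _ Ux] := AU x Ax; exists i => //; exists x.
apply: eq_eseriesr => i _; rewrite /ediam_pow ediam_translate.
congr (if _ then _ else _); apply/asbool_equiv_eq; split=> [|->]; last exact: image_set0.
by move=> /image_set0_set0.
Qed.

Lemma hausdorff_translate (A : set 'rV[R]_d) v : H [set x + v | x in A]%R = H A.
Proof.
apply/eqP; rewrite eq_le hausdorff_translate_le/=.
apply: le_trans (hausdorff_translate_le [set x + v | x in A]%R (- v)).
apply: le_outer_measure => x Ax; exists (x + v)%R; first by exists x.
by rewrite addrK.
Qed.

End HausdorffBorel.

(** * Hausdorff measures of linear subspaces *)

Section GridCounting.
Context {R : realType}.

Lemma mulmx_bounded n p (A : 'M[R]_(n, p)) :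
  exists2 C : R, 0 < C & forall u : 'rV[R]_n, `|u *m A| <= C * `|u|.
Proof.
exists (\sum_j \sum_i `|A i j| + 1).
  by rewrite ltr_wpDl// sumr_ge0// => j _; exact: sumr_ge0.
move=> u; apply: rV_norm_le => [|j].
  by rewrite mulr_ge0// addr_ge0// sumr_ge0// => j _; exact: sumr_ge0.
rewrite mxE (le_trans (ler_norm_sum _ _ _))//.
rewrite (@le_trans _ _ (\sum_i `|A i j| * `|u|))//.
  by apply: ler_sum => i _; rewrite normrM mulrC ler_wpM2l// rV_coord_le.
rewrite -mulr_suml ler_wpM2r// (bigD1 j)//= -addrA lerDl addr_ge0//.
by apply: sumr_ge0 => k _; exact: sumr_ge0.
Qed.

(** The indices lie in an interval of length 2 N r, which holds at most 2 N r + 1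
    integers. *)
Lemma card_close_grid (N : nat) (w r : R) : (0 < N)%N -> 1 <= N%:R * r ->
  #|[pred j : 'I_N | `|w - j%:R / N%:R| < r]|%:R <= 3 * (N%:R * r).
Proof.
move=> N0 Nr; set S := [pred j : 'I_N | _].
have NR0 : 0 < N%:R :> R by rewrite ltr0n.
have [j1 j1S|/eq_card0 ->] := pickP S; last by rewrite mulr_ge0// (le_trans ler01).
pose j0 := [arg min_(j < j1 | S j) (j : nat)].
have [j0S j0min] : S j0 /\ forall j, S j -> (j0 <= j)%N.
  by rewrite /j0; case: arg_minnP.
pose K := Num.truncn (2 * (N%:R * r)).
have KS j : S j -> (j - j0 < K.+1)%N.
  move=> jS; rewrite -(ltr_nat R) (le_lt_trans _ (truncnS_gt _))//.
  rewrite natrB ?j0min//; move: jS j0S => /= jS j0S.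
  have : `|j%:R / N%:R - j0%:R / N%:R| <= 2 * r :> R.
    rewrite (_ : _ - _ = (w - j0%:R / N%:R) - (w - j%:R / N%:R)); last by ring.
    by rewrite (le_trans (ler_normB _ _))// [2 * r]mulr_natl mulr2n lerD// ltW.
  rewrite -mulrBl normrM [X in _ * X]ger0_norm ?invr_ge0 ?(ltW NR0)//.
  by rewrite ler_pdivrMr// -mulrA [r * _]mulrC => /(le_trans (ler_norm _)).
have inj : {in S &, injective (fun j : 'I_N => inord (j - j0) : 'I_K.+1)}.
  move=> a b aS bS /(congr1 val); rewrite /= !inordK ?KS// => ab.
  by apply/val_inj => /=; rewrite -(subnK (j0min a aS)) ab subnK ?j0min.
have := leq_card_in _ _ inj; rewrite card_ord -(ler_nat R) => /le_trans; apply.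
have : K%:R <= 2 * (N%:R * r) by rewrite truncn_le mulr_ge0// (le_trans ler01).
by rewrite -[K.+1%:R]natr1; move: K%:R (N%:R * r) Nr => a b; lra.
Qed.

(** Counting the points of a fine grid in the cube: a ball of sup-norm radius [r]
    holds at most the fraction (3 r)^n of them, so the fractions must add up to
    one. *)
Lemma cube_cover n (s : seq ('rV[R]_n * R)) :
  (forall p, p \in s -> 0 < p.2) ->
  (forall u : 'rV[R]_n, (forall i, 0 <= u 0 i <= 1) ->
     exists2 p, p \in s & `|p.1 - u| < p.2) ->
  1 <= \sum_(p <- s) (3 * p.2) ^+ n.
Proof.
move=> s0 cov.
have [N N0 Ns] : exists2 N, (0 < N)%N & forall p, p \in s -> 1 <= N%:R * p.2.
  elim: s s0 {cov} => [|p s IH] s0; first by exists 1%N.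
  have [|N N0 HN] := IH; first by move=> q qs; apply: s0; rewrite inE qs orbT.
  exists (maxn N (Num.truncn p.2^-1).+1); first by rewrite leq_max N0.
  have p0 : 0 < p.2 by apply: s0; rewrite inE eqxx.
  move=> q; rewrite inE => /predU1P[->|qs].
    rewrite -[leLHS](mulVf (lt0r_neq0 p0)) ler_wpM2r ?(ltW p0)//.
    by rewrite ltW// (lt_le_trans (truncnS_gt _))// ler_nat leq_max leqnn orbT.
  rewrite (le_trans (HN q qs))// ler_wpM2r ?ler_nat ?leq_maxl//.
  by rewrite ltW// s0// inE qs orbT.
have NR0 : 0 < N%:R :> R by rewrite ltr0n.
pose pt (g : {ffun 'I_n -> 'I_N}) : 'rV[R]_n := \row_i ((g i)%:R / N%:R).
pose hit (p : 'rV[R]_n * R) (i : 'I_n) (j : 'I_N) : R := (`|p.1 0 i - j%:R / N%:R| < p.2 :> R)%R%:R.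
have hit0 (p : 'rV[R]_n * R) i j : 0 <= hit p i j by rewrite /hit ler0n.
have total : (N%:R : R) ^+ n <= \sum_(g : {ffun 'I_n -> 'I_N}) \sum_(p <- s) \prod_i hit p i (g i).
  rewrite -natrX (_ : (N ^ n)%N = \sum_(g : {ffun 'I_n -> 'I_N}) 1)%N; last first.
    by rewrite sum1_card card_ffun !card_ord.
  rewrite natr_sum; apply: ler_sum => g _.
  have [i|p ps pg] := cov (pt g).
    by rewrite mxE divr_ge0//= ler_pdivrMr// mul1r ler_nat ltnW.
  rewrite (big_rem p ps)/= big1 ?lerDl ?sumr_ge0// => [q _|i _].
    by apply: prodr_ge0.
  rewrite /hit (le_lt_trans _ pg)//.
  by have := rV_coord_le (p.1 - pt g) i; rewrite !mxE.
rewrite -(ler_pM2l (exprn_gt0 n NR0)) mulr1 (le_trans total)// exchange_big/=.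
rewrite mulr_sumr big_seq [leRHS]big_seq; apply: ler_sum => p ps.
rewrite -(bigA_distr_bigA (hit p)) -exprMn mulrCA.
have -> : (3 * (N%:R * p.2)) ^+ n = \prod_(i < n) (3 * (N%:R * p.2)).
  by rewrite prodr_const card_ord.
apply: ler_prod => i _; rewrite sumr_ge0//=.
apply: le_trans (card_close_grid (p.1 0 i) N0 (Ns p ps)).
rewrite -sum1_card natr_sum [leRHS]big_mkcond/=.
by apply: ler_sum => j _; rewrite /hit inE; case: (_ < _).
Qed.

End GridCounting.

Section HausdorffSubspace.
Context {R : realType} {d : nat}.
Implicit Types (n : nat) (kappa delta : R).

(** The side length is a parameter because bounded sets are translated into large
    cubes. *)
Definition cube n (M : R) : set 'rV[R]_n := [set u | forall i, 0 <= u 0 i <= M].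

Lemma cube_compact n M : compact (cube M : set 'rV[R]_n).
Proof.
exact: (@rV_compact R n (fun=> [set` `[0, M]]) (fun=> @segment_compact R 0 M)).
Qed.

Lemma finite_sum_le_series (x : nat -> \bar R) (s : seq nat) :
  uniq s -> (forall i, 0 <= x i)%E -> (\sum_(i <- s) x i <= \sum_(i <oo) x i)%E.
Proof.
move=> us x0; pose N := (\max_(i <- s) i).+1.
apply: (@le_trans _ _ (\sum_(0 <= i < N) x i)%E); last exact: nneseries_lim_ge.
have -> : (\sum_(i <- s) x i = \sum_(i <- index_iota 0 N | i \in s) x i)%E.
  rewrite -[RHS]big_filter; apply: perm_big; apply: uniq_perm => //.
    by rewrite filter_uniq// iota_uniq.
  move=> i; rewrite mem_filter mem_index_iota /= ltnS.
  by case: (boolP (i \in s)) => //= si; apply/esym/leq_bigmax_seq.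
by rewrite big_mkcond; apply: lee_sum => i _; case: ifP.
Qed.

(** A cover of the image of the unit cube by sets of diameters D_i pulls back to
    a cover of the cube by balls of radii little more than C D_i; compactness
    leaves finitely many of them, whose radii are controlled by grid counting. *)
Lemma hausdorff_cube_gt0 n (B : 'M[R]_(n, d)) : row_free B ->
  (0 < hausdorff n%:R [set u *m B | u in cube 1 : set 'rV[R]_n])%E.
Proof.
move=> /row_freeP[B' BB']; set Q := [set _ | _ in _].
have [C C0 HC] := mulmx_bounded B'.
have CB (u : 'rV[R]_n) : `|u| <= C * `|u *m B|.
  by have := HC (u *m B); rewrite -mulmxA BB' mulmx1.
pose K : R := (3 * C) ^+ n; have K0 : 0 < K by rewrite exprn_gt0// mulr_gt0.
apply: (@lt_le_trans _ _ ((2 * K)^-1)%:E); first by rewrite lte_fin invr_gt0 mulr_gt0.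
apply: le_trans (hausdorff_delta_le n%:R Q (@ltr01 R)).
apply: le_ereal_inf_tmp => _ [U [QU U1] <-].
pose hit i := exists u, cube 1 u /\ U i (u *m B).
pose e (i : nat) : R := (1 / 2) / (2 ^ i.+1)%:R.
have e0 i : 0 < e i by rewrite divr_gt0 ?divr_gt0// ltr0n expn_gt0.
have /choice[p Hp] : forall i, exists p : 'rV[R]_n * R, hit i -> [/\ 0 < p.2,
    (forall u, cube 1 u -> U i (u *m B) -> `|p.1 - u| < p.2) &
    (((3 * p.2) ^+ n)%:E <= K%:E * ediam_pow n%:R (U i) + (e i)%:E)%E].
  move=> i; have [[u0 [u01 Uu0]]|nh] := pselect (hit i); last by exists (0, 0).
  have [|dE d0 d1 ->] := ediam_powE n%:R _ (U1 i); first by exists (u0 *m B).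
  set D := fine _ in dE d0 d1 *.
  have [s s0 Hs] : exists2 s : R, 0 < s & (3 * (C * D + s)) ^+ n <= (3 * C * D) ^+ n + e i.
    pose g (t : R) := (3 * (C * D + t)) ^+ n.
    have gc : continuous g.
      move=> t; rewrite /g; apply: (@continuous_comp _ _ _ (fun t => 3 * (C * D + t)) (fun t => t ^+ n)).
        by apply: cvgM; [exact: cvg_cst|apply: cvgD; [exact: cvg_cst|exact: cvg_id]].
      exact: exprn_continuous.
    have : \forall t \near 0, g t < g 0 + e i.
      by apply: (cvgr_lt (g 0) (gc 0)); rewrite ltrDl.
    move=> /nbhs_ballP[r /= r0 Hr]; exists (r / 2); first by rewrite divr_gt0.
    have := Hr (r / 2); rewrite /g addr0 mulrA => /(_ _)/ltW; apply.
    rewrite /ball/= sub0r normrN ger0_norm ?divr_ge0 ?(ltW r0)//.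
    by rewrite ltr_pdivrMr// ltr_pMr// ltr1n.
  exists (u0, C * D + s) => _; split=> /=.
  - by rewrite ltr_wpDl// mulr_ge0// ltW.
  - move=> u u1 Uu; rewrite (le_lt_trans (CB _))//.
    rewrite (@le_lt_trans _ _ (C * D)) ?ltrDl//.
    rewrite ler_wpM2l ?(ltW C0)// mulmxBl (le_trans (norm_le_enorm _))//.
    by have := ediam_ge Uu0 Uu; rewrite dE lee_fin.
  - rewrite -EFinM -EFinD lee_fin powR_mulrn// /K -exprMn.
    exact: Hs.
have := @cube_compact n 1; rewrite compact_cover.
move=> /(_ nat hit (fun i => ball (p i).1 (p i).2)) [||D Dhit Dcov].
- by move=> i /Hp[p0 _ _]; exact: ball_open.
- move=> u u1; have [i _ Ui] := QU (u *m B) (ex_intro2 _ _ u u1 erefl).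
  have hi : hit i by exists u.
  by exists i => //; rewrite /= in_ball; have [_ + _] := Hp i hi; apply.
have hitD i : i \in finmap.enum_fset D -> hit i by move=> /Dhit; rewrite inE.
pose s := [seq p i | i <- finmap.enum_fset D].
have s0 q : q \in s -> 0 < q.2 by move=> /mapP[i /hitD/Hp[p0 _ _] ->].
have scov u : cube 1 u -> exists2 q, q \in s & `|q.1 - u| < q.2.
  move=> u1; have [i iD] := Dcov u u1; rewrite /= in_ball => pu.
  by exists (p i) => //; exact: map_f.
have := cube_cover s0 scov; rewrite big_map -lee_fin => h1.
have aU i : (0 <= ediam_pow n%:R (U i))%E by exact: ediam_pow_ge0.
have : (1 <= K%:E * \sum_(i <oo) ediam_pow n%:R (U i) + (1 / 2)%:E)%E.
  apply: (le_trans h1).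
  apply: (@le_trans _ _ (\sum_(i <oo) (K%:E * ediam_pow n%:R (U i) + (e i)%:E))%E).
    apply: (@le_trans _ _ (\sum_(i <- finmap.enum_fset D) (K%:E * ediam_pow n%:R (U i) + (e i)%:E))%E).
      rewrite -sumEFin big_seq [leRHS]big_seq; apply: lee_sum => i /hitD/Hp[_ _].
      exact.
    apply: finite_sum_le_series; first exact: finmap.fset_uniq.
    by move=> i; rewrite adde_ge0 ?mule_ge0// ?lee_fin ?(ltW K0)// ltW.
  apply: (le_trans (epsilon_trick _ _ _)); rewrite ?nneseriesZl//.
  by move=> i; rewrite mule_ge0// lee_fin ltW.
rewrite -leeBlDr// -EFinB (_ : 1 - 1 / 2 = K * (2 * K)^-1)%R; last first.
  by field; rewrite gt_eqF.
by rewrite EFinM lee_pmul2l// lte_fin.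
Qed.

End HausdorffSubspace.

Section HausdorffSubspaceUpper.
Context {R : realType} {d : nat}.
Implicit Types (n : nat) (kappa delta : R).

Lemma hausdorff_delta_finite (I : finType) (A : set 'rV[R]_d) (U : I -> set 'rV[R]_d)
    kappa delta (c : R) : 0 <= c ->
  (forall x, A x -> exists i, U i x) -> (forall i, (ediam (U i) <= delta%:E)%E) ->
  (forall i, (ediam_pow kappa (U i) <= c%:E)%E) ->
  (hausdorff_delta kappa delta A <= (#|I|%:R * c)%:E)%E.
Proof.
move=> c0 AU Ud Uc.
pose U' j := if insub j is Some k then U (enum_val (k : 'I_#|I|)) else set0.
apply: (@le_trans _ _ (\sum_(j <oo) ediam_pow kappa (U' j))%E).
  apply: ereal_inf_lbound; exists U' => //; split=> [x /AU[i Ux]|j].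
    by exists (enum_rank i : nat) => //; rewrite /U' valK enum_rankK.
  by rewrite /U'; case: insub => // ; rewrite ediam0 leNye.
apply: lime_le; first by apply: is_cvg_nneseries => *; exact: ediam_pow_ge0.
apply: nearW => N; rewrite big_mkord.
apply: (@le_trans _ _ ((minn N #|I|)%:R * c)%:E); last first.
  by rewrite lee_fin ler_wpM2r// ler_nat geq_minr.
elim: N => [|N IH]; first by rewrite big_ord0 min0n mul0r.
rewrite big_ord_recr/= {2}/U'; case: insubP => [k kI _|]; last first.
  rewrite -leqNgt => IN; rewrite ediam_pow0 adde0 (minn_idPr (leqW IN)).
  by rewrite (minn_idPr IN) in IH.
apply: (le_trans (leeD IH (Uc _))).
by rewrite (minn_idPl kI) (minn_idPl (ltnW kI)) -EFinD lee_fin -natr1 mulrDl mul1r.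
Qed.

(** The image of the cube is covered by those of (N + 2)^n cells of side
    M / (N + 1), the last ones for the faces where a coordinate is [M]; and
    N + 2 <= 2 (N + 1). *)
Lemma hausdorff_delta_cube n (B : 'M[R]_(n, d)) (M : R) : 0 < M ->
  exists2 c : R, 0 <= c & forall kappa (N : nat), 0 <= kappa ->
  (hausdorff_delta kappa (c / N.+1%:R) [set u *m B | u in cube M] <=
   (2 ^+ n * (N.+1%:R ^+ n * (c / N.+1%:R) `^ kappa))%:E)%E.
Proof.
move=> M0; have [C C0 HC] := mulmx_bounded B.
exists (d%:R * (C * M)); first by rewrite mulr_ge0// mulr_ge0// ltW.
move=> kappa N k0; set c := d%:R * _; set r := N.+1%:R; set delta := c / r.
have r0 : 0 < r :> R by rewrite ltr0n.
have c0 : 0 <= c by rewrite mulr_ge0// mulr_ge0// ltW.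
pose h := M / r; have h0 : 0 < h by rewrite divr_gt0.
pose cell (g : {ffun 'I_n -> 'I_N.+2}) : set 'rV[R]_n :=
  [set u | forall i, (g i)%:R * h <= u 0 i < (g i).+1%:R * h].
have cell_diam g : (ediam [set u *m B | u in cell g] <= delta%:E)%E.
  apply: ge_ereal_sup => _ [_ [u gu <-] [_ [v gv <-] <-]].
  rewrite lee_fin (le_trans (enorm_le_norm _))//.
  rewrite /delta /c -2!mulrA ler_wpM2l// -mulmxBl (le_trans (HC _))//.
  rewrite -/h ler_wpM2l ?(ltW C0)//; apply: rV_norm_le => [|i]; first exact: ltW.
  have := gu i; have := gv i; rewrite !mxE -!natr1 !mulrDl !mul1r.
  by rewrite ler_norml; move: (_ * h) => a; lra.
apply: (@le_trans _ _ (#|{ffun 'I_n -> 'I_N.+2}|%:R * delta `^ kappa)%:E); last first.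
  rewrite card_ffun !card_ord mulrA -exprMn natrX lee_fin ler_wpM2r ?powR_ge0//.
  rewrite lerXn2r ?nnegrE ?mulr_ge0 ?(ltW r0)// /r -[2]/(2%:R) -natrM ler_nat.
  by rewrite mul2n -addnn addSnnS leq_addl.
apply: (@hausdorff_delta_finite _ _ (fun g => [set u *m B | u in cell g])) => //.
- exact: powR_ge0.
- move=> _ [u uM <-].
  exists [ffun i => inord (Num.truncn (u 0 i / h))]; exists u => // i.
  have /andP[u0 u1] := uM i; have uh0 : 0 <= u 0 i / h by rewrite divr_ge0// ltW.
  rewrite ffunE inordK; last first.
    have : u 0 i / h <= r by rewrite ler_pdivrMr// /h mulrCA mulfV ?mulr1 ?gt_eqF.
    by rewrite truncn_lt_nat// => /le_lt_trans; apply; rewrite ltr_nat.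
  by rewrite -ler_pdivlMr// -ltr_pdivrMr// truncn_itv.
- move=> g; set U := [set _ | _ in _].
  have [->|/set0P U0] := eqVneq U set0; first by rewrite ediam_pow0 lee_fin powR_ge0.
  have [_ D0 Dd ->] := ediam_powE kappa U0 (cell_diam g).
  by rewrite lee_fin ge0_ler_powR// nnegrE (le_trans D0).
Qed.

End HausdorffSubspaceUpper.

Section HausdorffSubspacePieces.
Context {R : realType} {d : nat}.
Implicit Types (n : nat) (kappa delta : R) (U : {vspace 'rV[R]_d}).

Lemma hausdorff_cube_fin n (B : 'M[R]_(n, d)) (M : R) : 0 < M ->
  (hausdorff n%:R [set u *m B | u in cube M] < +oo)%E.
Proof.
move=> M0; have [c c0 Hc] := hausdorff_delta_cube B M0.
apply: (@le_lt_trans _ _ (2 ^+ n * c ^+ n)%:E); last exact: ltry.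
apply: ge_ereal_sup => _ [delta d0 <-].
pose N := Num.truncn (c / delta).
have Nd : c / N.+1%:R <= delta.
  by rewrite ler_pdivrMr// mulrC -ler_pdivrMr// ltW// truncnS_gt.
apply: (le_trans (hausdorff_delta_anti _ _ Nd)).
apply: (le_trans (Hc n%:R N _)) => //.
by rewrite powR_mulrn ?divr_ge0// -exprMn mulrCA mulfV ?mulr1.
Qed.

(** The cover by cells has total weight of order N^(n - kappa). *)
Lemma hausdorff_cube_null n (B : 'M[R]_(n, d)) (M : R) kappa : 0 < M -> n%:R < kappa ->
  hausdorff kappa [set u *m B | u in cube M] = 0%E.
Proof.
move=> M0 nk; have [c c0 Hc] := hausdorff_delta_cube B M0.
apply/eqP; rewrite eq_le hausdorff_ge0 andbT.
apply: ge_ereal_sup => _ [delta d0 <-]; apply/lee_addgt0Pr => e e0; rewrite add0e.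
have k0 : 0 <= kappa by rewrite (le_trans _ (ltW nk)).
have s0 : 0 < kappa - n%:R by rewrite subr_gt0.
pose X := 2 ^+ n * c `^ kappa / e.
have X0 : 0 <= X by rewrite divr_ge0 ?(ltW e0)// mulr_ge0 ?powR_ge0// exprn_ge0.
pose N := maxn (Num.truncn (c / delta)) (Num.truncn (X `^ (kappa - n%:R)^-1)).
set r : R := N.+1%:R; have r0 : 0 < r by rewrite ltr0n.
have Nd : c / r <= delta.
  rewrite ler_pdivrMr// mulrC -ler_pdivrMr// ltW//.
  by rewrite (lt_le_trans (truncnS_gt _))// ler_nat ltnS leq_maxl.
have Xr : X <= r `^ (kappa - n%:R).
  have -> : X = (X `^ (kappa - n%:R)^-1) `^ (kappa - n%:R).
    by rewrite -powRrM mulVf ?powRr1// gt_eqF.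
  rewrite ge0_ler_powR ?nnegrE ?powR_ge0 ?(ltW r0) ?(ltW s0)// ltW//.
  by rewrite (lt_le_trans (truncnS_gt _))// ler_nat ltnS leq_maxr.
apply: (le_trans (hausdorff_delta_anti _ _ Nd)); apply: (le_trans (Hc kappa N k0)).
rewrite lee_fin -/r powRM ?invr_ge0 ?(ltW r0)// powRV//.
have rk : r `^ kappa = r `^ (kappa - n%:R) * r ^+ n.
  by rewrite -powR_mulrn ?(ltW r0)// -powRD ?subrK// (gt_eqF r0) implybT.
have rs0 : 0 < r `^ (kappa - n%:R) by rewrite powR_gt0.
rewrite rk (_ : _ * _ = (X * e) / r `^ (kappa - n%:R)); last first.
  by rewrite /X; field; rewrite !gt_eqF ?exprn_gt0.
by rewrite ler_pdivrMr// mulrC ler_wpM2l// ltW.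
Qed.

(** Bounded parts of a subspace, on which the Hausdorff measure of its dimension
    is finite, and positive for a large bound. *)
Definition piece U (M : R) : set 'rV[R]_d := [set` U] `&` [set x | `|x| <= M].

Lemma mem_basis_mx U x : x \in U -> exists u, x = u *m basis_mx U.
Proof.
move=> xU; exists (\row_i coord (vbasis U) i x).
rewrite mul_basis_mx {1}(coord_vbasis xU).
by apply: eq_bigr => i _; rewrite mxE.
Qed.

(** The coordinates of a bounded set are bounded; a translation makes them
    nonnegative. *)
Lemma piece_sub_cube U (M : R) : exists M' v, 0 < M' /\
  piece U M `<=` [set x + v | x in [set u *m basis_mx U | u in cube M']].
Proof.
have /row_freeP[B' BB'] := row_free_basis_mx U.
have [C C0 HC] := mulmx_bounded B'.
pose a := C * `|M| + 1; have a0 : 0 < a by rewrite ltr_wpDl// mulr_ge0// ltW.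
exists (2 * a), (- (const_mx a *m basis_mx U)); split; first by rewrite mulr_gt0.
move=> x [/= xU xM]; have [u xu] := mem_basis_mx xU.
exists ((u + const_mx a) *m basis_mx U); last by rewrite mulmxDl addrK.
exists (u + const_mx a) => // i; rewrite !mxE.
have ua : `|u| <= a.
  have := HC x; rewrite xu -mulmxA BB' mulmx1 => /le_trans; apply.
  by rewrite -xu ler_wpDr// ler_wpM2l ?(ltW C0)// (le_trans xM)// ler_norm.
have := le_trans (rV_coord_le u i) ua; rewrite ler_norml => /andP[h1 h2].
by apply/andP; split; move: (u 0 i) a h1 h2 {a0 ua} => w b; lra.
Qed.

Lemma hausdorff_piece_fin U (M : R) : (hausdorff (\dim U)%:R (piece U M) < +oo)%E.
Proof.
have [M' [v [M0 /(hausdorffS (\dim U)%:R)]]] := piece_sub_cube U M.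
by rewrite hausdorff_translate => /le_lt_trans; apply; exact: hausdorff_cube_fin.
Qed.

Lemma hausdorff_piece_null U (M : R) kappa : (\dim U)%:R < kappa ->
  hausdorff kappa (piece U M) = 0%E.
Proof.
move=> Uk; have [M' [v [M0 /(hausdorffS kappa)]]] := piece_sub_cube U M.
rewrite hausdorff_translate hausdorff_cube_null// => H0.
by apply/eqP; rewrite eq_le H0 hausdorff_ge0.
Qed.

Lemma hausdorff_piece_gt0 U : exists M : R, (0 < hausdorff (\dim U)%:R (piece U M))%E.
Proof.
have [C C0 HC] := mulmx_bounded (basis_mx U); exists C.
apply: lt_le_trans (hausdorff_cube_gt0 (row_free_basis_mx U)) _.
apply: hausdorffS => _ [u u1 <-]; split; first exact: mem_mul_basis_mx.
rewrite /= (le_trans (HC u))// ler_piMr ?(ltW C0)//.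
apply: rV_norm_le => // i; have /andP[u0 u1'] := u1 i.
by rewrite ger0_norm.
Qed.

Lemma continuous_sumf (I : Type) (r : seq I) (f : I -> 'rV[R]_d -> R) :
  (forall i, continuous (f i)) -> continuous (fun x => \sum_(i <- r) f i x).
Proof.
move=> fc; elim: r => [|i r IH].
  by under eq_fun do rewrite big_nil; exact: cst_continuous.
by under eq_fun do rewrite big_cons; exact: continuous_addf.
Qed.

Lemma closed_orthv U : closed [set` orthv U].
Proof.
rewrite (_ : [set` _] = \bigcap_(y in [set` U]) ((fun x => dotp x y) @^-1` [set 0])).
  apply: closed_bigI => y _.
  have/continuous_closedP : continuous (fun x : 'rV[R]_d => dotp x y).
    apply: continuous_sumf => i; apply: continuous_mulf; last exact: cst_continuous.
    exact: coord_continuous.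
  by apply; exact: closed_eq.
apply/seteqP; split=> x /=.
  by move=> /memv_orthv xU y /xU.
by move=> xU; apply/memv_orthv => y yU; exact: (xU y yU).
Qed.

End HausdorffSubspacePieces.

(** * Hausdorff measure on a subspace as a vector measure *)

Section HausdorffOnSubspace.
Context {R : realType} {d m : nat}.
Local Notation T := (borelRV R d).
Variables (U : {vspace 'rV[R]_d}) (e : 'cV[R]_m).
Hypothesis U_closed : closed [set` U].
Local Notation H := (hausdorff (\dim U)%:R : set 'rV[R]_d -> \bar R).
Local Notation mu := (hausdorff_on (\dim U) [set` U] e).

Lemma relcompact_bounded (Omega B : set 'rV[R]_d) :
  relcompact Omega B -> exists M : R, forall x, B x -> `|x| <= M.
Proof.
move=> [_ [K [/compact_bounded cK _ BK]]].
have [M [_ HM]] := cK; exists (M + 1) => x /BK Kx.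
by apply: (HM (M + 1)) => //; rewrite ltrDl.
Qed.

Lemma hausdorff_bounded_fin (B : set 'rV[R]_d) (M : R) : (forall x, B x -> `|x| <= M) ->
  H (B `&` [set` U]) \is a fin_num.
Proof.
move=> BM; rewrite ge0_fin_numE ?hausdorff_ge0//.
apply: le_lt_trans (hausdorff_piece_fin U M); apply: hausdorffS => x [Bx Ux].
by split=> //; exact: BM.
Qed.

Let mU : measurable ([set` U] : set T). Proof. exact: closed_borel. Qed.

Lemma hausdorff_on_radon : vector_radon setT mu.
Proof.
move=> A mA tA rA; have [M HM] := relcompact_bounded rA.
have finA i : H (A i `&` [set` U]) \is a fin_num.
  by apply: (@hausdorff_bounded_fin _ M) => x Ax; apply: HM; exists i.
rewrite /hausdorff_on.
under eq_fun do rewrite -scaler_suml (sum_fine _ (fun i _ => finA _)).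
apply: cvgZr_tmp; apply: fine_cvg; rewrite fineK; last exact: hausdorff_bounded_fin HM.
rewrite setI_bigcupl.
under eq_fun do rewrite -(big_mkord xpredT (fun i => H (A i `&` [set` U]))).
apply: (@hausdorff_sigma_additive R d (\dim U)%:R (fun i => A i `&` [set` U])).
- by move=> i; apply: measurableI => //; exact: mA.
- by apply: trivIset_setIr.
- by apply: bigcupT_measurable => i; apply: measurableI => //; exact: mA.
Qed.

Lemma piece_relcompact (M : R) : relcompact setT (piece U M).
Proof.
have pE : piece U M = [set` U] `&` cball 0 M.
  by apply/seteqP; split=> x [Ux]; rewrite /= in_cball sub0r normrN.
split; first by rewrite pE; apply: measurableI => //; exact: cball_borel.
exists (cball 0 M); split=> //; first exact: compact_cball.
by rewrite pE => x [].
Qed.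

(** Absolute continuity with respect to the Hausdorff measure of the dimension of
    [U] is immediate.  It fails for larger exponents, for which the bounded pieces
    of [U] are null, although [mu] charges them. *)
Lemma hdim_hausdorff_on : e != 0 -> hdim (radon_variation setT mu) = (\dim U)%:R.
Proof.
move=> e0; set S : set R := [set kappa : R | 0 <= kappa <= d%:R /\
    radon_variation setT mu `<< (hausdorff kappa : set (borelRV R d) -> \bar R)].
have Sub : ubound S (\dim U)%:R.
  move=> kappa [_ dom]; rewrite leNgt; apply/negP => Uk.
  have [M HM] := hausdorff_piece_gt0 U.
  have rM := piece_relcompact M; have [mM _] := rM.
  have var0 : radon_variation setT mu (piece U M) = 0%E.
    apply: (dom (piece U M)) => // B _ BM.
    apply/eqP; rewrite eq_le hausdorff_ge0 andbT -(hausdorff_piece_null M Uk).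
    exact: hausdorffS.
  have := radon_variation_ge mu rM; rewrite var0 lee_fin => mu0.
  have /enorm_eq0/eqP : enorm (mu (piece U M)) = 0.
    by apply/eqP; rewrite eq_le mu0 sqrtr_ge0.
  rewrite /hausdorff_on scaler_eq0 (negbTE e0) orbF.
  rewrite (_ : piece U M `&` [set` U] = piece U M); last first.
    by rewrite setIAC setIid.
  apply/negP; rewrite gt_eqF// fine_gt0// HM/=.
  exact: hausdorff_piece_fin.
have Sell : S (\dim U)%:R.
  split.
    by rewrite ler0n ler_nat (leq_trans (dimvS (subvf _)))// dimvf /dim /= mul1n.
  move=> A HA B mB BA; have HB : H B = 0%E by exact: HA.
  apply: radon_variation_eq0 => C _ CB.
  rewrite /hausdorff_on (_ : H _ = 0%E) ?scale0r//.
  apply/eqP; rewrite eq_le hausdorff_ge0 andbT -HB; apply: hausdorffS.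
  by move=> x [/CB].
change (sup S = (\dim U)%:R); apply/eqP; rewrite eq_le; apply/andP; split.
  by apply: ge_sup => //; exists (\dim U)%:R.
by apply: ub_le_sup => //; exists (\dim U)%:R.
Qed.

End HausdorffOnSubspace.

(** * Derivatives along a subspace integrate to zero *)

Section ContinuousPartials.
Context {R : realType}.

Lemma mean_value (g dg : R -> R) : (forall s : R, is_derive s 1 g (dg s)) ->
  forall h, exists2 c, `|c| <= `|h| & g h - g 0 = h * dg c.
Proof.
move=> g' h; have gc (i : interval R) : {within [set` i], continuous g}.
  by apply: derivable_within_continuous => s _; case: (g' s).
have [h0|h0] := leP 0 h.
  have [c + ->] := MVT_segment h0 (fun s _ => g' s) (gc `[0, h]).
  rewrite in_itv/= => /andP[c0 ch]; exists c; last by rewrite subr0 mulrC.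
  by rewrite !ger0_norm.
have [c + E] := MVT_segment (ltW h0) (fun s _ => g' s) (gc `[h, 0]).
rewrite in_itv/= => /andP[ch c0]; exists c; first by rewrite !ler0_norm ?lerN2// ltW.
by rewrite -opprB E; ring.
Qed.

Context {V : normedModType R}.
Implicit Types (f : V -> R) (v w : V).

(** The increment along v + w splits into the increment along v and one along
    w, from a moving base point, which the mean value theorem turns into a value
    of the derivative along w. *)
Lemma is_derive_dirD f v w (f1 f2 : V -> R) :
  (forall x, is_derive x v f (f1 x)) -> (forall x, is_derive x w f (f2 x)) ->
  continuous f2 -> forall x, is_derive x (v + w) f (f1 x + f2 x).
Proof.
move=> f'v f'w f2c x.
have /choice[c Hc] : forall h : R, exists c : R, `|c| <= `|h| /\
    f (h *: w + (h *: v + x)) - f (h *: v + x) = h * f2 (c *: w + (h *: v + x)).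
  move=> h; have [c ch] := mean_value (is_derive_along f'w (h *: v + x)) h.
  by rewrite scale0r add0r => E; exists c.
have c0 : c h @[h --> 0^'] --> 0.
  apply/cvgr0Pnorm_lt => e e0; near=> h.
  by rewrite (le_lt_trans (Hc h).1)//; near: h; exact: dnbhs0_lt.
have id0 : (h : R) @[h --> (0 : R)^'] --> (0 : R).
  by apply/cvgr0Pnorm_lt => e e0; near=> h; near: h; exact: dnbhs0_lt.
have f2x : f2 (c h *: w + (h *: v + x)) @[h --> 0^'] --> f2 x.
  have : c h *: w + (h *: v + x) @[h --> 0^'] --> 0 *: w + (0 *: v + x).
    by apply: cvgD; [exact: cvgZr_tmp|apply: cvgD; [exact: cvgZr_tmp|exact: cvg_cst]].
  by rewrite !scale0r !add0r => l0; exact: (@cvg_comp _ _ _ (fun h : R => c h *: w + (h *: v + x)) f2 _ _ _ l0 (f2c x)).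
have [dv Ev] := f'v x.
have q : h^-1 *: ((f \o shift x) (h *: (v + w)) - f x) @[h --> 0^'] --> f1 x + f2 x.
  have fv : h^-1 *: ((f \o shift x) (h *: v) - f x) @[h --> 0^'] --> f1 x.
    by rewrite -Ev; exact: dv.
  apply: cvg_trans (cvgD fv f2x); apply: near_eq_cvg; near=> h => /=.
  have h0 : h != 0 by near: h; exact: nbhs_dnbhs_neq.
  have -> : h *: (v + w) + x = h *: w + (h *: v + x).
    by rewrite scalerDr -addrA addrCA.
  rewrite -[f (h *: w + _)](subrK (f (h *: v + x))) (Hc h).2.
  change (h^-1 * (f (h *: v + x) - f x) + f2 (c h *: w + (h *: v + x)) =
    h^-1 * (h * f2 (c h *: w + (h *: v + x)) + f (h *: v + x) - f x)).
  by field.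
split; first by apply/cvg_ex; exists (f1 x + f2 x).
exact: cvg_lim q.
Unshelve. all: by end_near.
Qed.

Lemma is_derive_dirZ f v (f1 : V -> R) (a : R) :
  (forall x, is_derive x v f (f1 x)) ->
  forall x, is_derive x (a *: v) f (a * f1 x).
Proof.
move=> f'v x; apply/is_derive1P.
have := is_derive_along f'v x.
have -> : (fun h : R => f (h *: (a *: v) + x)) = (fun h => (fun s => f (s *: v + x)) (h * a)).
  by apply/funext => h; rewrite scalerA.
move=> H; have H0 : is_derive (0 * a) (1 : R) (fun s : R => f (s *: v + x)) (f1 x).
  by have := H (0 * a); rewrite mul0r scale0r add0r.
have Ha : is_derive (0 : R) (1 : R) (fun h : R => h * a) a.
  have Hm := @is_derive_mul R R (fun h => h) (fun=> a) (0 : R) (1 : R) 1 0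
    (is_derive_id _ _) (is_derive_cst a _ _).
  by apply: (is_derive_eq Hm); rewrite mulr0 addr0 mul1r.
by rewrite mulrC; exact: (@is_derive1_comp R _ (fun h => h * a) 0 _ _ H0 Ha).
Qed.

End ContinuousPartials.

(** The coordinate directions are added one at a time. *)
Lemma is_derive_partials {R : realType} {d : nat} (f : 'rV[R]_d -> R) (v : 'rV[R]_d) :
  (forall i x, derivable f x (delta_mx 0 i)) -> (forall i, continuous (partial i f)) ->
  forall x, is_derive x v f (\sum_i v 0 i * partial i f x).
Proof.
move=> fd fc; rewrite [v]row_sum_delta.
suff H (s : seq 'I_d) x : is_derive x (\sum_(i <- s) v 0 i *: delta_mx 0 i) f
    (\sum_(i <- s) v 0 i * partial i f x).
  move=> x; have := H (index_enum _) x.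
  congr (is_derive _ _ _ _); apply: eq_bigr => i _.
  by rewrite -row_sum_delta.
elim: s x => [|i s IH] x.
  rewrite !big_nil; apply/is_derive1P.
  by under eq_fun do rewrite scaler0 add0r; exact: is_derive_cst.
rewrite !big_cons addrC [in X in is_derive _ _ _ X]addrC.
apply: (@is_derive_dirD _ _ _ _ _ (fun x => \sum_(i <- s) v 0 i * partial i f x)
  (fun x => v 0 i * partial i f x)).
- move=> y; apply: (@is_derive_dirZ _ _ f _ (partial i f)) => z.
  exact: DeriveDef.
- by apply: continuous_mulf => //; exact: cst_continuous.
Qed.

Section IntegrationOnSubspace.
Context {R : realType} {d : nat}.
Local Notation T := (borelRV R d).
Variable U : {vspace 'rV[R]_d}.
Hypothesis mU : measurable ([set` U] : set T).

Definition subspace_measure : {measure set T -> \bar R} :=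
  mrestr (hausdorff_measure (\dim U)%:R : {measure set T -> \bar R}) mU.
Local Notation sigma := subspace_measure.

Lemma subspace_measureE (A : set T) :
  sigma A = hausdorff (\dim U)%:R (A `&` [set` U]).
Proof. by []. Qed.

Lemma integrable_supported (psi : 'rV[R]_d -> R) (M C : R) :
  measurable_fun setT (psi : T -> R) -> (forall y, `|psi y| <= C) ->
  (forall y, M < `|y| -> psi y = 0) -> sigma.-integrable setT (EFin \o psi).
Proof.
move=> mpsi bpsi psi0; have mK : measurable (cball 0 M : set T) by exact: cball_borel.
have : sigma.-integrable (cball 0 M : set T) (EFin \o psi).
  apply: measurable_bounded_integrable => //.
  - rewrite subspace_measureE ltey_eq (@hausdorff_bounded_fin _ _ _ _ M)// => x.
    by rewrite in_cball sub0r normrN.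
  - exact: measurable_funS mpsi.
  - exists C; split; first exact: num_real.
    by move=> C' CC' x _; exact: le_trans (ltW CC').
move=> /(iffLR (integrable_mkcond _ mK)); congr (_.-integrable _ _).
apply/funext => x; rewrite patchE; case: ifPn => //; rewrite notin_setE => xM.
by rewrite /= psi0// ltNge; apply/negP => h; apply: xM; rewrite in_cball sub0r normrN.
Qed.

Definition translation (v : 'rV[R]_d) : T -> T := fun x : 'rV[R]_d => v + x.

Lemma translation_measurable (v : 'rV[R]_d) :
  measurable_fun setT (translation v).
Proof.
apply: (@measurability _ _ T T _ _ (@open 'rV[R]_d) erefl) => _ [B oB <-].
rewrite setTI; apply: open_borel.
have /continuousP : continuous (fun x : 'rV[R]_d => v + x).
  by move=> x; exact: (continuousD (@cst_continuous _ _ v x) (@cvg_id _ _)).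
exact.
Qed.

(** Translations by vectors of [U] preserve both [U] and the Hausdorff measure. *)
Lemma integral_translate (v : 'rV[R]_d) (f : T -> \bar R) : v \in U ->
  measurable_fun setT f -> sigma.-integrable setT (f \o (translation v)) ->
  (\int[sigma]_x (f \o (translation v)) x = \int[sigma]_x f x)%E.
Proof.
move=> vU mf fi; have mt := translation_measurable v.
have := @integral_pushforward _ _ T T R _ mt sigma setT f mf.
rewrite preimage_setT => /(_ fi measurableT) <-.
apply: (@eq_integral_carrier _ T R _ _ setT) => [A mA _|x /(_ I)//].
rewrite /pushforward !subspace_measureE -[RHS](hausdorff_translate _ _ (- v)).
congr hausdorff; apply/seteqP; split=> x.
  move=> [Ax Ux]; exists (v + x); last by rewrite addrC addKr.
  by split=> //; rewrite /= memvD.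
move=> [y [Ay Uy] <-]; split; first by rewrite /= /translation addrCA subrr addr0.
by rewrite /= memvD// memvN.
Qed.

Variable phi : 'rV[R]_d -> R.
Hypothesis phi_test : test_function setT phi.

Lemma test_function_derivable i x : derivable phi x (delta_mx 0 i).
Proof. by have [/(_ [::])[_]] := phi_test. Qed.

Lemma test_function_continuous : continuous phi.
Proof. by have [/(_ [::])[]] := phi_test. Qed.

Lemma test_function_partial_continuous i : continuous (partial i phi).
Proof. by have [/(_ [:: i])[]] := phi_test. Qed.

Lemma test_function_support : exists M : R, forall y, M < `|y| ->
  phi y = 0 /\ forall i, partial i phi y = 0.
Proof.
have [_ /compact_bounded[M [_ HM]] _] := phi_test.
have out y : M + 1 < `|y| -> phi y = 0.
  move=> yM; apply/eqP; apply: contraTT yM => yphi; rewrite -leNgt.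
  by apply: (HM (M + 1)); [rewrite ltrDl|exact: subset_closure].
exists (M + 1) => y yM; split; first exact: out.
move=> i; rewrite /partial (@near_eq_derive _ _ _ _ (cst 0)) ?derive_cst//.
near=> z; apply: out; near: z.
have : open [set z : 'rV[R]_d | M + 1 < `|z|].
  have /continuousP/(_ _ (@open_gt R (M + 1))) := @norm_continuous R 'rV[R]_d.
  by [].
by move=> oM; exact: (open_nbhs_nbhs (conj oM yM)).
Unshelve. all: by end_near.
Qed.

(** The integrals of the translates of [phi] along [v] are all equal; differentiate
    under the integral. *)
Lemma integral_directional_eq0 (v : 'rV[R]_d) : v \in U ->
  \int[sigma]_(x in setT) (\sum_i v 0 i * partial i phi x) = 0.
Proof.
move=> vU; have [M HM] := test_function_support.
pose D (x : 'rV[R]_d) := \sum_i v 0 i * partial i phi x.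
have Dc : continuous D.
  apply: continuous_sumf => i; apply: continuous_mulf; first exact: cst_continuous.
  exact: test_function_partial_continuous.
have D0 y : M < `|y| -> D y = 0.
  by move=> /HM[_ p0]; rewrite /D big1// => i _; rewrite p0 mulr0.
have [C HC] : exists C : R, forall y, `|D y| <= C.
  apply: bounded_of_support => //; exists (M + 1) => y My; apply: D0.
  by rewrite (lt_le_trans _ My)// ltrDl.
have [C1 HC1] : exists C : R, forall y, `|phi y| <= C.
  apply: bounded_of_support; first exact: test_function_continuous.
  by exists (M + 1) => y My; apply: (HM y _).1; rewrite (lt_le_trans _ My)// ltrDl.
have far (t r : R) y : r + `|t *: v| < `|y| -> r < `|t *: v + y|.
  rewrite -ltrBrDr => /lt_le_trans; apply.
  by rewrite -[y in leLHS](addKr (t *: v)) lerBlDr addrC (le_trans (ler_normD _ _))// normrN.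
pose f (t : R) : T -> R := phi \o translation (t *: v).
have f_derive (y : T) (t : R) : is_derive t (1 : R) (f^~ y) (D (t *: v + (y : 'rV[R]_d))).
  apply: (@is_derive_along R 'rV[R]_d phi v D) => x.
  by apply: is_derive_partials => i; [exact: test_function_derivable|exact: test_function_partial_continuous].
have f_partial (t : R) (y : T) : partial1of2 f t y = D (t *: v + (y : 'rV[R]_d)).
  by rewrite /partial1of2 derive1E; exact: (@derive_val _ _ _ _ _ _ _ (f_derive y t)).
have mphi : measurable_fun setT (phi : T -> R).
  by apply: continuous_borel => //; exact: test_function_continuous.
have f_int t : sigma.-integrable setT (EFin \o f t).
  apply: (@integrable_supported _ (M + `|t *: v|) C1) => [|y|y yM].
  - apply: measurableT_comp mphi _; exact: translation_measurable.
  - exact: HC1.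
  - by apply: (HM _ _).1; exact: far.
have f_const t : \int[sigma]_(x in setT) f t x = \int[sigma]_(x in setT) phi x.
  rewrite /Rintegral; congr fine.
  apply: (@integral_translate (t *: v) (EFin \o phi)).
  - by rewrite memvZ.
  - exact/measurable_EFinP.
  - exact: f_int.
(* For |t| < 1 the derivatives vanish outside of this ball, which gives the
   integrable bound for dominated convergence. *)
pose K : set T := cball 0 (M + `|v|).
have I0 : `]-1, 1[%classic (0 : R) by rewrite /= in_itv/= ltrN10 ltr01.
have := @differentiation_under_integral R _ T sigma f setT measurableT 0 (-1) 1 I0
  (fun t _ => f_int t) (fun t y _ _ => @ex_derive _ _ _ _ _ _ _ (f_derive y t)) (fun y => `|C| * \1_K y).
have C0 : 0 <= C by apply: le_trans (HC 0).
move=> H; have {}H := H (fun y => mulr_ge0 (normr_ge0 _) (ler0n _ _)).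
have G_int : sigma.-integrable setT (EFin \o (fun y => `|C| * \1_K y)).
  apply: (@integrable_supported _ (M + `|v|) C) => [|y|y yM].
  - by apply: measurable_funM => //; apply: measurable_indic; exact: cball_borel.
  - by rewrite ger0_norm ?mulr_ge0// ger0_norm// ler_piMr.
  - rewrite indicE memNset ?mulr0// /K => /=; rewrite in_cball sub0r normrN.
    by apply/negP; rewrite -ltNge.
have {}H := H G_int.
have : forall t y, `]-1, 1[%classic t -> setT y -> `|partial1of2 f t y| <= `|C| * \1_K y.
  move=> t y; rewrite /= in_itv/= => /andP[t1 t2] _; rewrite f_partial indicE.
  have [yK|yK] := boolP (y \in K).
    by rewrite mulr1 (le_trans (HC _))// ler_norm.
  rewrite D0 ?normr0 ?mulr0//; apply: far.
  move: yK; rewrite notin_setE /K => /=; rewrite in_cball sub0r normrN => /negP.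
  rewrite -ltNge; apply: le_lt_trans.
  by rewrite lerD2l normrZ ler_piMl// ler_norml ltW//= ltW.
move=> /H; under eq_fun do rewrite f_const; rewrite derive1_cst => /esym.
rewrite /Rintegral => h; rewrite -[RHS]h; congr fine; apply: eq_integral => x _.
by rewrite f_partial scale0r add0r.
Qed.

End IntegrationOnSubspace.

(** * Sharpness *)

Section VectorIntegralOnSubspace.
Context {R : realType} {d m : nat}.
Local Notation T := (borelRV R d).
Variable U : {vspace 'rV[R]_d}.
Hypothesis mU : measurable ([set` U] : set T).
Local Notation sigma := (subspace_measure mU).
Local Notation H := (hausdorff (\dim U)%:R : set 'rV[R]_d -> \bar R).

(** The supremum is attained at [A] when [c] is positive and at the empty set
    otherwise. *)
Lemma upper_variation_subspace (c : R) A : relcompact setT A ->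
  upper_variation setT (fun B => fine (H (B `&` [set` U])) * c) A =
  ((Num.max c 0)%:E * sigma A)%E.
Proof.
move=> rA; have [M AM] := relcompact_bounded rA.
have fin B : B `<=` A -> H (B `&` [set` U]) \is a fin_num.
  by move=> BA; apply: (@hausdorff_bounded_fin _ _ _ _ M) => x /BA; exact: AM.
have c0 : 0 <= Num.max c 0 by rewrite le_max lexx orbT.
rewrite subspace_measureE -[H _]fineK ?fin// -EFinM.
apply/eqP; rewrite eq_le; apply/andP; split.
  apply: ge_ereal_sup => _ [B [_ BA] <-]; rewrite lee_fin mulrC.
  apply: (@le_trans _ _ (Num.max c 0 * fine (H (B `&` [set` U])))).
    by rewrite ler_wpM2r ?fine_ge0 ?hausdorff_ge0// le_max lexx.
  rewrite ler_wpM2l// fine_le ?fin//; apply: hausdorffS => x [Bx Ux].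
  by split=> //; exact: BA.
have [c00|c00] := leP c 0.
  rewrite mul0r; apply: ereal_sup_ubound; exists set0.
    by split=> //; apply: relcompactS rA => //; exact: measurable0.
  by rewrite set0I hausdorff0 mul0r.
by apply: ereal_sup_ubound; exists A; [split|rewrite mulrC].
Qed.

Lemma fine_integral_mscale (k : {nonneg R}) (psi : T -> R) :
  sigma.-integrable setT (EFin \o psi) ->
  fine (\int[mscale k sigma]_x (psi x)%:E) = k%:num * \int[sigma]_(x in setT) psi x.
Proof.
move=> ipsi; have mpsi := measurable_int _ ipsi.
rewrite integralE.
rewrite (ge0_integral_mscale _ measurableT k (measurable_funepos mpsi))//.
rewrite (ge0_integral_mscale _ measurableT k (measurable_funeneg mpsi))//.
have ip := integrable_pos_fin_num measurableT ipsi.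
have iN := integrable_neg_fin_num measurableT ipsi.
rewrite /Rintegral (integralE _ _ (fun x => (psi x)%:E)).
by rewrite -(fineK ip) -(fineK iN) -!EFinM -!EFinB/= mulrBr.
Qed.

(** The upper variations of a component [e b 0 * sigma] and of its opposite are the
    positive and the negative part of [e b 0], times [sigma]. *)
Lemma vector_integral_subspace (e : 'cV[R]_m) (psi : 'rV[R]_d -> R) (M C : R) :
  measurable_fun setT (psi : T -> R) -> (forall y, `|psi y| <= C) ->
  (forall y, M < `|y| -> psi y = 0) ->
  vector_integral setT (hausdorff_on (\dim U) [set` U] e) psi =
  (\int[sigma]_(x in setT) psi x) *: e.
Proof.
move=> mpsi bpsi psi0; have ipsi := integrable_supported mU mpsi bpsi psi0.
have part (c : R) : fine (\int[upper_variation setT (fun B => fine (H (B `&` [set` U])) * c)]_(x in [set: T])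
    (psi x)%:E) = Num.max c 0 * \int[sigma]_(x in setT) psi x.
  have c0 : 0 <= Num.max c 0 by rewrite le_max lexx orbT.
  rewrite -(fine_integral_mscale (NngNum c0) ipsi); congr fine.
  apply: (@eq_integral_carrier _ T R _ _ (cball 0 M)) => [A mA AM|x xM].
    rewrite upper_variation_subspace//; split=> //; exists (cball 0 M).
    by split=> //; exact: compact_cball.
  rewrite psi0// ltNge; apply/negP => h; apply: xM.
  by rewrite in_cball sub0r normrN.
apply/colP => b; rewrite !mxE /signed_integral.
rewrite (_ : (fun B => hausdorff_on (\dim U) [set` U] e B b 0) =
  (fun B => fine (H (B `&` [set` U])) * e b 0)); last first.
  by apply/funext => B; rewrite !mxE.
rewrite (_ : (fun B => - hausdorff_on (\dim U) [set` U] e B b 0) =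
  (fun B => fine (H (B `&` [set` U])) * - e b 0)); last first.
  by apply/funext => B; rewrite !mxE mulrN.
rewrite !part -mulrBl mulrC; congr (_ * _).
by have [h|h] := leP (e b 0) 0; have [h'|h'] := leP (- e b 0) 0; lra.
Qed.

End VectorIntegralOnSubspace.

Section Sharpness.
Context {R : realType} {d m k : nat}.
Variables (P0 : 'M[R]_(k, m)) (P : 'I_d -> 'M[R]_(k, m)) (e : 'cV[R]_m).
Local Notation U := (symbol_ker_perp P e).

(** The kernel of a matrix is orthogonal to its rows. *)
Lemma symbol_mx_row_mem a : row a (symbol_mx P e) \in U.
Proof.
apply/memv_orthv => y /memv_symbol_ker Py.
have /colP/(_ a) := Py; rewrite symbol_mxE mxE => <-.
by rewrite /dotp; apply: eq_bigr => i _; rewrite mxE mulrC.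
Qed.

(** Component [a] of the equation is the integral of the derivative of the test
    function along row [a] of [symbol_mx P e], a vector of [U], up to sign. *)
Lemma hausdorff_on_solves : P0 *m e = 0 ->
  solves setT P0 P (hausdorff_on (\dim U) [set` U] e).
Proof.
move=> P0e phi phi_test.
have mU : measurable ([set` U] : set (borelRV R d)).
  by apply: closed_borel; exact: closed_orthv.
have [M HM] := test_function_support phi_test.
have ev (psi : 'rV[R]_d -> R) : continuous psi -> (forall y, M < `|y| -> psi y = 0) ->
    (exists C : R, forall y, `|psi y| <= C).
  move=> psic psi0; apply: bounded_of_support => //.
  by exists (M + 1) => y My; apply: psi0; rewrite (lt_le_trans _ My)// ltrDl.
pose sigma := subspace_measure mU.
have vE (psi : 'rV[R]_d -> R) : continuous psi -> (forall y, M < `|y| -> psi y = 0) ->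
  vector_integral setT (hausdorff_on (\dim U) [set` U] e) psi =
  (\int[sigma]_(x in setT) psi x) *: e.
  move=> psic psi0; have [C HC] := ev psi psic psi0.
  by apply: (vector_integral_subspace _ _ _ HC psi0); exact: continuous_borel.
rewrite vE; [|exact: test_function_continuous|by move=> y /HM[]].
rewrite -scalemxAr P0e scaler0 addr0.
pose s : 'rV[R]_d := \row_i \int[sigma]_(x in setT) partial i phi x.
have pc i := test_function_partial_continuous phi_test i.
have p0 i y : M < `|y| -> partial i phi y = 0 by move=> /HM[_].
transitivity (- (symbol P s *m e)).
  rewrite /symbol mulmx_suml -sumrN; apply: eq_bigr => i _.
  by rewrite (vE _ (pc i) (p0 i)) mulmxN -scalemxAr -scalemxAl mxE.
apply/eqP; rewrite oppr_eq0; apply/eqP/colP => a; rewrite symbol_mxE mxE.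
rewrite -[RHS](integral_directional_eq0 mU phi_test (symbol_mx_row_mem a)).
have iv i : intval sigma setT (partial i phi) (s 0 i).
  have [C HC] := ev (partial i phi) (pc i) (p0 i).
  have ip : sigma.-integrable setT (EFin \o partial i phi).
    by apply: (integrable_supported mU _ HC (p0 i)); exact: (continuous_borel (pc i) measurableT).
  split=> //; rewrite mxE /Rintegral fineK//.
  exact: integrable_fin_num.
have := intval_sum measurableT (index_enum _) (fun i => intvalZ measurableT (symbol_mx P e a i) (iv i)).
move=> [_ E]; rewrite /Rintegral.
transitivity (fine (\sum_i symbol_mx P e a i * s 0 i)%:E).
  by apply: eq_bigr => i _; rewrite mulrC.
rewrite -E; congr fine; apply: eq_integral => x _; congr EFin.
by apply: eq_bigr => i _; rewrite [in RHS]mxE.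
Qed.

End Sharpness.

Theorem theorem1 (R : realType) (d m k : nat) (Omega : set 'rV[R]_d)
    (P0 : 'M[R]_(k, m)) (P : 'I_d -> 'M[R]_(k, m)) :
  (open Omega -> forall mu : set 'rV[R]_d -> 'cV[R]_m,
     vector_radon Omega mu -> solves Omega P0 P mu ->
     (ell P)%:R <= hdim (radon_variation Omega mu)) /\
  (forall e : 'cV[R]_m, e != 0 -> \dim (symbol_ker_perp P e) = ell P ->
     let mu := hausdorff_on (ell P) [set` symbol_ker_perp P e] e in
     [/\ vector_radon setT mu,
         hdim (radon_variation setT mu) = (ell P)%:R &
         P0 *m e = 0 -> solves setT P0 P mu]).
Proof.
split=> [oO mu|e e0 dimE]; first exact: dimension_lower_bound.
have cU := @closed_orthv R d (symbol_ker P e).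
rewrite -dimE /=; split.
- exact: hausdorff_on_radon.
- exact: hdim_hausdorff_on.
- exact: hausdorff_on_solves.
Qed.
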